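(* Let $K\subset\mathbb{R}^2$ be a compact strictly convex set with $0$ in its interior, such that $\partial K$ is $C^{k,\alpha}$ ($k\ge 2$, $0\le\alpha\le 1$), with positive curvature except at a finite number of points. Let $U\subset\mathbb{R}^2$ be a bounded open set with piecewise $C^{k,\alpha}$ boundary (in the sense of the context) satisfying the Boundary Assumption of the context, and suppose that $\partial U$ only has nonreentrant corners. Let $x\in U\setminus R_{K,0}$, and let $y=y(x)$ be the unique $d_K$-closest point to $x$ on $\partial U$. If $$\kappa_K(y(x))\,d_K(x)\neq 1,$$ then $d_K$ is $C^{k,\alpha}$ around $x$. Furthermore, if $\nu$ is an inward normal to $\partial U$ at $y$ and $\zeta$ is a unit vector orthogonal to the segment $]x,y[$, then $$Dd_K(x)=\frac{\nu}{\gamma^\circ(\nu)},\qquad \Delta d_K(x)=\frac{-\kappa(y)\,|\nu|^3\,|D\gamma^\circ(\nu)|^2}{\gamma^\circ(\nu)^3\,\bigl(1-\kappa_K(y)d_K(x)\bigr)},$$ $$D^2_{vw}d_K(x)=\Delta d_K(x)\,\langle v,\zeta\rangle\langle w,\zeta\rangle$$ for arbitrary vectors $v,w\in\mathbb{R}^2$. Here $\kappa$ is the ordinary curvature and $\kappa_K$ is the $K$-curvature of $\partial U$.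
   Context: **Gauge functions.** For a compact convex $K\subset\mathbb{R}^2$ with $0$ in its interior, $\gamma(x)=\gamma_K(x):=\inf\{\lambda>0: x\in\lambda K\}$; the polar is $K^\circ:=\{x:\langle x,y\rangle\le 1\ \text{for all } y\in K\}$; and $\gamma^\circ:=\gamma_{K^\circ}$. Strictly convex means $\partial K$ contains no line segment. $C^{k,\alpha}$ regularity is understood to include $C^\infty$ and real-analytic regularity. $\{\mu_1,\dots,\mu_m\}$ denotes the set of outward unit normals to $\partial K$ at the finitely many points where the curvature of $\partial K$ vanishes. Under the hypotheses, $\gamma^\circ$ is $C^1$ on $\mathbb{R}^2\setminus\{0\}$ and $C^{k,\alpha}$ on $\mathbb{R}^2\setminus\{t\mu_i: t\ge 0,\ i=1,\dots,m\}$. **Distance.** $d_K(x)=d_K(x,\partial U):=\min_{y\in\partial U}\gamma(x-y)$. A point $y\in\partial U$ with $d_K(x)=\gamma(x-y)$ is called a $d_K$-closest point to $x$ on $\partial U$. $R_{K,0}$ is the set of points of $U$ with more than one $d_K$-closest point on $\partial U$. $]x,y[$ is the open segment between $x$ and $y$. **Boundary of $U$.** $\partial U$ is a union of simple closed Jordan curves consisting of arcs $S_1,\dots,S_N$ which are $C^{k,\alpha}$ up to their endpoints; topologically $U$ is the interior of a disk from which, possibly, several disks are removed. If $S_i\cap S_j$ ($i\ne j$) is nonempty it consists of a single point, called a corner (vertex). A corner is nonreentrant if its opening angle (measured inside $U$) is less than $\pi$, and reentrant if it is $\ge\pi$. Opening angles are strictly between $0$ and $2\pi$. **Boundary Assumption.**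 Let $y\in S_i$ be an interior point of $S_i$ or a reentrant corner. If the inward unit normal to $S_i$ at $y$ belongs to $\{\mu_1,\dots,\mu_m\}$, then either the curvature of $S_i$ at $y$ is positive, or $S_i$ is a line segment. **Curvatures.** Write $v^\perp:=(-v_2,v_1)$. For a $C^2$ curve $t\mapsto(x(t),y(t))$ let $\nu:=(-y',x')$, assumed nonzero. The ordinary curvature is $\kappa=\langle\nu',\nu^\perp\rangle/|\nu|^3$. If $\nu$ is not a positive multiple of any $\mu_i$, the $K$-curvature is $\kappa_K:=\frac{1}{|\nu|^2}\langle D^2\gamma^\circ(\nu)\nu',\nu^\perp\rangle$; if the curve is a line segment and $\nu\equiv c\mu_i$ for some $c>0$, then $\kappa_K\equiv 0$. Both are independent of (orientation preserving) parametrization. For $\partial U$, the orientation is chosen so that $\nu$ points into $U$. *)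

(* Defs.v *)
From HB Require Import structures.
From mathcomp Require Import all_boot all_order all_algebra all_fingroup.
From mathcomp Require Import all_classical all_reals all_analysis.

Set Implicit Arguments.
Unset Strict Implicit.
Unset Printing Implicit Defensive.

Import Order.TTheory GRing.Theory Num.Theory.
Import numFieldNormedType.Exports.

Local Open Scope classical_set_scope.
Local Open Scope ring_scope.

(* [Holder k alpha] is $C^{k,\alpha}$, and $C^k$ when [alpha = 0]. *)
Inductive regularity (R : realType) :=
  | Holder of nat & R
  | Smooth
  | Analytic.
Arguments Smooth {R}.
Arguments Analytic {R}.

Definition admissible (R : realType) (s : regularity R) : Prop :=
  if s is Holder k alpha then (2 <= k)%N /\ 0 <= alpha <= 1 else True.

Section Classes.
Variables (R : realType) (V W : normedModType R).
Implicit Types (f : V -> W) (A : set V) (vs : seq V).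

Definition iterD f vs : V -> W := foldr (fun v g => 'D_v g) f vs.

(* On a finite-dimensional [V], quantifying over lists of arbitrary directions
   amounts to asking for all partial derivatives. Curves are the case [V := R].
   These classes are only meant for open [A]. *)
Definition Ck k A f : Prop := forall vs a, (size vs <= k)%N -> A a ->
  {for a, continuous (iterD f vs)} /\
  ((size vs < k)%N -> forall v, derivable (iterD f vs) a v).

Definition locally_Holder (alpha : R) A f : Prop := forall a, A a ->
  exists C : R, \forall u \near a & w \near a,
    `|f u - f w| <= C * `|u - w| `^ alpha.

(* The j-th term of the Taylor series at [a] is $D^jf(a)[h,\dots,h]/j!$. *)
Definition taylor_converges A f : Prop := forall a, A a ->
  \forall h \near (0 : V),
    (fun n : nat => \sum_(j < n) (j`!%:R)^-1 *: iterD f (nseq j h) a)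
      @ \oo --> f (a + h).

Definition of_class (s : regularity R) A f : Prop :=
  match s with
  | Holder k alpha => Ck k A f /\
      forall vs, size vs = k -> locally_Holder alpha A (iterD f vs)
  | Smooth => forall k, Ck k A f
  | Analytic => (forall k, Ck k A f) /\ taylor_converges A f
  end.

End Classes.

Section Plane.
Variable R : realType.
Implicit Types (u v p q y : 'rV[R]_2) (A U : set 'rV[R]_2).

(* The norm of the library on ['rV[R]_2] is the sup norm. *)
Definition dot u v : R := \sum_i u 0 i * v 0 i.
Definition enorm v : R := Num.sqrt (dot v v).

(* $v^\perp = (-v_2, v_1)$. *)
Definition perp v : 'rV[R]_2 := \row_i (if i == 0 then - v 0 1 else v 0 0).

Definition grad (f : 'rV[R]_2 -> R) p : 'rV[R]_2 :=
  \row_i 'D_(delta_mx 0 i) f p.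
Definition hess (f : 'rV[R]_2 -> R) p : 'M[R]_2 :=
  \matrix_(i, j) 'D_(delta_mx 0 i) ('D_(delta_mx 0 j) f) p.
Definition laplacian (f : 'rV[R]_2 -> R) p : R := \tr (hess f p).

Definition bd A : set 'rV[R]_2 := closure A `\` interior A.
Definition segment p q : set 'rV[R]_2 :=
  [set p + t *: (q - p) | t in `[0, 1]%classic].

(* [v] points into the open set [U] at [y] and [- v] points out of it: [U] lies
   on one side only. *)
Definition points_into U y v : Prop := exists2 e : R, 0 < e &
  forall t, 0 < t < e -> U (y + t *: v) /\ ~ closure U (y - t *: v).

Definition homeomorphic A (B : set 'rV[R]_2) : Prop :=
  exists f g : 'rV[R]_2 -> 'rV[R]_2,
    [/\ {within A, continuous f}, {within B, continuous g},
        forall z, A z -> B (f z) /\ g (f z) = z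
      & forall z, B z -> A (g z) /\ f (g z) = z].

(* The interior of a disk from which [m] disjoint closed disks are removed. *)
Definition disk_with_holes m (p : 'I_m -> 'rV[R]_2) (r : 'I_m -> R) :=
  [set z : 'rV[R]_2 | enorm z < 1 /\ forall j, r j < enorm (z - p j)].
Definition proper_holes m (p : 'I_m -> 'rV[R]_2) (r : 'I_m -> R) : Prop :=
  [/\ forall j, 0 < r j, forall j, enorm (p j) + r j < 1
    & forall j l, j != l -> r j + r l < enorm (p j - p l)].

End Plane.

Section Curves.
Variable R : realType.
Implicit Types (c : R -> 'rV[R]_2).

Definition nu c t : 'rV[R]_2 := perp (derive1 c t).
Definition curvature c t : R :=
  dot (derive1 (nu c) t) (perp (nu c t)) / enorm (nu c t) ^+ 3.

Definition arc c : set 'rV[R]_2 := [set c t | t in `[0, 1]%classic].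
Definition is_segment c : Prop := exists p q, arc c = segment p q.
Definition one_periodic c : Prop := forall t, c (t + 1) = c t.

Definition inward_normal (U : set 'rV[R]_2) c t (v : 'rV[R]_2) : Prop :=
  dot v (derive1 c t) = 0 /\ points_into U (c t) v.

End Curves.

Section Gauge.
Variable R : realType.
Implicit Types (K U : set 'rV[R]_2) (g c : R -> 'rV[R]_2) (x y : 'rV[R]_2).

Definition gauge K x : R :=
  inf [set l : R | 0 < l /\ exists2 k, K k & x = l *: k].
Definition polar K : set 'rV[R]_2 := [set x | forall y, K y -> dot x y <= 1].

(* $\partial K$ is of class [s]: [g] is a regular simple closed parametrization
   of it of class [s], run through counterclockwise. *)
Record boundary_param (s : regularity R) K g : Prop := {
  bp_class : of_class s setT g;
  bp_periodic : one_periodic g;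
  bp_simple : forall a b, 0 <= a < 1 -> 0 <= b < 1 -> g a = g b -> a = b;
  bp_regular : forall t, derive1 g t != 0;
  bp_range : range g = bd K;
  bp_inward : forall t, points_into (interior K) (g t) (nu g t)
}.

Definition no_segment (A : set 'rV[R]_2) : Prop :=
  forall p q, p != q -> ~ (segment p q `<=` A).

Record gauge_body (s : regularity R) K g : Prop := {
  gb_compact : compact K;
  gb_convex : convex_set K;
  gb_strict : no_segment (bd K);
  gb_zero : interior K 0;
  gb_boundary : boundary_param s K g;
  gb_curvature : finite_set [set g t | t in [set t | ~ 0 < curvature g t]]
}.

(* $\{\mu_1,\dots,\mu_m\}$; [nu g t] is the inward normal. *)
Definition flat_normals g : set 'rV[R]_2 :=
  [set - ((enorm (nu g t))^-1 *: nu g t) | t in [set t | curvature g t = 0]].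

Definition flat_segment g c : Prop := is_segment c /\
  exists2 mu, flat_normals g mu &
    forall t, 0 <= t <= 1 -> exists2 l, 0 < l & nu c t = l *: mu.

(* Meaningful when [nu c t] is not a positive multiple of a flat normal, or
   [flat_segment g c]; its value is irrelevant otherwise. *)
Definition Kcurvature K g c t : R :=
  if `[< flat_segment g c >] then 0 else
  dot (derive1 (nu c) t *m hess (gauge (polar K)) (nu c t)) (perp (nu c t))
    / enorm (nu c t) ^+ 2.

(* $d_K$; for [U] nonempty and bounded the infimum is a minimum. *)
Definition distK K U x : R := inf [set gauge K (x - y) | y in bd U].
Definition closest K U x y : Prop := bd U y /\ distK K U x = gauge K (x - y).
(* $R_{K,0}$ *)
Definition ridge K U : set 'rV[R]_2 :=
  [set x | U x /\
    exists y z, [/\ closest K U x y, closest K U x z & y <> z]].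

End Gauge.

Section Domain.
Variables (R : realType) (N : nat).
Variables (c : 'I_N -> R -> 'rV[R]_2) (succ : {perm 'I_N}).
Implicit Types (U : set 'rV[R]_2) (i j : 'I_N) (t theta : R).

(* The arc $S_i$ is [arc (c i)], and it is followed on $\partial U$ by
   $S_{succ(i)}$, so that the Jordan curves forming $\partial U$ are the orbits
   of [succ]. A closed curve of class [s] without corners is a single arc with
   a one-periodic parametrization and [succ i = i]; all other junctions
   [c i 1 = c (succ i) 0] are corners. *)
Definition corner i : Prop := ~ one_periodic (c i).

Definition interior_time i t : Prop :=
  0 < t < 1 \/ (one_periodic (c i) /\ 0 <= t <= 1).

(* [U] lies to the left of the arcs, so at the corner [c i 1] it fills the
   sector swept counterclockwise from the outgoing direction [tp] to the
   backward incoming direction [- tm]. *)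
Definition opening_angle i theta : Prop :=
  let tm := derive1 (c i) 1 in
  let tp := derive1 (c (succ i)) 0 in
  0 < theta < 2 * pi /\
  enorm tp *: (- tm) = enorm tm *: (cos theta *: tp + sin theta *: perp tp).

Definition nonreentrant i : Prop :=
  exists2 theta, opening_angle i theta & theta < pi.
Definition reentrant i : Prop :=
  exists2 theta, opening_angle i theta & pi <= theta.

(* [pb_class]: "up to the endpoints" means that [c i] extends to a curve of the
   same class on a neighbourhood of [0, 1]. *)
Record piecewise_boundary (s : regularity R) U : Prop := {
  pb_class : forall i, exists A : set R,
    [/\ open A, `[0, 1]%classic `<=` A & of_class s A (c i)];
  pb_regular : forall i t, 0 <= t <= 1 -> derive1 (c i) t != 0;
  pb_simple : forall i a b, 0 <= a -> a < b -> b <= 1 -> c i a = c i b ->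
    [/\ a = 0, b = 1 & succ i = i];
  pb_succ : forall i, c i 1 = c (succ i) 0;
  pb_meet : forall i j a b, i != j -> 0 <= a <= 1 -> 0 <= b <= 1 ->
    c i a = c j b ->
    [/\ a = 1, b = 0 & j = succ i] \/ [/\ a = 0, b = 1 & i = succ j];
  pb_meet_point : forall i j p q, i != j ->
    (arc (c i) `&` arc (c j)) p -> (arc (c i) `&` arc (c j)) q -> p = q;
  pb_cover : bd U = \bigcup_i arc (c i);
  pb_inward : forall i t, interior_time i t ->
    points_into U (c i t) (nu (c i) t);
  pb_corner : forall i, corner i -> exists theta, opening_angle i theta;
  pb_topology : exists m (p : 'I_m -> 'rV[R]_2) (r : 'I_m -> R),
    proper_holes p r /\ homeomorphic U (disk_with_holes p r)
}.

Definition reentrant_time i t : Prop :=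
  (t = 1 /\ corner i /\ reentrant i) \/
  (t = 0 /\ exists2 j, succ j = i & corner j /\ reentrant j).

Definition boundary_assumption (g : R -> 'rV[R]_2) : Prop := forall i t,
  interior_time i t \/ reentrant_time i t ->
  flat_normals g ((enorm (nu (c i) t))^-1 *: nu (c i) t) ->
  0 < curvature (c i) t \/ is_segment (c i).

End Domain.

(* Main.v *)
(* Write d for d_K.  If y = c(tau) is a d_K-closest point to x and k = (x - y)/d(x),
   then the translate x - d(x) K touches the boundary of U from inside at y; hence k
   is the point of the boundary of K, say g(sigma), at which <nu(tau), .> is maximal.
   At a nonreentrant corner this is impossible.  So (tau, sigma, d) solves
     x = c(tau) + d g(sigma),   <nu(tau), g'(sigma)> = 0,
   whose Jacobian determinant is, with G = <nu, k> = gamma^o(nu),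
     <nu, g''(sigma)> (1 - kappa_K d) G.

   If the curvature of K at k is positive, the determinant does not vanish.  The
   equations satisfied by the differences of two solutions give uniqueness and
   Lipschitz continuity near x.  They also give the derivatives of (tau, sigma, d)
   as rational functions of d and of derivatives of c at tau and of g at sigma.
   Iterating, every derivative of d is a polynomial in these and in the inverses of
   G and of the determinant.  Continuity and Hoelder continuity follow; in the
   analytic case, counting the monomials bounds the derivatives of order n by
   const^n n!.

   If the curvature of K at k is zero, the arc cannot have positive curvature at y,
   or it would enter the touching translate of K.  By the Boundary Assumption it is
   then a segment, k does not depend on x, and d is affine near x. *)
Require Import Defs.
From mathcomp Require Import all_boot all_order all_algebra all_fingroup.
From mathcomp Require Import all_classical all_reals all_analysis.
From mathcomp Require Import ring lra.
Set Implicit Arguments.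
Unset Strict Implicit.
Unset Printing Implicit Defensive.
Import Order.TTheory GRing.Theory Num.Theory.
Import numFieldNormedType.Exports.
Local Open Scope classical_set_scope.
Local Open Scope ring_scope.

(** * Plane algebra and divided differences *)

(** No implicit function theorem is invoked. Solutions near [x] are supplied by the closest points
    themselves, so only uniqueness and smooth dependence remain. Both come from exact identities
    between two solutions, with divided differences in place of derivatives: bounding the
    coefficients gives the Lipschitz estimate, and letting one solution tend to the other gives the
    derivatives. The regularity is carried by the boundary curve [g] of K; the polar gauge is
    differentiated only at the normal of the contact point, to recognise [Kcurvature] and the final
    formulas. No order of differentiability is lost: the gradient of the distance is nu / G, in
    which only c' and g occur and no derivative of tau or sigma, so k derivatives of the distance
    use only k derivatives of the curves. All contact arguments rest on convexity and first-order
    expansions, because the curvature of K may vanish at the contact point. In that case the factor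
    <nu, g''> of the determinant is zero and the equations cannot be solved for sigma, which is why
    flat directions need a separate argument. *)

Section PlaneAlgebra.
Variable R : realType.
Implicit Types (u v w : 'rV[R]_2).

Definition cross u v : R := u 0 0 * v 0 1 - u 0 1 * v 0 0.

Lemma dotE u v : dot u v = u 0 0 * v 0 0 + u 0 1 * v 0 1.
Proof.
rewrite /dot big_ord_recl big_ord1; congr (_ + _ * _);
  by [|congr (u _ _); apply/val_inj|congr (v _ _); apply/val_inj].
Qed.

Lemma row2P u v : u 0 0 = v 0 0 -> u 0 1 = v 0 1 -> u = v.
Proof.
move=> h0 h1; apply/rowP => -[[|[|//]] h].
- by have -> : Ordinal h = 0 by apply/val_inj.
- by have -> : Ordinal h = 1 by apply/val_inj.
Qed.

Lemma perp0 v : perp v 0 0 = - v 0 1. Proof. by rewrite mxE. Qed.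
Lemma perp1 v : perp v 0 1 = v 0 0. Proof. by rewrite mxE. Qed.

Lemma ord2P (i : 'I_2) : i = 0 \/ i = 1.
Proof.
by case: i => -[|[|//]] h; [left|right]; apply/val_inj.
Qed.

Lemma norm2E u : `|u| = Num.max `|u 0 0| `|u 0 1|.
Proof.
rewrite /Num.norm /= mx_normrE; apply/le_anti/andP; split.
  apply/bigmax_leP; split => /=; first by rewrite le_max normr_ge0.
  by move=> [i j] _ /=; rewrite (ord1 i); case: (ord2P j) => ->; rewrite le_max lexx ?orbT.
by rewrite ge_max (le_bigmax _ (fun ij => `|u ij.1 ij.2|) (0, 0))
  (le_bigmax _ (fun ij => `|u ij.1 ij.2|) (0, 1)).
Qed.

End PlaneAlgebra.

Ltac plane := rewrite ?dotE /cross ?(perp0, perp1, mxE); ring.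

Section EpsDelta.
Variables (R : realType) (V W : normedModType R).
Implicit Types (f : V -> W) (a v : V).

Lemma nbhs_ballN a (P : V -> Prop) :
  (\forall b \near a, P b) <-> exists2 d : R, 0 < d & forall b, `|b - a| < d -> P b.
Proof.
split=> [/nbhs_normP[d d0 dP]|[d d0 dP]].
  by exists d => // b bd; apply: dP; rewrite /ball_ /= distrC.
by apply/nbhs_normP; exists d => // b; rewrite /ball_ /= distrC => /dP.
Qed.

Lemma interior_ballP (U : set V) p :
  interior U p <-> exists2 d : R, 0 < d & forall b, `|b - p| < d -> U b.
Proof. by have -> : interior U p = (\forall b \near p, U b); [|exact: nbhs_ballN]. Qed.

Lemma continuous_epsP f a : {for a, continuous f} <->
  forall e : R, 0 < e -> exists2 d : R, 0 < d &
    forall b, `|b - a| < d -> `|f b - f a| < e.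
Proof.
split=> [/cvgrPdist_lt cf e e0|cf].
  by have /nbhs_ballN[d d0 dP] := cf e e0; exists d => // b /dP; rewrite distrC.
apply/cvgrPdist_lt => e e0; apply/nbhs_ballN.
by have [d d0 dP] := cf e e0; exists d => // b /dP; rewrite distrC.
Qed.

(** Multiplied out by [h], the estimate also covers [h = 0], so that shifts and compositions need no
    punctured neighbourhood. *)
Lemma is_derive_epsP f a v (df : W) : is_derive a v f df <->
  forall e : R, 0 < e -> exists2 d : R, 0 < d &
    forall h : R, `|h| < d -> `|f (a + h *: v) - f a - h *: df| <= e * `|h|.
Proof.
split=> [[dfa dfE] e e0|Hf].
  have /cvgrPdist_le/(_ e e0) : h^-1 *: ((f \o shift a) (h *: v) - f a) @[h --> 0^'] --> df.
    by rewrite -dfE; exact: dfa.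
  move=> [d /= d0 dP]; exists d => // h hd.
  have [->|h0] := eqVneq h 0.
    by rewrite !scale0r addr0 !subrr !normr0 mulr0.
  have := dP h; rewrite /ball_ /= sub0r normrN => /(_ hd h0).
  rewrite [h *: v + a]addrC => H.
  have -> : f (a + h *: v) - f a - h *: df
     = h *: (h^-1 *: (f (a + h *: v) - f a) - df).
    by rewrite scalerBr scalerA divff // scale1r.
  by rewrite normrZ mulrC ler_wpM2r // distrC.
have cvg_df : h^-1 *: ((f \o shift a) (h *: v) - f a) @[h --> 0^'] --> df.
  apply/cvgrPdist_le => e e0; have [d d0 dP] := Hf e e0.
  exists d => //= h; rewrite /ball_ /= sub0r normrN => hd h0.
  have := dP h hd.
  have -> : f (a + h *: v) - f a - h *: df
     = h *: (h^-1 *: (f (a + h *: v) - f a) - df).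
    by rewrite scalerBr scalerA divff // scale1r.
  rewrite normrZ mulrC ler_pM2r ?normr_gt0 // distrC => H.
  by rewrite [h *: v + a]addrC.
by split; [apply/cvg_ex; exists df|exact/cvg_lim].
Qed.

End EpsDelta.

Section EpsDelta2.
Variables (R : realType) (V W : normedModType R).
Implicit Types (f : V -> W) (a v : V).

Lemma is_derive_line f a v (df : W) :
  is_derive a v f df <-> is_derive (0 : R) 1 (fun r : R => f (a + r *: v)) df.
Proof.
by split=> /is_derive_epsP H; apply/is_derive_epsP => e e0; have [d d0 dP] := H e e0; exists d => // h /dP;
  rewrite add0r [h *: 1]mulr1 scale0r addr0.
Qed.

Lemma is_derive_unique f a v (df dg : W) :
  is_derive a v f df -> is_derive a v f dg -> df = dg.
Proof. by move=> [_ <-] [_ <-]. Qed.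

Lemma near_is_derive f (g : V -> W) a v (df : W) (A : set V) :
  open_nbhs a A -> (forall b, A b -> f b = g b) ->
  is_derive a v f df -> is_derive a v g df.
Proof.
by move=> Aa fg; apply: near_eq_is_derive; near do apply: fg;
  apply: open_nbhs_nbhs.
Unshelve. all: by end_near. Qed.

Lemma is_deriveZv f a v (df : W) (k : R) :
  is_derive a v f df -> is_derive a (k *: v) f (k *: df).
Proof.
rewrite !is_derive_epsP => H e e0.
have k1 : 0 < `|k| + 1 by rewrite ltr_wpDl.
have [d d0 dP] := H (e / (`|k| + 1)) (divr_gt0 e0 k1).
exists (d / (`|k| + 1)); first exact: divr_gt0.
move=> h; rewrite ltr_pdivlMr // => hd.
have /dP : `|h * k| < d.
  rewrite normrM; apply: le_lt_trans hd.
  by rewrite ler_wpM2l // lerDl.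
rewrite !scalerA => /le_trans; apply; rewrite normrM -mulrA.
rewrite ler_pM2l // mulrC -mulrA -[leRHS]mulr1 ler_wpM2l //.
by rewrite ler_pdivrMr // mul1r lerDl.
Qed.

End EpsDelta2.

Section Curves.
Variable R : realType.

Lemma is_derive_comp1 (V : normedModType R) (f : V -> R) (phi : R -> R) a v df dphi :
  is_derive a v f df -> is_derive (f a) 1 phi dphi ->
  is_derive a v (phi \o f) (dphi * df).
Proof.
move=> /is_derive_line fa phia; apply/is_derive_line.
have := @is_derive1_comp R phi (fun r => f (a + r *: v)) 0 dphi df.
by rewrite scale0r addr0; apply.
Qed.

Lemma is_derive_coord (V : normedModType R) (f : V -> 'rV[R]_2) a v df j :
  is_derive a v f df -> is_derive a v (fun b => f b 0 j) (df 0 j).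
Proof.
move=> [fa <-]; have fj := (derivable_mxP f a v).1 fa 0 j.
by apply: DeriveDef => //; rewrite derive_mx // mxE.
Qed.

Lemma is_derive_row2 (V : normedModType R) (f : V -> 'rV[R]_2) a v (df : 'rV_2) :
  is_derive a v (fun b => f b 0 0) (df 0 0) -> is_derive a v (fun b => f b 0 1) (df 0 1) ->
  is_derive a v f df.
Proof.
move=> [f0 d0] [f1 d1].
have fa : derivable f a v.
  by apply/derivable_mxP => i j; rewrite (ord1 i); case: (ord2P j) => ->; [exact: f0|exact: f1].
by apply: DeriveDef => //; rewrite derive_mx //; apply: row2P; rewrite mxE.
Qed.

Lemma cvg_coord (T : Type) (F : set_system T) {FF : Filter F} (f : T -> 'rV[R]_2) (u : 'rV[R]_2) j :
  f x @[x --> F] --> u -> f x 0 j @[x --> F] --> u 0 j.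
Proof. by move=> fu; exact: (cvg_comp _ _ fu (@coord_continuous _ _ _ 0 j u)). Qed.

Lemma is_derive_continuous (W : normedModType R) (f : R -> W) (a : R) df :
  is_derive a 1 f df -> {for a, continuous f}.
Proof. by move=> [fa _]; exact/differentiable_continuous/derivable1_diffP. Qed.

End Curves.

Section DividedDifference.
Variable R : realType.
Implicit Types (f df : R -> R).

Definition ddiff f df (a b : R) : R :=
  if a == b then df a else (f a - f b) / (a - b).

Lemma ddiffE f df a b : f a - f b = ddiff f df a b * (a - b).
Proof.
rewrite /ddiff; case: eqVneq => [->|ab]; first by rewrite !subrr mulr0.
by rewrite divfK // subr_eq0.
Qed.

Lemma MVT_ball f df (s d a b : R) :
  (forall u, `|u - s| < d -> is_derive u 1 f (df u)) ->
  `|a - s| < d -> `|b - s| < d ->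
  exists2 u, `|u - s| < d & f a - f b = df u * (a - b).
Proof.
move=> fd; wlog ab : a b / b <= a => [H|] da db.
  case/orP: (le_total b a) => ab; first exact: H.
  have [u ud e] := H b a ab db da; exists u => //.
  by rewrite -opprB e -mulrN opprB.
have inn u : u \in `[b, a] -> `|u - s| < d.
  rewrite in_itv /= => /andP[bu ua].
  move: da db; rewrite !ltr_norml => /andP[_ h1] /andP[h2 _].
  by apply/andP; split; lra.
have [u uab e] : exists2 u, u \in `[b, a] & f a - f b = df u * (a - b).
  apply: MVT_segment => // [u uab|].
    by apply/fd/inn; apply: subset_itv_oo_cc.
  apply: derivable_within_continuous => u /inn /fd [] //.
by exists u => //; apply: inn.
Qed.

Lemma ddiff_ball f df (s d a b : R) :
  (forall u, `|u - s| < d -> is_derive u 1 f (df u)) ->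
  `|a - s| < d -> `|b - s| < d ->
  exists2 u, `|u - s| < d & ddiff f df a b = df u.
Proof.
move=> fd da db; rewrite /ddiff; case: eqVneq => [_|ab]; first by exists a.
have [u ud e] := MVT_ball fd da db; exists u => //.
by rewrite e mulfK // subr_eq0.
Qed.

(** Both arguments move independently. The quotient is a value of [df] at an intermediate point,
    hence near [s], where [df] is continuous. *)
Lemma cvg_ddiff (T : Type) (F : set_system T) {FF : Filter F} f df (s : R) (a b : T -> R) :
  (\forall u \near s, is_derive (u : R) 1 f (df u)) -> {for s, continuous df} ->
  a x @[x --> F] --> s -> b x @[x --> F] --> s ->
  ddiff f df (a x) (b x) @[x --> F] --> df s.
Proof.
move=> /nbhs_ballN[d d0 fd] cdf /cvgrPdist_lt ca /cvgrPdist_lt cb.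
apply/cvgrPdist_lt => e e0.
have [d' d'0 cd'] := (continuous_epsP _ _).1 cdf e e0.
have m0 : 0 < Num.min d d' by rewrite lt_min d0 d'0.
near=> x.
have [|||u ud ->] := @ddiff_ball f df s (Num.min d d') (a x) (b x).
- by move=> u; rewrite lt_min => /andP[/fd].
- by rewrite distrC; near: x; apply: ca.
- by rewrite distrC; near: x; apply: cb.
- by rewrite distrC; apply: cd'; move: ud; rewrite lt_min => /andP[].
Unshelve. all: by end_near. Qed.

End DividedDifference.

Section Topology.
Variable R : realType.
Implicit Types (U : set 'rV[R]_2) (p q : 'rV[R]_2).

Lemma bd_open U p : open U -> bd U p <-> closure U p /\ ~ U p.
Proof. by rewrite /bd => /interior_id ->. Qed.

Lemma closure_cases U p : open U -> closure U p -> ~ U p -> bd U p.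
Proof. by move=> oU cp Up; apply/bd_open. Qed.

(** Along a segment without boundary points the preimages of [U] and of its closure coincide, so
    this preimage is open and closed in the connected interval [0, 1]. *)
Lemma segment_in U p q : open U ->
  (forall r, 0 <= r <= 1 -> ~ bd U (p + r *: (q - p))) -> U p -> U q.
Proof.
move=> oU noU Up.
pose f (r : R) := p + r *: (q - p).
have cf : continuous f.
  move=> r; apply: cvgD; first exact: cvg_cst.
  by apply: cvgZr_tmp; exact: cvg_id.
suff : `[0, 1]%classic `&` f @^-1` U = `[0, 1]%classic.
  move=> /seteqP[_ /(_ 1)] /=; rewrite in_itv /= ler01 lexx => /(_ isT)[_].
  by rewrite /f scale1r addrC subrK.
apply: (@segment_connected R 0 1).
- by exists 0; split; rewrite /= ?in_itv /= ?lexx ?ler01 // /f scale0r addr0.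
- by exists (f @^-1` U) => //; apply: open_comp.
- exists (f @^-1` closure U).
    by apply: closed_comp => //; exact: closed_closure.
  apply/seteqP; split=> r /= [r01 h]; split=> //; first exact: subset_closure.
  apply: contrapT => nU; apply: (noU r) => //; exact: closure_cases.
Qed.

(** If [q] were in the closure it would lie in [U], not being a boundary point, and [segment_in]
    along the reversed segment would put [p] in [U]. *)
Lemma segment_out U p q : open U ->
  (forall r, 0 <= r <= 1 -> ~ bd U (p + r *: (q - p))) ->
  ~ closure U p -> ~ closure U q.
Proof.
move=> oU noU Up cq.
have Uq : U q.
  apply: contrapT => nUq; have /noU : 0 <= (1:R) <= 1 by rewrite ler01 lexx.
  by rewrite scale1r addrC subrK; apply; exact: closure_cases.
apply: Up; apply: subset_closure; apply: (segment_in oU _ Uq) => r /andP[r0 r1].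
have -> : q + r *: (p - q) = p + (1 - r) *: (q - p).
  by rewrite scalerBl scale1r -[p - q]opprB scalerN addrA [p + (q - p)]addrC subrK.
by apply: noU; rewrite subr_ge0 r1 lerBlDr lerDl.
Qed.

(** Compactness: the image of the bad times of each arc is a compact set that misses [y], hence
    stays away from it. A property of the times at which arcs pass through [y] thus extends to all
    times at which they pass near [y]. *)
Lemma arcs_local n (c : 'I_n -> R -> 'rV[R]_2) (P : 'I_n -> R -> Prop) y :
  (forall j, {within `[0, 1]%classic, continuous (c j)}) ->
  (forall j, closed [set b | ~ P j b]) ->
  (forall j b, 0 <= b <= 1 -> c j b = y -> P j b) ->
  exists2 r : R, 0 < r &
    forall j b, 0 <= b <= 1 -> `|c j b - y| < r -> P j b.
Proof.
move=> cc cP Py.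
have H j : \forall z \near y, forall b, 0 <= b <= 1 -> c j b = z -> P j b.
  pose C := c j @` (`[0, 1]%classic `&` [set b | ~ P j b]).
  have kC : compact C.
    apply: continuous_compact.
      by apply: continuous_subspaceW (cc j) => b [].
    by apply: compact_closedI => //; exact: segment_compact.
  have oC : open (~` C).
    by apply: closed_openC; apply: compact_closed => //; exact: norm_hausdorff.
  have : nbhs y (~` C).
    apply: open_nbhs_nbhs; split=> // -[b [b01 nP] cb].
    by apply: nP; apply: Py => //; move: b01; rewrite /= in_itv.
  apply: filterS => z nC b b01 cb; apply: contrapT => nP; apply: nC.
  by exists b => //; split=> //=; rewrite in_itv.
have [r r0 rP] := (nbhs_ballN _ _).1 (filter_forall _ H).
by exists r => // j b b01 /rP/(_ j b b01 erefl).
Qed.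

End Topology.

(** * Convex bodies and their gauges *)

Section ConvexBody.
Variable R : realType.
Implicit Types (K U : set 'rV[R]_2) (p q u v x z k : 'rV[R]_2).

(** The factor 2 is the price of the sup norm on the plane. *)
Lemma dot_le u v : `|dot u v| <= 2 * `|u| * `|v|.
Proof.
rewrite dotE; apply: le_trans (ler_normD _ _) _; rewrite !normrM.
have H (w : 'rV[R]_2) j : `|w 0 j| <= `|w|.
  by rewrite norm2E le_max; case: (ord2P j) => ->; rewrite lexx ?orbT.
have := ler_pM (normr_ge0 _) (normr_ge0 _) (H u 0) (H v 0).
have := ler_pM (normr_ge0 _) (normr_ge0 _) (H u 1) (H v 1).
by lra.
Qed.

Lemma dotC u v : dot u v = dot v u. Proof. by plane. Qed.
Lemma dotDr u v w : dot u (v + w) = dot u v + dot u w. Proof. by plane. Qed.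
Lemma dotBr u v w : dot u (v - w) = dot u v - dot u w. Proof. by plane. Qed.
Lemma dotNr u v : dot u (- v) = - dot u v. Proof. by plane. Qed.
Lemma dotZr (a : R) u v : dot u (a *: v) = a * dot u v. Proof. by plane. Qed.
Lemma dotDl u v w : dot (v + w) u = dot v u + dot w u. Proof. by plane. Qed.
Lemma dotBl u v w : dot (v - w) u = dot v u - dot w u. Proof. by plane. Qed.
Lemma dotNl u v : dot (- v) u = - dot v u. Proof. by plane. Qed.
Lemma dotZl (a : R) u v : dot (a *: v) u = a * dot v u. Proof. by plane. Qed.
Lemma dot0r u : dot u 0 = 0. Proof. by plane. Qed.

Lemma dot_continuous u : continuous (dot u).
Proof.
move=> z; apply/continuous_epsP => e e0.
have C0 : 0 < 2 * `|u| + 1 by rewrite ltr_wpDl // mulr_ge0.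
exists (e / (2 * `|u| + 1)); first exact: divr_gt0.
move=> w; rewrite ltr_pdivlMr // mulrC -dotBr => h.
apply: le_lt_trans (dot_le _ _) _; apply: le_lt_trans h.
by rewrite ler_wpM2r // lerDl.
Qed.

Lemma dot_gt0 u : (0 < dot u u) = (u != 0).
Proof.
apply/idP/idP => [|u0]; first by apply: contraTN => /eqP ->; rewrite dot0r ltxx.
rewrite dotE -!expr2 lt_neqAle addr_ge0 ?sqr_ge0 // andbT eq_sym.
rewrite paddr_eq0 ?sqr_ge0 // !sqrf_eq0; apply: contra u0 => /andP[/eqP h0 /eqP h1].
by apply/eqP/row2P; rewrite ?h0 ?h1 mxE.
Qed.

Lemma perp_neq0 u : (perp u != 0) = (u != 0).
Proof. by rewrite -!dot_gt0; congr (_ < _); plane. Qed.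

Lemma enorm_gt0 u : (0 < enorm u) = (u != 0).
Proof. by rewrite /enorm sqrtr_gt0 dot_gt0. Qed.

Lemma enorm_sqr u : enorm u ^+ 2 = dot u u.
Proof. by rewrite sqr_sqrtr // dotE -!expr2 addr_ge0 ?sqr_ge0. Qed.

Lemma orth_perp (n v : 'rV[R]_2) : v != 0 -> dot n v = 0 ->
  n = (dot n (perp v) / dot v v) *: perp v.
Proof.
move=> v0 nv; have d0 : dot v v != 0 by rewrite gt_eqF // dot_gt0.
have e (j : 'I_2) : n 0 j * dot v v = dot n (perp v) * perp v 0 j + dot n v * v 0 j.
  by case: (ord2P j) => ->; plane.
apply: row2P; rewrite mxE; apply: (mulIf d0); rewrite e nv mul0r addr0;
  by rewrite mulrAC divfK.
Qed.

Lemma convex_setP K : convex_set K -> forall p q (r : R), K p -> K q ->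
  0 <= r <= 1 -> K (p + r *: (q - p)).
Proof.
move=> cK p q r Kp Kq /andP[r0 r1].
have := cK q p (Itv01 r0 r1); rewrite !inE => /(_ Kq Kp).
rewrite /conv /= => h.
have -> : p + r *: (q - p) = r *: q + (1 - r) *: p; last exact: h.
by rewrite scalerBr scalerBl scale1r addrA [RHS]addrC addrAC -addrA [_ + r *: q]addrC addrA.
Qed.

Variable K : set 'rV[R]_2.
Hypothesis kK : compact K.
Hypothesis cK : forall p q (r : R), K p -> K q -> 0 <= r <= 1 -> K (p + r *: (q - p)).
Hypothesis K0 : interior K 0.

Lemma closedK : closed K.
Proof. by apply: compact_closed => //; exact: norm_hausdorff. Qed.

Lemma ball_in_K : exists2 d : R, 0 < d & forall z, `|z| < d -> K z.
Proof.
by have [d d0 dP] := (nbhs_ballN _ _).1 K0; exists d => // z zd; apply: dP; rewrite subr0.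
Qed.

Lemma K_bounded : exists2 M : R, 0 < M & forall z, K z -> `|z| < M.
Proof. by have [M M0 MP] := ex_strict_bound_gt0 (compact_bounded kK); exists M. Qed.

(** The homothety of centre [p] and ratio [r] maps a ball around [q] inside K onto a ball around the
    new point, still inside K by convexity. *)
Lemma interior_convex p q (r : R) : K p -> interior K q -> 0 < r <= 1 ->
  interior K (p + r *: (q - p)).
Proof.
move=> Kp /interior_ballP[d d0 dK] /andP[r0 r1].
apply/interior_ballP; exists (r * d); first exact: mulr_gt0.
move=> b bd.
have -> : b = p + r *: (q + r^-1 *: (b - (p + r *: (q - p))) - p).
  by apply: row2P; rewrite !mxE; field; rewrite gt_eqF.
apply: cK; rewrite ?(ltW r0) ?r1 //; apply: dK.
rewrite addrAC subrr add0r normrZ normfV (gtr0_norm r0).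
by rewrite mulrC ltr_pdivrMr // [d * r]mulrC.
Qed.

Definition gset x := [set l : R | 0 < l /\ exists2 k, K k & x = l *: k].

Lemma gset_lb x : has_lbound (gset x).
Proof. by exists 0 => l [/ltW]. Qed.

Lemma K_scale k (r : R) : K k -> 0 <= r <= 1 -> K (r *: k).
Proof.
move=> Kk r01; have := cK (nbhs_singleton K0) Kk r01.
by rewrite subr0 add0r.
Qed.

Lemma gset_up x (l l' : R) : gset x l -> l <= l' -> gset x l'.
Proof.
move=> [l0 [k Kk ->]] ll'; have l'0 := lt_le_trans l0 ll'; split=> //.
exists ((l / l') *: k).
  by apply: K_scale => //; rewrite divr_ge0 ?(ltW l0) ?(ltW l'0) //= ler_pdivrMr // mul1r.
by rewrite scalerA mulrCA divff ?gt_eqF // mulr1.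
Qed.

Lemma gset_ball (d : R) x (l : R) : 0 < d -> (forall z, `|z| < d -> K z) -> `|x| < l * d ->
  gset x l.
Proof.
move=> d0 dK xl.
have l0 : 0 < l by rewrite -(pmulr_lgt0 _ d0); apply: le_lt_trans xl.
split=> //; exists (l^-1 *: x).
  by apply: dK; rewrite normrZ normfV (gtr0_norm l0) mulrC ltr_pdivrMr // mulrC.
by rewrite scalerA divff ?gt_eqF // scale1r.
Qed.

Lemma gset_nonempty x : gset x !=set0.
Proof.
have [d d0 dK] := ball_in_K; exists ((`|x| + 1) / d).
by apply: (gset_ball d0 dK); rewrite divfK ?gt_eqF // ltrDl.
Qed.

Lemma gset_inf x : has_inf (gset x).
Proof. by split; [exact: gset_nonempty|exact: gset_lb]. Qed.

Lemma gauge_ge0 x : 0 <= gauge K x.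
Proof. by apply: lb_le_inf; [exact: gset_nonempty|move=> l [/ltW]]. Qed.

Lemma gauge_le x (l : R) : gset x l -> gauge K x <= l.
Proof. by move=> h; apply: ge_inf => //; exact: gset_lb. Qed.

Lemma gauge_lt x (l : R) : gauge K x < l -> gset x l.
Proof.
move=> xl; have [|l' hl'] := @inf_adherent _ (gset x) (l - gauge K x) _ (gset_inf x).
  by rewrite subr_gt0.
by rewrite addrC subrK => /ltW; apply: gset_up.
Qed.

Lemma gauge_bound : exists2 C : R, 0 < C & forall x, gauge K x <= C * `|x|.
Proof.
have [d d0 dK] := ball_in_K; exists (d^-1); first by rewrite invr_gt0.
move=> x; apply/ler_addgt0Pr => e e0; apply: gauge_le; apply: (gset_ball d0 dK).
by rewrite mulrDl mulrAC mulVf ?gt_eqF // mul1r ltrDl mulr_gt0.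
Qed.

Lemma gaugeZ_le (a : R) x : 0 < a -> gauge K (a *: x) <= a * gauge K x.
Proof.
move=> a0; apply/ler_addgt0Pr => e e0.
have [|l0 [k Kk xk]] := @gauge_lt x (gauge K x + e / a).
  by rewrite ltrDl divr_gt0.
apply: gauge_le; rewrite /gset /=.
have -> : a * gauge K x + e = a * (gauge K x + e / a).
  by rewrite mulrDr mulrCA divff ?gt_eqF // mulr1.
by split; [exact: mulr_gt0|exists k => //; rewrite {1}xk scalerA].
Qed.

Lemma gaugeZ (a : R) x : 0 < a -> gauge K (a *: x) = a * gauge K x.
Proof.
move=> a0; apply/le_anti; rewrite gaugeZ_le //=.
have ai0 : 0 < a^-1 by rewrite invr_gt0.
have := gaugeZ_le (a *: x) ai0.
by rewrite scalerA mulVf ?gt_eqF // scale1r mulrC ler_pdivlMr // mulrC.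
Qed.

Lemma gaugeD x z : gauge K (x + z) <= gauge K x + gauge K z.
Proof.
apply/ler_addgt0Pr => e e0.
have e2 : 0 < e / 2 by rewrite divr_gt0.
have [|l0 [k Kk xk]] := @gauge_lt x (gauge K x + e / 2); first by rewrite ltrDl.
have [|m0 [k' Kk' zk']] := @gauge_lt z (gauge K z + e / 2); first by rewrite ltrDl.
apply: gauge_le; rewrite /gset /=.
set l := gauge K x + e / 2 in l0 xk; set m := gauge K z + e / 2 in m0 zk'.
have -> : gauge K x + gauge K z + e = l + m by rewrite /l /m; lra.
have lm0 : 0 < l + m by rewrite addr_gt0.
split=> //; exists (k + (m / (l + m)) *: (k' - k)).
  apply: cK => //; rewrite divr_ge0 ?(ltW m0) ?(ltW lm0) //=.
  by rewrite ler_pdivrMr // mul1r lerDr ltW.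
rewrite scalerDr scalerA mulrCA divff ?gt_eqF // mulr1 scalerBr addrCA -scalerBl.
by rewrite [_ - m]addrK addrC -xk -zk'.
Qed.

Lemma gauge_lipschitz : exists2 C : R, 0 < C &
  forall x z, gauge K x <= gauge K z + C * `|x - z|.
Proof.
have [C C0 CP] := gauge_bound; exists C => // x z.
have := gaugeD z (x - z); rewrite addrC subrK => /le_trans; apply.
by rewrite lerD2l.
Qed.

Lemma gauge_gt0 x : x != 0 -> 0 < gauge K x.
Proof.
move=> x0; have [M M0 MK] := K_bounded.
apply: (@lt_le_trans _ _ (`|x| / M)); first by rewrite divr_gt0 ?normr_gt0.
apply: lb_le_inf; first exact: gset_nonempty.
move=> l [l0 [k Kk ->]]; rewrite normrZ (gtr0_norm l0) ler_pdivrMr //.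
by rewrite ler_pM2l // ltW // MK.
Qed.

Lemma gauge_le1 x : K x -> gauge K x <= 1.
Proof. by move=> Kx; apply: gauge_le; split=> //; exists x => //; rewrite scale1r. Qed.

(** For every e > 0 the point x / (1 + e) belongs to K; these points tend to [x] and K is closed. *)
Lemma gauge_le1K x : gauge K x <= 1 -> K x.
Proof.
move=> x1; apply: closedK => B /nbhs_ballN[d d0 dB].
have n1 : 0 < `|x| + 1 by rewrite ltr_wpDl.
pose e := d / (`|x| + 1); have e0 : 0 < e by rewrite divr_gt0.
have [|l0 [k Kk xk]] := @gauge_lt x (1 + e); first by rewrite (le_lt_trans x1) // ltrDl.
exists k; split=> //; apply: dB.
have e1 : 0 < 1 + e by rewrite addr_gt0.
have ke : k = (1 + e)^-1 *: x by rewrite xk scalerA mulVf ?gt_eqF // scale1r.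
have -> : k - x = - (e / (1 + e)) *: x.
  rewrite ke -[X in _ - X]scale1r -scalerBl; congr (_ *: _).
  by field; rewrite gt_eqF.
rewrite normrZ normrN gtr0_norm ?divr_gt0 // mulrAC ltr_pdivrMr //.
rewrite /e mulrAC ltr_pdivrMr // -mulrA ltr_pM2l //.
rewrite mulrDl mul1r; apply: (@lt_le_trans _ _ (`|x| + 1)); first by rewrite ltrDl.
by rewrite lerDl mulr_ge0 // ltW.
Qed.

Lemma interior_gauge x : interior K x <-> gauge K x < 1.
Proof.
split=> [/nbhs_ballN[d d0 dK]|x1].
  have n1 : 0 < `|x| + 1 by rewrite ltr_wpDl.
  pose e := d / (`|x| + 1); have e0 : 0 < e by rewrite divr_gt0.
  have : K ((1 + e) *: x).
    apply: dK; rewrite scalerDl scale1r addrAC subrr add0r normrZ gtr0_norm //.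
    by rewrite /e mulrAC ltr_pdivrMr // ltr_pM2l // ltrDl.
  move=> /gauge_le1; have e1 : 0 < 1 + e by rewrite addr_gt0.
  rewrite gaugeZ // => h; have g0 := gauge_ge0 x.
  by have [->|gn0] := eqVneq (gauge K x) 0; [lra|have gp : 0 < gauge K x by rewrite lt_def gn0 g0]; nra.
apply/interior_ballP; have [C C0 CP] := gauge_lipschitz.
exists ((1 - gauge K x) / C); first by rewrite divr_gt0 // subr_gt0.
move=> b; rewrite ltr_pdivlMr // => bx; apply: gauge_le1K.
by have := CP b x; rewrite mulrC => h; lra.
Qed.

Lemma bd_gauge x : bd K x <-> gauge K x = 1.
Proof.
split=> [[cx nx]|x1].
  apply/le_anti; rewrite gauge_le1; last exact: closedK.
  by rewrite /= leNgt; apply/negP => /interior_gauge.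
split; first by apply/subset_closure/gauge_le1K; rewrite x1.
by move=> /interior_gauge; rewrite x1 ltxx.
Qed.

(** [k] is a support point of K with outward normal [u]. This expresses contact with a line without
    any smoothness of K. *)
Definition maximizes u k := K k /\ forall z, K z -> dot u z <= dot u k.

Lemma maximizer_exists u : exists k, maximizes u k.
Proof.
have [||k kK' kP] := @EVT_max_rV _ _ (dot u) K _ kK.
- by exists 0; apply: nbhs_singleton.
- exact/continuous_subspaceT/dot_continuous.
- by exists k; split; [exact: set_mem|move=> z Kz; apply: kP; exact: mem_set].
Qed.

Lemma maximizes_gt0 u k : u != 0 -> maximizes u k -> 0 < dot u k.
Proof.
move=> u0 [Kk km]; have [d d0 dK] := ball_in_K.
have n0 : 0 < `|u| by rewrite normr_gt0.
have /km : K ((d / 2 / `|u|) *: u).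
  apply: dK; rewrite normrZ gtr0_norm ?divr_gt0 // divfK ?gt_eqF //.
  by rewrite ltr_pdivrMr // ltr_pMr // ltr1n.
apply: lt_le_trans; rewrite dotZr mulr_gt0 ?divr_gt0 //.
by rewrite dot_gt0.
Qed.

Lemma maximizes_notin_interior u k : u != 0 -> maximizes u k -> ~ interior K k.
Proof.
move=> u0 [Kk km] /nbhs_ballN[d d0 dK].
have n0 : 0 < `|u| by rewrite normr_gt0.
have /km : K (k + (d / 2 / `|u|) *: u).
  apply: dK; rewrite addrAC subrr add0r normrZ gtr0_norm ?divr_gt0 // divfK ?gt_eqF //.
  by rewrite ltr_pdivrMr // ltr_pMr // ltr1n.
rewrite leNgt dotDr ltrDl dotZr mulr_gt0 ?divr_gt0 //.
by rewrite dot_gt0.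
Qed.

Lemma maximizes_bd u k : u != 0 -> maximizes u k -> bd K k.
Proof.
move=> u0 km; split; last exact: maximizes_notin_interior km.
by apply: subset_closure; case: km.
Qed.

(** All points between two maximizers are maximizers, hence boundary points, and strict convexity
    excludes such a segment. *)
Lemma maximizes_unique u k k' : no_segment (bd K) -> u != 0 ->
  maximizes u k -> maximizes u k' -> k = k'.
Proof.
move=> ns u0 [Kk km] [Kk' km']; apply: contrapT => /eqP kk'.
apply: (ns _ _ kk') => _ [r /= + <-]; rewrite in_itv /= => r01.
apply: (@maximizes_bd u) => //; split; first exact: cK.
move=> z Kz; rewrite dotDr dotZr dotBr.
have -> : dot u k' = dot u k by apply/le_anti; rewrite km //= km'.
by rewrite subrr mulr0 addr0; apply: km.
Qed.

(** The gauge of the polar is the support function of K: [u] is [l] times a point of the polar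
    exactly when [dot u k <= l]. *)
Lemma gauge_polar u k : u != 0 -> maximizes u k -> gauge (polar K) u = dot u k.
Proof.
move=> u0 km; have m0 := maximizes_gt0 u0 km; case: km => Kk km.
have E l : 0 < l /\ (exists2 w, polar K w & u = l *: w) <-> dot u k <= l.
  split=> [[l0 [w pw ->]]|ml].
    by rewrite dotZl -[leRHS]mulr1 ler_pM2l //; exact: pw.
  have l0 := lt_le_trans m0 ml; split=> //; exists (l^-1 *: u).
    move=> z Kz; rewrite dotZl mulrC ler_pdivrMr // mul1r.
    by apply: le_trans ml; exact: km.
  by rewrite scalerA divff ?gt_eqF // scale1r.
rewrite /gauge; apply/le_anti/andP; split.
  by apply: ge_inf; [exists 0 => l [/ltW]|apply/E].
by apply: lb_le_inf; [exists (dot u k); apply/E|move=> l /E].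
Qed.

Lemma maximizesZ (a : R) u k : 0 < a -> maximizes u k -> maximizes (a *: u) k.
Proof. by move=> a0 [Kk km]; split=> // z Kz; rewrite !dotZl ler_pM2l // km. Qed.

End ConvexBody.

(** * Tangency and first-order contact conditions *)

Section Transversality.
Variable R : realType.
Implicit Types (K U : set 'rV[R]_2) (p q u v x z k : 'rV[R]_2) (c g : R -> 'rV[R]_2).

(** Near [c tau] the boundary is the curve alone, run at times near [tau]. With closure and
    complement in place of [bd], the notion serves both the domain and the interior of K. *)
Definition local_boundary U c (tau : R) := forall d : R, 0 < d -> exists2 r : R, 0 < r &
  forall z, closure U z -> ~ U z -> `|z - c tau| < r ->
  exists2 b, `|b - tau| < d & z = c b.

Lemma norm_conv_le (p q : 'rV[R]_2) (r : R) : 0 <= r <= 1 ->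
  `|p + r *: (q - p)| <= Num.max `|p| `|q|.
Proof.
move=> /andP[r0 r1].
have -> : p + r *: (q - p) = (1 - r) *: p + r *: q by apply: row2P; plane.
apply: le_trans (ler_normD _ _) _; rewrite !normrZ ger0_norm ?subr_ge0 // ger0_norm //.
set M := Num.max _ _; have pM : `|p| <= M by rewrite le_max lexx.
have qM : `|q| <= M by rewrite le_max lexx orbT.
have := ler_wpM2l r0 qM; have := ler_wpM2l (_ : 0 <= 1 - r) pM.
by rewrite subr_ge0 => /(_ r1); lra.
Qed.

(* Since bd U is tangent to [dc] at [c tau], the segment from
   [c tau - s *: perp dc] to [c tau + s *: v] does not meet it. *)
Lemma transversality U c tau dc v : open U ->
  is_derive (tau : R) 1 c dc -> dc != 0 -> local_boundary U c tau ->
  points_into U (c tau) (perp dc) -> dot v (perp dc) < 0 ->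
  exists2 e : R, 0 < e & forall s, 0 < s < e -> ~ closure U (c tau + s *: v).
Proof.
move=> oU cdc dc0 loc [e1 e10 into] vn; set n := perp dc in into vn *.
have nn : 0 < dot n n by rewrite dot_gt0 perp_neq0.
have n0 : 0 < `|n| by rewrite normr_gt0 perp_neq0.
have nd0 : 0 < `|dc| by rewrite normr_gt0.
pose M := Num.max `|- n| `|v|.
have M0 : 0 < M by rewrite lt_max normrN n0.
(* Every point [w] between [- n] and [v] satisfies [dot w n <= - kap]: the segment keeps a definite
   normal distance below the tangent line. *)
pose kap := Num.min (dot n n) (- dot v n).
have kap0 : 0 < kap by rewrite lt_min nn oppr_gt0 vn.
(* The first entry bounds the time offset [h] by a multiple of [s]. The second makes the deviation
   of the curve from its tangent too small to reach normal depth [s * kap]. *)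
pose ep := Num.min (`|dc| / 2) (kap * `|dc| / (16 * `|n| * M)).
have ep0 : 0 < ep by rewrite lt_min !divr_gt0 ?mulr_gt0.
have [d d0 dP] := (is_derive_epsP _ _ _ _).1 cdc ep ep0.
have [r r0 rP] := loc d d0.
exists (Num.min e1 (r / M)); first by rewrite lt_min e10 divr_gt0.
move=> s /andP[s0]; rewrite lt_min => /andP[se1 sr].
have := @segment_out _ U (c tau + s *: - n) (c tau + s *: v) oU; apply; last first.
  by have [|_] := into s; [rewrite s0|rewrite scalerN].
move=> t t01 /bd_open[//|cU nU].
set w := - n + t *: (v - - n).
have ew : c tau + s *: - n + t *: (c tau + s *: v - (c tau + s *: - n)) = c tau + s *: w.
  by apply: row2P; plane.
rewrite ew in cU nU.
have wM : `|w| <= M by exact: norm_conv_le.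
have wk : dot w n <= - kap.
  have -> : dot w n = (1 - t) * - dot n n + t * dot v n by plane.
  have k1 : kap <= dot n n by rewrite ge_min lexx.
  have k2 : kap <= - dot v n by rewrite ge_min lexx orbT.
  by move/andP: t01 => [t0 t1]; nra.
have [|b bd e] := rP _ cU nU.
  rewrite addrAC subrr add0r normrZ gtr0_norm //.
  by apply: le_lt_trans (ler_wpM2l (ltW s0) wM) _; rewrite -ltr_pdivlMr.
have := dP (b - tau) bd; rewrite [_ *: 1]mulr1 [tau + _]addrC subrK -e [_ - c tau]addrAC subrr add0r.
set h := b - tau => H.
have H1 : `|h| * `|dc| <= s * M + ep * `|h|.
  have -> : `|h| * `|dc| = `|s *: w - (s *: w - h *: dc)| by rewrite subKr normrZ.
  apply: le_trans (ler_normB _ _) _; apply: lerD => //.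
  by rewrite normrZ gtr0_norm // ler_wpM2l // ltW.
have ep1 : ep <= `|dc| / 2 by rewrite ge_min lexx.
have ep2 : ep * (16 * `|n| * M) <= kap * `|dc|.
  by rewrite -ler_pdivlMr ?mulr_gt0 // ge_min lexx orbT.
have H2 : `|h| * `|dc| <= 2 * s * M.
  have := ler_wpM2r (normr_ge0 h) ep1; nra.
have H3 : s * kap <= 2 * `|n| * (ep * `|h|).
  (* The tangential part [h *: dc] is orthogonal to [n], so only the remainder of the first-order
     expansion contributes. *)
  have E : dot (s *: w) n = dot (s *: w - h *: dc) n by rewrite /n; plane.
  have Ha := dot_le (s *: w - h *: dc) n; rewrite -E dotZl in Ha.
  have Hb := ler_wpM2l (normr_ge0 n) H.
  have Hc : s * kap <= `|s * dot w n|.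
    by rewrite normrM gtr0_norm // ler_pM2l // ler_normr lerNr wk orbT.
  lra.
have H4 : s * kap * `|dc| <= 2 * `|n| * ep * (2 * s * M).
  apply: le_trans (ler_wpM2r (ltW nd0) H3) _.
  have -> : 2 * `|n| * (ep * `|h|) * `|dc| = 2 * `|n| * ep * (`|h| * `|dc|) by ring.
  by apply: ler_wpM2l => //; rewrite !mulr_ge0 // ltW.
have H5 : 0 < s * (kap * `|dc|) by rewrite !mulr_gt0.
have := ler_wpM2l (ltW s0) ep2; lra.
Qed.

(** A point of K violating maximality can be moved slightly towards 0; it becomes interior and still
    violates the inequality. *)
Lemma maximizes_escape K u k : (forall p q (r : R), K p -> K q -> 0 <= r <= 1 -> K (p + r *: (q - p))) ->
  interior K 0 -> K k ->
  (forall z, interior K z -> dot u (z - k) <= 0) -> maximizes K u k.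
Proof.
move=> cK K0 Kk H; split=> // z Kz; rewrite leNgt; apply/negP => ltz.
have D0 : 0 < dot u z - dot u k by rewrite subr_gt0.
pose r := Num.min 1 ((dot u z - dot u k) / (2 * (`|dot u z| + 1))).
have a0 : 0 < `|dot u z| + 1 by rewrite ltr_wpDl.
have r0 : 0 < r by rewrite lt_min ltr01 divr_gt0 // mulr_gt0.
have r1 : r <= 1 by rewrite ge_min lexx.
have r2 : r * (2 * (`|dot u z| + 1)) <= dot u z - dot u k.
  by rewrite -ler_pdivlMr ?mulr_gt0 // ge_min lexx orbT.
have Iz : interior K (z + r *: (0 - z)) by apply: interior_convex => //; rewrite r0.
have := H _ Iz; rewrite dotBr dotDr dotZr dotBr dot0r sub0r mulrN.
have := ler_norm (dot u z); have := normr_ge0 (dot u z); nra.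
Qed.

(** First-order condition: the increment of [dot u] along the curve is nonpositive for both signs of
    [h], so its linear part vanishes. *)
Lemma maximizes_curve K u c tau dc : is_derive (tau : R) 1 c dc -> maximizes K u (c tau) ->
  (forall b, K (c b)) -> dot u dc = 0.
Proof.
move=> cdc [_ km] Kc.
have H (e : R) : 0 < e -> `|dot u dc| <= 2 * `|u| * e.
  move=> e0; have [d d0 dP] := (is_derive_epsP _ _ _ _).1 cdc e e0.
  have main (h : R) : `|h| < d -> h * dot u dc <= 2 * `|u| * e * `|h|.
    move=> hd; have := dP h hd; rewrite [_ *: 1]mulr1 => Hh.
    have := dot_le u (c (tau + h) - c tau - h *: dc); rewrite !dotBr dotZr ler_norml => /andP[Hl _].
    have := km _ (Kc (tau + h)) => Hm.
    have := ler_wpM2l (_ : 0 <= 2 * `|u|) Hh; rewrite mulr_ge0 // => /(_ isT); lra.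
  have d2 : `|d / 2| < d by rewrite gtr0_norm ?divr_gt0 // ltr_pdivrMr // ltr_pMr // ltr1n.
  have d20 : 0 < d / 2 by rewrite divr_gt0.
  have := main (d / 2) d2; have := main (- (d / 2)); rewrite normrN => /(_ d2).
  rewrite gtr0_norm // ler_norml => h1 h2.
  by apply/andP; split; rewrite -(ler_pM2l d20); lra.
apply/eqP; rewrite -normr_le0; apply/ler_addgt0Pr => e e0; rewrite add0r.
have u0 : 0 < 2 * `|u| + 1 by rewrite ltr_wpDl // mulr_ge0.
apply: le_trans (H (e / (2 * `|u| + 1)) _) _; first exact: divr_gt0.
rewrite mulrCA -[leRHS]mulr1 ler_pM2l // ler_pdivrMr // mul1r.
by rewrite lerDl.
Qed.

End Transversality.

Section Regular.
Variable R : realType.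
Implicit Types (c : R -> 'rV[R]_2) (A : set R).

Lemma Ck_le (V W : normedModType R) k l (A : set V) (f : V -> W) : (k <= l)%N -> Ck l A f -> Ck k A f.
Proof.
move=> kl H vs a sk Aa; have [h1 h2] := H vs a (leq_trans sk kl) Aa; split=> // sk'.
by apply: h2; apply: leq_trans kl.
Qed.

Lemma of_class_C2 (V W : normedModType R) s (A : set V) (f : V -> W) :
  admissible s -> of_class s A f -> Ck 2 A f.
Proof.
case: s => [k al [k2 _] [Ckf _]|_ H|_ [H _]]; last 2 first; [exact: H|exact: H|].
exact: Ck_le Ckf.
Qed.

Definition drv c (l : nat) : R -> 'rV[R]_2 := Defs.iterD c (nseq l 1).

Lemma drvS c l : drv c l.+1 = derive1 (drv c l).
Proof. by apply/funext => a; rewrite derive1E. Qed.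

Lemma drv1 c : drv c 1 = derive1 c. Proof. exact: drvS. Qed.
Lemma drv2 c : drv c 2 = derive1 (derive1 c). Proof. by rewrite drvS drv1. Qed.

Lemma Ck_drv k A c l a : Ck k A c -> (l <= k)%N -> A a -> {for a, continuous (drv c l)}.
Proof. by move=> H lk Aa; apply: (H (nseq l 1) a _ Aa).1; rewrite size_nseq. Qed.

Lemma Ck_is_derive k A c l a : Ck k A c -> (l < k)%N -> A a ->
  is_derive a 1 (drv c l) (drv c l.+1 a).
Proof.
move=> H lk Aa; have [|_ ] := H (nseq l 1) a _ Aa; rewrite size_nseq; first exact: ltnW.
by move=> /(_ lk 1) h; apply: DeriveDef.
Qed.

Lemma periodic_derive1 c : one_periodic c -> one_periodic (derive1 c).
Proof.
move=> pc a; rewrite /derive1.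
suff -> : (fun h : R => h^-1 *: (c (h + (a + 1)) - c (a + 1))) =
  (fun h => h^-1 *: (c (h + a) - c a)) by [].
by apply/funext => h; rewrite pc addrA pc.
Qed.

Lemma periodic_int (T : Type) (f : R -> T) (pf : forall t, f (t + 1) = f t) (n : int) a :
  f (a + n%:~R) = f a.
Proof.
have H (m : nat) b : f (b + m%:R) = f b.
  by elim: m => [|m IH] in b *; rewrite ?addr0 // -natr1 addrA pf IH.
by case: n => m; [exact: H|rewrite NegzE rmorphN /= -[in RHS](subrK m.+1%:R a) H].
Qed.

End Regular.

Lemma cross_decomp (R : realType) (n v w : 'rV[R]_2) : cross w n != 0 ->
  v = (cross w v / cross w n) *: n + (cross v n / cross w n) *: w.
Proof. by move=> wn; apply: row2P; rewrite !mxE; move: wn; rewrite /cross => wn; field. Qed.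

(** The algebra behind [tangent_cone]: a step [a *: n + b *: w] becomes a point between one on the
    chord along [w] and the point at height [e] along [n]. *)
Lemma convex_decomp (R : realType) (p n w : 'rV[R]_2) (r a b a' e : R) :
  r * a = a' * e -> 1 - a' != 0 ->
  p + r *: (a *: n + b *: w) = p + (r * b / (1 - a')) *: w +
    a' *: (p + e *: n - (p + (r * b / (1 - a')) *: w)).
Proof.
by move=> h a1; rewrite scalerDr !scalerA h; apply: row2P; rewrite !mxE; field.
Qed.

(** * The boundary curve of K and its normals *)

Section Gbody.
Variable R : realType.
Variables (s : regularity R) (K : set 'rV[R]_2) (g : R -> 'rV[R]_2).
Hypothesis hs : admissible s.
Hypothesis hK : gauge_body s K g.

Let kK : compact K := gb_compact hK.
Let cK := convex_setP (gb_convex hK).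
Let K0 : interior K 0 := gb_zero hK.
Let bp := gb_boundary hK.

Lemma body_C2 : Ck 2 setT g.
Proof. exact: of_class_C2 hs (bp_class bp). Qed.

Lemma body_derive a : is_derive (a : R) 1 g (derive1 g a).
Proof.
have := @Ck_is_derive _ 2 setT g 0 a body_C2 isT I.
by rewrite drv1.
Qed.

Lemma body_derive2 a : is_derive (a : R) 1 (derive1 g) (derive1 (derive1 g) a).
Proof.
have := @Ck_is_derive _ 2 setT g 1 a body_C2 isT I.
by rewrite drv1 drv2.
Qed.

Lemma body_continuous2 : continuous (derive1 (derive1 g)).
Proof. by move=> a; rewrite -drv2; apply: (Ck_drv body_C2). Qed.

Lemma body_bd a : bd K (g a).
Proof. by rewrite -(bp_range bp); exists a. Qed.

Lemma body_K a : K (g a).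
Proof. by have [+ _] := body_bd a; move=> /(closedK kK). Qed.

Lemma periodic_inj a b : g a = g b -> exists n : int, a = b + n%:~R.
Proof.
move=> e.
have fl (r : R) : 0 <= r + (- Num.floor r)%:~R < 1.
  by rewrite rmorphN /=; have := floor_le_tmp r; have := floorD1_gt r; rewrite intrD => h1 h2; apply/andP; split; lra.
have := bp_simple bp (fl a) (fl b).
rewrite !(periodic_int (bp_periodic bp)) => /(_ e) h.
exists (Num.floor a - Num.floor b); move: h; rewrite rmorphB !rmorphN /=; lra.
Qed.

Lemma local_boundary_body a : local_boundary (interior K) g a.
Proof.
move=> d d0.
(* Closeness to [a] modulo 1, since the curve is injective only up to its period. *)
pose P (j : 'I_1) (b : R) := exists n : int, `|b + n%:~R - a| < d.
have gc : continuous g by move=> b; apply: is_derive_continuous (body_derive b).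
have [||j b b01 e|r r0 rP] := @arcs_local R 1 (fun _ => g) P (g a).
- by move=> _; exact: continuous_subspaceT.
- move=> j; apply: open_closedC; rewrite openE => b [n bn].
  apply/interior_ballP; exists (d - `|b + n%:~R - a|); first by rewrite subr_gt0.
  move=> z zb; exists n.
  have -> : z + n%:~R - a = (z - b) + (b + n%:~R - a) by ring.
  by apply: le_lt_trans (ler_normD _ _) _; rewrite -ltrBrDr.
- have [n an] := periodic_inj (esym e); exists n.
  by rewrite -an subrr normr0.
exists r => // z cz nz zr.
have Kz : K z by apply: (closedK kK); apply: closureS cz; exact: interior_subset.
have : bd K z by split => //; exact: subset_closure.
rewrite -(bp_range bp) => -[b0 _ zb0].
have b01 : 0 <= b0 + (- Num.floor b0)%:~R <= 1.
  by rewrite rmorphN /=; have := floor_le_tmp b0; have := floorD1_gt b0; rewrite intrD => h1 h2; apply/andP; split; lra.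
have gb : g (b0 + (- Num.floor b0)%:~R) = z by rewrite (periodic_int (bp_periodic bp)).
have [|n bn] := rP 0 _ b01; first by rewrite gb.
exists (b0 + (- Num.floor b0)%:~R + n%:~R) => //.
by rewrite (periodic_int (bp_periodic bp)) gb.
Qed.

(** An interior point [z] on the wrong side of the tangent gives a direction which leaves the
    closure by [transversality], although convexity keeps the segment from [g a] to [z] inside. *)
Lemma normal_maximizes a : maximizes K (- nu g a) (g a).
Proof.
apply: maximizes_escape => //; first exact: body_K.
move=> z Iz; rewrite leNgt; apply/negP => H.
have [||||||e e0 eP] := @transversality R (interior K) g a (derive1 g a) (z - g a).
- exact: open_interior.
- exact: body_derive.
- exact: bp_regular bp a.
- exact: local_boundary_body.
- exact: bp_inward bp a.
- by move: H; rewrite dotNl oppr_gt0 dotC.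
pose r := Num.min 1 (e / 2).
have r0 : 0 < r by rewrite lt_min ltr01 divr_gt0.
have re : r < e by rewrite gt_min ltr_pdivrMr // ltr_pMr // ltr1n orbT.
have r1 : r <= 1 by rewrite ge_min lexx.
apply: (eP r); first by rewrite r0.
by apply: subset_closure; apply: interior_convex => //; [exact: body_K|rewrite r0].
Qed.

(** The first-order condition makes [u] a multiple of the normal. The sign follows because [u] and
    the outward normal are both positive at the common support point, 0 being interior. *)
Lemma maximizes_range u k : u != 0 -> maximizes K u k ->
  exists a, k = g a /\ exists2 l : R, 0 < l & u = - l *: nu g a.
Proof.
move=> u0 km; have := maximizes_bd u0 km.
rewrite -(bp_range bp) => -[a _ e]; exists a; split=> //.
rewrite -e in km.
have ug : dot u (derive1 g a) = 0 := maximizes_curve (body_derive a) km body_K.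
have eu := orth_perp (bp_regular bp a) ug; rewrite -/(nu g a) in eu.
set l := (X in X *: _) in eu.
have p1 := maximizes_gt0 K0 u0 km.
have n0 : - nu g a != 0 by rewrite oppr_eq0 perp_neq0; exact: bp_regular bp a.
have p2 := maximizes_gt0 K0 n0 (normal_maximizes a).
exists (- l); last by rewrite opprK.
by move: p1 p2; rewrite eu dotZl dotNl oppr_gt0; nra.
Qed.

Lemma maximizes_uniq u k k' : u != 0 -> maximizes K u k -> maximizes K u k' -> k = k'.
Proof. exact: (maximizes_unique cK (gb_strict hK)). Qed.

(** With a short chord [w] of the boundary curve, [v] is a combination of [n] with positive and of
    [w] with nonnegative coefficient. A small step along [v] then lies between a point of the chord
    and an interior point of K on the normal. *)
Lemma tangent_cone a v : 0 < dot v (nu g a) ->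
  exists2 e : R, 0 < e & forall r, 0 < r <= e -> interior K (g a + r *: v).
Proof.
set n := nu g a => vn; set t := derive1 g a.
have tt : 0 < dot t t by rewrite dot_gt0; exact: bp_regular bp a.
have nE : n = perp t by [].
have [e1 e10 into] := bp_inward bp a; rewrite -/n in into.
(* The chord is taken forwards or backwards according to the tangential component of [v], so that
   its coefficient [be] is nonnegative. *)
pose sg : R := if 0 <= cross v n then 1 else -1.
have sg1 : `|sg| = 1 by rewrite /sg; case: ifP => _; rewrite ?normrN normr1.
have sgv : 0 <= sg * cross v n.
  by rewrite /sg; case: ifPn; rewrite ?mul1r // -ltNge mulN1r oppr_ge0 => /ltW.
pose m := dot v n; have m0 : 0 < m by [].
have n0 : 0 < `|n| by rewrite normr_gt0 nE perp_neq0; exact: bp_regular bp a.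
have v0 : 0 < `|v|.
  by rewrite normr_gt0; apply: contraTneq vn => ->; rewrite dotC dot0r ltxx.
(* The two entries make the errors in [cross w n] and [cross w v] at most half of their leading
   terms [h * dot t t] and [h * m], which fixes both signs. *)
pose ep := Num.min (dot t t / (4 * `|n|)) (m / (4 * `|v|)).
have ep0 : 0 < ep by rewrite lt_min !divr_gt0 ?mulr_gt0.
have [d d0 dP] := (is_derive_epsP _ _ _ _).1 (body_derive a) ep ep0.
pose h := sg * (d / 2).
have d20 : 0 < d / 2 by rewrite divr_gt0.
have hn : `|h| = d / 2 by rewrite normrM sg1 mul1r gtr0_norm.
have hd : `|h| < d by rewrite hn ltr_pdivrMr // ltr_pMr // ltr1n.
have hh : sg * h = d / 2 by rewrite /h mulrA -expr2 -real_normK ?num_real // sg1 expr1n mul1r.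
have h0 : h != 0 by rewrite -normr_eq0 hn gt_eqF.
have := dP h hd; rewrite [_ *: 1]mulr1 -/t hn => Hw.
pose w := g (a + h) - g a.
have crl (u u' : 'rV[R]_2) : `|cross u u'| <= 2 * `|u| * `|u'|.
  have -> : cross u u' = dot u (- perp u') by plane.
  apply: le_trans (dot_le _ _) _; rewrite normrN.
  suff -> : `|perp u'| = `|u'| by [].
  by rewrite !norm2E perp0 perp1 normrN maxC.
have E1 : `|cross w n - h * dot t t| <= dot t t * (d / 2) / 2.
  have -> : cross w n - h * dot t t = cross (w - h *: t) n by rewrite nE; plane.
  apply: le_trans (crl _ _) _.
  have : ep * (4 * `|n|) <= dot t t by rewrite -ler_pdivlMr ?mulr_gt0 // ge_min lexx.
  move=> /(ler_wpM2r (ltW d20)); have := ler_wpM2r (ltW n0) Hw; lra.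
have E2 : `|cross w v - h * m| <= m * (d / 2) / 2.
  have -> : cross w v - h * m = cross (w - h *: t) v by rewrite /m nE; plane.
  apply: le_trans (crl _ _) _.
  have : ep * (4 * `|v|) <= m by rewrite -ler_pdivlMr ?mulr_gt0 // ge_min lexx orbT.
  move=> /(ler_wpM2r (ltW d20)); have := ler_wpM2r (ltW v0) Hw; lra.
have sgE (X Y : R) : 0 < Y -> `|X - h * Y| <= Y * (d / 2) / 2 -> 0 < sg * X.
  move=> Y0 H; have : `|sg * X - (d / 2) * Y| <= Y * (d / 2) / 2.
    have -> : sg * X - d / 2 * Y = sg * (X - h * Y) by rewrite -hh; ring.
    by rewrite normrM sg1 mul1r.
  rewrite ler_norml => /andP[h1 _]; have := mulr_gt0 Y0 d20; lra.
have P1 := sgE _ _ tt E1; have P2 := sgE _ _ m0 E2.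
have cw0 : cross w n != 0 by apply: contraTneq P1 => ->; rewrite mulr0 ltxx.
pose al := cross w v / cross w n; pose be := cross v n / cross w n.
have sg2 : sg * sg = 1 by rewrite -expr2 -real_normK ?num_real // sg1 expr1n.
have al0 : 0 < al.
  have -> : al = (sg * cross w v) / (sg * cross w n).
    by rewrite /al -mulf_div divff ?mul1r // -normr_eq0 sg1 oner_eq0.
  exact: divr_gt0.
have be0 : 0 <= be.
  have -> : be = (sg * cross v n) / (sg * cross w n).
    by rewrite /be -mulf_div divff ?mul1r // -normr_eq0 sg1 oner_eq0.
  by rewrite divr_ge0 // ltW.
have vE : v = al *: n + be *: w.
  exact: cross_decomp.
have [e2 e20 Iz] : exists2 e2, 0 < e2 & interior K (g a + e2 *: n).
  have e20 : 0 < e1 / 2 by rewrite divr_gt0.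
  have e21 : e1 / 2 < e1 by rewrite ltr_pdivrMr // ltr_pMr // ltr1n.
  exists (e1 / 2); first exact: e20.
  by have [|hz _] := into (e1 / 2); [rewrite e20|exact: hz].
have b10 : 0 < be + 1 by rewrite ltr_wpDl.
(* These bounds keep [r * al / e2] and [r * be] at most 1/2, so that both convex weights stay in
   [0, 1]. *)
exists (Num.min (e2 / (2 * al)) (1 / (2 * (be + 1)))).
  by rewrite lt_min; apply/andP; split; apply: divr_gt0 => //; exact: mulr_gt0.
move=> r /andP[r0]; rewrite le_min => /andP[r1 r2].
have r1' : r * al / e2 <= 1 / 2.
  have h1 : r * (2 * al) <= e2 by rewrite -ler_pdivlMr //; exact: mulr_gt0.
  by rewrite ler_pdivrMr //; lra.
have r2' : r * be <= 1 / 2.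
  have h1 : r * (2 * (be + 1)) <= 1 by rewrite -ler_pdivlMr //; exact: mulr_gt0.
  by lra.
pose a' := r * al / e2; have a'0 : 0 < a' by rewrite divr_gt0 // mulr_gt0.
have a'1 : 0 < 1 - a' by move: r1'; rewrite -/a'; lra.
pose q := g a + (r * be / (1 - a')) *: (g (a + h) - g a).
have Kq : K q.
  apply: cK; try exact: body_K.
  apply/andP; split; first exact: divr_ge0 (mulr_ge0 (ltW r0) be0) (ltW a'1).
  rewrite ler_pdivrMr // mul1r.
  by move: r1'; rewrite -/a'; lra.
have -> : g a + r *: v = q + a' *: (g a + e2 *: n - q).
  by rewrite vE; apply: convex_decomp; rewrite ?gt_eqF // /a' divfK ?gt_eqF.
apply: interior_convex => //.
by rewrite a'0 /=; move: r1'; rewrite -/a'; lra.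
Qed.

End Gbody.

(** * Closest points on the boundary of U *)

Section Distance.
Variable R : realType.
Variables (s : regularity R) (K : set 'rV[R]_2) (g : R -> 'rV[R]_2).
Hypothesis hs : admissible s.
Hypothesis hK : gauge_body s K g.
Variables (U : set 'rV[R]_2).
Hypothesis oU : open U.
Hypothesis bU : bounded_set U.
Implicit Types x y z : 'rV[R]_2.

Let kK : compact K := gb_compact hK.
Let cK := convex_setP (gb_convex hK).
Let K0 : interior K 0 := gb_zero hK.

Lemma compact_bd : compact (bd U).
Proof.
apply: bounded_closed_compact.
  have [M M0 MP] := ex_strict_bound_gt0 bU.
  exists M; split; [exact: num_real|move=> N MN z [cz _] /=; apply: le_trans (ltW MN)].
  apply/ler_addgt0Pr => e e0.
  have [|z' [Uz' /= zz']] := cz (ball z e); first exact: nbhsx_ballx.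
  have -> : z = z' + (z - z') by rewrite addrC subrK.
  apply: le_trans (ler_normD _ _) _; apply: lerD; first exact/ltW/MP.
  by move: zz'; rewrite -ball_normE /ball_ /= => /ltW.
have -> : bd U = closure U `&` ~` U by rewrite /bd ((interior_id U).1 oU).
by apply: closedI; [exact: closed_closure|exact: open_closedC].
Qed.

Lemma dist_le x z : bd U z -> distK K U x <= gauge K (x - z).
Proof.
move=> bz; apply: ge_inf; last by exists z.
by exists 0 => _ [w _ <-]; exact: gauge_ge0.
Qed.

Lemma gauge_sub_continuous x : continuous (fun z => gauge K (x - z)).
Proof.
move=> z; have [C C0 CP] := gauge_lipschitz cK K0.
apply/continuous_epsP => e e0; exists (e / C); first exact: divr_gt0.
move=> w; rewrite ltr_pdivlMr // mulrC => zw.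
have e1 : x - w - (x - z) = - (w - z) by rewrite !opprB addrC addrA subrK.
have e2 : x - z - (x - w) = w - z by apply: row2P; plane.
have := CP (x - w) (x - z); have := CP (x - z) (x - w).
rewrite e1 e2 normrN => h1 h2; rewrite ltr_norml; apply/andP; split; lra.
Qed.

Lemma closest_exists x : bd U !=set0 -> exists y, closest K U x y.
Proof.
move=> b0; have [y yb ym] := EVT_min_rV b0 compact_bd
  (continuous_subspaceT (@gauge_sub_continuous x)).
have by_ := set_mem yb; exists y; split=> //; apply/le_anti; rewrite dist_le //=.
by apply: lb_le_inf; [exists (gauge K (x - y)), y|move=> _ [z bz <-]; exact/ym/mem_set].
Qed.

Lemma closest_neq x y : U x -> closest K U x y -> x - y != 0.
Proof.
move=> Ux [/(bd_open _ oU)[_ nU] _]; apply: contra_not_neq nU => /eqP.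
by rewrite subr_eq0 => /eqP <-.
Qed.

Lemma dist_gt0 x y : U x -> closest K U x y -> 0 < distK K U x.
Proof. by move=> Ux cy; have xy := closest_neq Ux cy; case: cy => _ ->; exact: gauge_gt0. Qed.

(** Every point of the segment from [x] to [z] has gauge distance from [x] less than [distK K U x],
    so none is a boundary point. *)
Lemma ball_subset x z : U x -> gauge K (x - z) < distK K U x -> U z.
Proof.
move=> Ux zx; apply: (segment_in oU _ Ux) => r /andP[r0 r1] /(dist_le x).
have -> : x - (x + r *: (z - x)) = r *: (x - z).
  by apply: row2P; rewrite !mxE; ring.
have g0 := gauge_ge0 K0 (x - z).
move: r0; rewrite le_eqVlt => /orP[/eqP <-|r0].
  rewrite scale0r; have [C C0 CP] := gauge_bound K0.
  by have := CP 0; rewrite normr0 mulr0; lra.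
by rewrite gaugeZ //; have := ler_wpM2r g0 r1; rewrite mul1r; lra.
Qed.

Lemma closest_bd x y : U x -> closest K U x y ->
  bd K ((distK K U x)^-1 *: (x - y)).
Proof.
move=> Ux cy; have d0 := dist_gt0 Ux cy; apply/bd_gauge => //.
by case: cy => _ e; rewrite gaugeZ ?invr_gt0 // -e mulVf ?gt_eqF.
Qed.

Lemma ball_direction x y (k := (distK K U x)^-1 *: (x - y)) z (r : R) :
  U x -> closest K U x y -> interior K (k + r *: z) ->
  U (y + (r * distK K U x) *: - z).
Proof.
move=> Ux cy Iz; have d0 := dist_gt0 Ux cy; apply: (ball_subset Ux).
have -> : x - (y + (r * distK K U x) *: - z) = distK K U x *: (k + r *: z).
  rewrite scalerDr !scalerA divff ?gt_eqF // scale1r mulrC.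
  by apply: row2P; rewrite !mxE; ring.
rewrite gaugeZ // -[ltRHS]mulr1 ltr_pM2l //.
exact/interior_gauge.
Qed.

(** The argument of [normal_maximizes], for the touching translate: a violating interior [z] yields
    the direction [- (z - k)], which leaves [U] by [transversality] and stays in [U] by
    [ball_direction]. *)
Lemma closest_maximizes x c tau dc : U x -> closest K U x (c tau) ->
  is_derive (tau : R) 1 c dc -> dc != 0 -> local_boundary U c tau ->
  points_into U (c tau) (perp dc) ->
  maximizes K (perp dc) ((distK K U x)^-1 *: (x - c tau)).
Proof.
move=> Ux cx cdc dc0 loc into; set k := _ *: _.
have d0 := dist_gt0 Ux cx; set d := distK K U x in k d0 *.
have Kk : K k by have [+ _] := closest_bd Ux cx; exact: closedK.
apply: maximizes_escape => // z Iz; rewrite leNgt; apply/negP => H.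
have [|e e0 eP] := transversality oU cdc dc0 loc into (v := - (z - k)).
  by rewrite dotNl dotC oppr_lt0.
pose r := Num.min 1 (e / (2 * d)).
have e2d : 0 < e / (2 * d) by rewrite divr_gt0 // mulr_gt0.
have r0 : 0 < r by rewrite lt_min ltr01.
have r1 : r <= 1 by rewrite ge_min lexx.
have rd : r * d < e.
  have : r * (2 * d) <= e by rewrite -ler_pdivlMr; [rewrite ge_min lexx orbT|rewrite mulr_gt0].
  by lra.
apply: (eP (r * d)); first by rewrite mulr_gt0.
apply: subset_closure; apply: (ball_direction Ux cx).
by apply: interior_convex => //; rewrite r0.
Qed.

Lemma dist_lipschitz : bd U !=set0 -> exists2 C : R, 0 < C &
  forall x z, `|distK K U x - distK K U z| <= C * `|x - z|.
Proof.
move=> b0; have [C C0 CP] := gauge_lipschitz cK K0; exists C => // x z.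
have H a b : distK K U a <= distK K U b + C * `|a - b|.
  have [y [yb ->]] := closest_exists b b0; apply: le_trans (dist_le a yb) _.
  have -> : a - b = (a - y) - (b - y) by apply: row2P; plane.
  exact: CP.
have := H x z; have := H z x; rewrite [`|z - x|]distrC => h1 h2.
by rewrite ler_norml; apply/andP; split; lra.
Qed.

(** On the compact part of the boundary at distance at least [r] from [y], the gauge exceeds the
    minimum by a positive gap, which survives a small change of [x]. *)
Lemma closest_near x y : U x -> closest K U x y -> (forall z, closest K U x z -> z = y) ->
  forall r : R, 0 < r -> exists2 e : R, 0 < e &
    forall x' z, `|x' - x| < e -> closest K U x' z -> `|z - y| < r.
Proof.
move=> Ux cy uy r r0; have [C C0 CP] := gauge_lipschitz cK K0.
pose F := bd U `&` [set z | r <= `|z - y|].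
have [F0|/set0P F0] := eqVneq F set0.
  exists 1 => // x' z _ [bz _]; rewrite ltNge; apply/negP => h.
  by have : F z by []; rewrite F0.
have kF : compact F.
  apply: compact_closedI; first exact: compact_bd.
  have -> : [set z | r <= `|z - y|] = (fun z => `|z - y|) @^-1` [set t | r <= t] by [].
  apply: closed_comp; last exact: closed_ge.
  move=> z _; apply/continuous_epsP => e e0; exists e => // w wz.
  apply: le_lt_trans wz; apply: le_trans (ler_dist_dist _ _) _.
  by rewrite opprB addrA subrK.
have [z0 /set_mem[bz0 z0r] zm] := EVT_min_rV F0 kF
  (continuous_subspaceT (@gauge_sub_continuous x)).
have eta0 : 0 < gauge K (x - z0) - distK K U x.
  rewrite subr_gt0 lt_neqAle dist_le // andbT; apply/eqP => e.
  by move: z0r; rewrite /= (uy z0 (conj bz0 e)) subrr normr0 leNgt r0.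
(* Replacing [x] by [x'] costs [C] times the displacement at each of two points, so half of the gap
   for each suffices. *)
exists ((gauge K (x - z0) - distK K U x) / (2 * C)).
  by rewrite divr_gt0 // mulr_gt0.
move=> x' z; rewrite ltr_pdivlMr ?mulr_gt0 // => hx [bz ez].
rewrite ltNge; apply/negP => h.
have Fz : F z by [].
have h1 := zm _ (mem_set Fz).
have h2 := dist_le x' (cy.1); have h3 := cy.2.
have h4 := CP (x - z) (x' - z); have h5 := CP (x' - y) (x - y).
have e1 : x - z - (x' - z) = - (x' - x) by apply: row2P; plane.
have e2 : x' - y - (x - y) = x' - x by apply: row2P; plane.
by rewrite e1 normrN in h4; rewrite e2 in h5; lra.
Qed.

End Distance.

(** * The arcs of the boundary near a closest point *)

Section Domain.
Variable R : realType.
Variables (s : regularity R) (K : set 'rV[R]_2) (g : R -> 'rV[R]_2).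
Hypothesis hs : admissible s.
Hypothesis hK : gauge_body s K g.
Variables (U : set 'rV[R]_2) (N : nat) (c : 'I_N -> R -> 'rV[R]_2) (succ : {perm 'I_N}).
Hypothesis oU : open U.
Hypothesis bU : bounded_set U.
Hypothesis hU : piecewise_boundary c succ s U.

Let kK : compact K := gb_compact hK.
Let cK := convex_setP (gb_convex hK).
Let K0 : interior K 0 := gb_zero hK.

Lemma arc_C2 i : exists A : set R, [/\ open A, `[0, 1]%classic `<=` A & Ck 2 A (c i)].
Proof.
have [A [oA sA cA]] := pb_class hU i; exists A; split=> //.
exact: of_class_C2 hs cA.
Qed.

Lemma arc_derive i (t : R) : 0 <= t <= 1 -> is_derive t 1 (c i) (derive1 (c i) t).
Proof.
move=> t01; have [A [oA sA cA]] := arc_C2 i; rewrite -drv1.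
by apply: (@Ck_is_derive _ 2 A (c i) 0 t cA) => //; apply: sA; rewrite /= in_itv.
Qed.

Lemma arc_continuous i (t : R) : 0 <= t <= 1 -> {for t, continuous (c i)}.
Proof. by move=> /(arc_derive i)/is_derive_continuous. Qed.

Lemma arc_continuous1 i (t : R) : 0 <= t <= 1 -> {for t, continuous (derive1 (c i))}.
Proof.
move=> t01; have [A [oA sA cA]] := arc_C2 i; rewrite -drv1.
by apply: (Ck_drv cA) => //; apply: sA; rewrite /= in_itv.
Qed.

Lemma arc_within i : {within `[0, 1]%classic, continuous (c i)}.
Proof.
apply: continuous_in_subspaceT => t /set_mem /=; rewrite in_itv /= => t01.
exact: arc_continuous.
Qed.

Lemma arc_bd i (t : R) : 0 <= t <= 1 -> bd U (c i t).
Proof. by move=> t01; rewrite (pb_cover hU); exists i => //; exists t => //=; rewrite in_itv. Qed.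

Lemma bd_arc z : bd U z -> exists i (t : R), 0 <= t <= 1 /\ z = c i t.
Proof.
rewrite (pb_cover hU) => -[i _ [t /= + <-]]; rewrite in_itv /= => t01.
by exists i, t.
Qed.

(* A closed arc may be used at times outside [0, 1], so that good times are open. *)
Definition good i (t : R) := 0 < t < 1 \/ (one_periodic (c i) /\ -1 < t < 2).

Lemma periodic_succ i : one_periodic (c i) -> succ i = i.
Proof.
move=> pi; have e : c i 0 = c i 1 by rewrite -[in RHS](add0r 1) pi.
by have [] := pb_simple hU (lexx 0) ltr01 (lexx 1) e.
Qed.

(** Brings an extended time back into [0, 1] by a period, so that the boundary hypotheses, stated
    there, hold at all good times. *)
Lemma good_base i (t : R) : good i t -> exists n : int, 0 <= t + n%:~R <= 1 /\
  interior_time c i (t + n%:~R) /\ forall b, c i (b + n%:~R) = c i b.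
Proof.
case=> [t01|[pi /andP[t1 t2]]].
  exists 0; rewrite addr0; split; last by split; [left|move=> b; rewrite addr0].
  by case/andP: t01 => *; rewrite !ltW.
have [t0|t0] := ltP t 0; last have [t1'|t1'] := ltP 1 t.
- have e : 0 <= t + 1%:~R <= 1 by rewrite mulr1z; apply/andP; split; lra.
  by exists 1; split=> //; split=> [|b]; [right|rewrite (periodic_int pi)].
- have e : 0 <= t + (-1)%:~R <= 1 by rewrite mulrN1z; apply/andP; split; lra.
  by exists (-1); split=> //; split=> [|b]; [right|rewrite (periodic_int pi)].
- have e : 0 <= t + 0%:~R <= 1 by rewrite addr0 t0 t1'.
  by exists 0; split=> //; split=> [|b]; [right|rewrite addr0].
Qed.

Lemma shift_derive (V : normedModType R) (f : R -> V) (a t : R) df :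
  (forall b, f (b + a) = f b) -> is_derive (t + a) 1 f df -> is_derive t 1 f df.
Proof.
move=> fa /is_derive_epsP H; apply/is_derive_epsP => e e0.
by have [d d0 dP] := H e e0; exists d => // h /dP; rewrite [t + a + _]addrAC !fa.
Qed.

Lemma shift_derive1 (V : normedModType R) (f : R -> V) (a t : R) :
  (forall b, f (b + a) = f b) -> derive1 f (t + a) = derive1 f t.
Proof.
move=> fa; rewrite /derive1.
suff -> : (fun h : R => h^-1 *: (f (h + (t + a)) - f (t + a))) =
  (fun h => h^-1 *: (f (h + t) - f t)) by [].
by apply/funext => h; rewrite fa addrA fa.
Qed.

Lemma good_derive i (t : R) : good i t -> is_derive t 1 (c i) (derive1 (c i) t).
Proof.
move=> /good_base[n [t01 [_ pn]]]; apply: (shift_derive pn).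
by rewrite -(shift_derive1 t pn); exact: arc_derive.
Qed.

Lemma good_into i (t : R) : good i t -> points_into U (c i t) (nu (c i) t).
Proof.
move=> /good_base[n [_ [it pn]]]; have := pb_inward hU it.
by rewrite pn /nu (shift_derive1 t pn).
Qed.

Lemma good_regular i (t : R) : good i t -> derive1 (c i) t != 0.
Proof.
move=> /good_base[n [t01 [_ pn]]]; have := pb_regular hU i t01.
by rewrite (shift_derive1 t pn).
Qed.

Lemma good_bd i (t : R) : good i t -> bd U (c i t).
Proof. by move=> /good_base[n [t01 [_ pn]]]; have := arc_bd i t01; rewrite pn. Qed.

(** Two arcs meet only at end times, and at a good end time the arc is closed and its own successor,
    which excludes a second arc. On arc [i] itself simplicity leaves only [t] modulo the period. *)
Lemma good_local i (t : R) : good i t -> local_boundary U (c i) t.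
Proof.
move=> gt d d0.
pose P (l : 'I_N) (b : R) := l = i /\
  exists2 n : int, `|b + n%:~R - t| < d & (n = 0 \/ one_periodic (c i)).
have [||l b b01 e|r r0 rP] := @arcs_local R N c P (c i t).
- exact: arc_within.
- move=> l; apply: open_closedC; rewrite openE => b [li [n bn pn]].
  apply/interior_ballP; exists (d - `|b + n%:~R - t|); first by rewrite subr_gt0.
  move=> z zb; split=> //; exists n => //.
  have -> : z + n%:~R - t = (z - b) + (b + n%:~R - t) by ring.
  by apply: le_lt_trans (ler_normD _ _) _; rewrite -ltrBrDr.
- have [n [t01 [it pn]]] := good_base gt; set t0 := t + n%:~R in t01 it.
  have e0 : c i t0 = c l b by rewrite pn.
  have li : l = i.
    apply: contrapT => /eqP; rewrite eq_sym => il.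
    case: it => [/andP[h0 h1]|[pi _]].
      by have [[h _ _]|[h _ _]] := pb_meet hU il t01 b01 e0; move: h0 h1; rewrite h ltxx.
    have si := periodic_succ pi.
    have [[_ _ h]|[_ _ h]] := pb_meet hU il t01 b01 e0.
      by move: il; rewrite h si eqxx.
    by move: il; rewrite -(inj_eq (@perm_inj _ succ)) -h si eqxx.
  split=> //; subst l; case: gt => [/andP[h0 h1]|[pi /andP[h0 h1]]].
    exists 0; last by left.
    suff -> : b = t by rewrite addr0 subrr normr0.
    have t01' : 0 <= t <= 1 by rewrite !ltW.
    case: (ltgtP b t) => // bt.
    - have [_ h _] := pb_simple hU (proj1 (andP b01)) bt (ltW h1) e.
      by move: h1; rewrite h ltxx.
    - have [h _ _] := pb_simple hU (ltW h0) bt (proj2 (andP b01)) (esym e).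
      by move: h0; rewrite h ltxx.
  have [m bm] : exists m : int, b + m%:~R = t0.
    case: (ltgtP b t0) => bt; last by exists 0; rewrite addr0.
    - have [h h' _] := pb_simple hU (proj1 (andP b01)) bt (proj2 (andP t01)) (esym e0).
      by exists 1; rewrite h h' mulr1z add0r.
    - have [h h' _] := pb_simple hU (proj1 (andP t01)) bt (proj2 (andP b01)) e0.
      by exists (-1); rewrite h h' mulrN1z subrr.
  exists (m - n); last by right.
  by rewrite rmorphB addrA bm /t0 addrK subrr normr0.
exists r => // z cz nz zr.
have [l [b [b01 zb]]] := bd_arc (closure_cases oU cz nz).
have [|li [n bn nP]] := rP l b b01; first by rewrite -zb.
exists (b + n%:~R) => //; rewrite zb li.
by case: nP => [->|pi]; rewrite ?addr0 ?(periodic_int pi).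
Qed.

Lemma closest_good_maximizes x i (t : R) : U x -> good i t -> closest K U x (c i t) ->
  maximizes K (nu (c i) t) ((distK K U x)^-1 *: (x - c i t)).
Proof.
move=> Ux gt cx; apply: (closest_maximizes hK oU Ux cx (good_derive gt)).
- exact: good_regular.
- exact: good_local.
- exact: good_into.
Qed.

End Domain.

Lemma is_derive_dot (R : realType) (V : normedModType R) (f : V -> 'rV[R]_2) a v df u :
  is_derive a v f df -> is_derive a v (fun b => dot u (f b)) (dot u df).
Proof.
move=> /is_derive_epsP H; apply/is_derive_epsP => e e0.
have u0 : 0 < 2 * `|u| + 1 by rewrite ltr_wpDl // mulr_ge0.
have [d d0 dP] := H (e / (2 * `|u| + 1)) (divr_gt0 e0 u0).
exists d => // h /dP; rewrite -dotBr.
have -> : h *: dot u df = dot u (h *: df) by rewrite dotZr.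
rewrite -dotBr => Hh; apply: le_trans (dot_le _ _) _.
apply: le_trans (_ : (2 * `|u| + 1) * (e / (2 * `|u| + 1) * `|h|) <= _).
  by apply: ler_pM; rewrite ?mulr_ge0 ?lerDl.
by rewrite mulrA mulrCA divff ?gt_eqF // mulr1.
Qed.

Lemma cvg_dot (R : realType) (T : Type) (F : set_system T) {FF : Filter F}
    (f h : T -> 'rV[R]_2) (u v : 'rV[R]_2) :
  f x @[x --> F] --> u -> h x @[x --> F] --> v ->
  dot (f x) (h x) @[x --> F] --> dot u v.
Proof.
move=> fu hv; rewrite dotE.
have -> : (fun x => dot (f x) (h x)) = (fun x => f x 0 0 * h x 0 0 + f x 0 1 * h x 0 1).
  by apply/funext => x; rewrite dotE.
by apply: cvgD; apply: cvgM; exact: cvg_coord.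
Qed.

(** * Nonreentrant corners carry no closest point *)

Section Corner.
Variable R : realType.
Variables (s : regularity R) (K : set 'rV[R]_2) (g : R -> 'rV[R]_2).
Hypothesis hs : admissible s.
Hypothesis hK : gauge_body s K g.
Variables (U : set 'rV[R]_2) (N : nat) (c : 'I_N -> R -> 'rV[R]_2) (succ : {perm 'I_N}).
Hypothesis oU : open U.
Hypothesis bU : bounded_set U.
Hypothesis hU : piecewise_boundary c succ s U.

Let kK : compact K := gb_compact hK.
Let cK := convex_setP (gb_convex hK).
Let K0 : interior K 0 := gb_zero hK.

Lemma arc_MVT i u (a b : R) : 0 <= a -> a <= b -> b <= 1 ->
  exists2 xi, a <= xi <= b &
    dot u (c i b) - dot u (c i a) = dot u (derive1 (c i) xi) * (b - a).
Proof.
move=> a0 ab b1.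
have H (z : R) : a <= z <= b -> is_derive z 1 (fun t => dot u (c i t)) (dot u (derive1 (c i) z)).
  move=> /andP[az zb]; apply: is_derive_dot; apply: (arc_derive hs hU).
  by apply/andP; split; [exact: le_trans az|exact: le_trans b1].
have [||xi + e] := @MVT_segment R (fun t => dot u (c i t)) (fun t => dot u (derive1 (c i) t)) a b ab.
- by move=> z; rewrite in_itv /= => /andP[az zb]; apply: H; rewrite !ltW.
- by apply: derivable_within_continuous => z; rewrite in_itv /= => /H[].
- by rewrite in_itv /= => xi_ab; exists xi.
Qed.

(** The step [e1] is fixed first: a ball around [g a - e1 *: v] lies inside K. Convexity from [g a]
    then handles all shorter steps and all directions near [v] at once. *)
Lemma closest_cone x y v n : U x -> closest K U x y ->
  (exists2 a, (distK K U x)^-1 *: (x - y) = g a & n = - nu g a) -> 0 < dot v n ->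
  exists e r : R, [/\ 0 < e, 0 < r &
    forall h w, 0 < h <= e -> `|w - v| < r -> U (y + h *: w)].
Proof.
move=> Ux cy [a ka ->] vn; have d0 := dist_gt0 hK oU Ux cy.
set d := distK K U x in ka d0 *.
have [|e1 e10 eP] := tangent_cone hs hK (a := a) (v := - v).
  by rewrite dotNl -dotNr.
have [r r0 rP] : exists2 r : R, 0 < r & forall w, `|w - v| < r -> interior K (g a + e1 *: - w).
  have : interior (interior K) (g a + e1 *: - v).
    by rewrite ((interior_id _).1 (@open_interior _ K)); apply: eP; rewrite e10 lexx.
  move=> /interior_ballP[r1 r10 rP]; exists (r1 / e1); first exact: divr_gt0.
  move=> w wv; apply: rP.
  have -> : g a + e1 *: - w - (g a + e1 *: - v) = e1 *: - (w - v) by apply: row2P; plane.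
  by rewrite normrZ normrN gtr0_norm // mulrC -ltr_pdivlMr.
exists (e1 * d), r; split=> //; first exact: mulr_gt0.
move=> h w /andP[h0 he] wv.
have -> : h *: w = (h / d * d) *: - - w by rewrite divfK ?gt_eqF // opprK.
apply: (ball_direction hK oU Ux cy); rewrite -/d ka.
have -> : g a + (h / d) *: - w = g a + (h / d / e1) *: (g a + e1 *: - w - g a).
  by rewrite [g a + e1 *: _]addrC addrK scalerA divfK ?gt_eqF.
apply: (interior_convex cK (body_K hK a) (rP _ wv)).
by rewrite !divr_gt0 //= ler_pdivrMr // mul1r ler_pdivrMr.
Qed.

(** Otherwise points of the boundary curve near [y] would lie in the cone of [closest_cone], hence
    in the open set [U]. It is applied to both arcs at a corner. *)
Lemma tangent_out x y v n (f : R -> 'rV[R]_2) : U x -> closest K U x y ->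
  (exists2 a, (distK K U x)^-1 *: (x - y) = g a & n = - nu g a) ->
  (forall e : R, 0 < e -> exists2 d : R, 0 < d & forall h, 0 < h < d ->
     `|f h - y - h *: v| <= e * h) ->
  (forall h, 0 < h < 1 -> bd U (f h)) -> dot v n <= 0.
Proof.
move=> Ux cy hn df bf; rewrite leNgt; apply/negP => vn.
have [e [r [e0 r0 H]]] := closest_cone Ux cy hn vn.
have [d d0 dP] := df (r / 2) (divr_gt0 r0 (ltr0n _ 2)).
pose m := Num.min e (Num.min d 1); have m0 : 0 < m by rewrite !lt_min e0 d0 ltr01.
have h0 : 0 < m / 2 by rewrite divr_gt0.
have hm : m / 2 < m by rewrite ltr_pdivrMr // ltr_pMr // ltr1n.
move: (hm); rewrite {2}/m !lt_min => /and3P[h1 h2 h3].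
have /(bd_open _ oU)[_] : bd U (f (m / 2)) by apply: bf; rewrite h0.
apply.
have -> : f (m / 2) = y + (m / 2) *: ((m / 2)^-1 *: (f (m / 2) - y)).
  by rewrite scalerA divff ?gt_eqF // scale1r addrC subrK.
apply: H; first by rewrite h0 ltW.
have -> : (m / 2)^-1 *: (f (m / 2) - y) - v = (m / 2)^-1 *: (f (m / 2) - y - (m / 2) *: v).
  by rewrite [RHS]scalerBr scalerA mulVf ?gt_eqF // scale1r.
rewrite normrZ gtr0_norm ?invr_gt0 // mulrC ltr_pdivrMr //.
have := dP (m / 2); rewrite h0 => /(_ h2) /le_lt_trans; apply.
by rewrite ltr_pM2r // ltr_pdivrMr // ltr_pMr // ltr1n.
Qed.

(* At a nonreentrant corner the two arcs leave [y] on one side of the tangent to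
   the ball, so moving from a point of the outgoing arc along the outer bisector
   [w] one enters the ball without crossing the boundary again; but the right
   hand side of the outgoing arc lies outside [U]. *)
Lemma corner_not_closest x j : U x -> nonreentrant c succ j -> ~ closest K U x (c j 1).
Proof.
move=> Ux [th [/andP[th0 _] oa] thpi] cy.
set i := succ j; set y := c j 1 in cy *.
have yi : c i 0 = y by rewrite /y (pb_succ hU).
have in0 : (0 : R) <= (0 : R) <= (1 : R) by apply/andP; split; lra.
have in1 : (0 : R) <= (1 : R) <= (1 : R) by apply/andP; split; lra.
have tp0 := pb_regular hU i in0; have tm0 := pb_regular hU j in1.
have ip := arc_derive hs hU i in0; have im := arc_derive hs hU j in1.
rewrite /= -/i in oa.
have [tp tpE] : exists z, z = derive1 (c i) 0 by eexists.
have [tm tmE] : exists z, z = derive1 (c j) 1 by eexists.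
rewrite -tpE in oa tp0 ip; rewrite -tmE in oa tm0 im.
(* Positive because the sine of an angle between 0 and pi is; this is where nonreentrance enters. *)
pose X := cross tp (- tm).
have X0 : 0 < X.
  have e : enorm tp * X = enorm tm * (sin th * dot tp tp).
    have -> : enorm tp * X = cross tp (enorm tp *: (- tm)) by rewrite /X; plane.
    by rewrite oa; plane.
  have p1 : 0 < enorm tp by rewrite enorm_gt0.
  rewrite -(pmulr_rgt0 _ p1) e !mulr_gt0 ?enorm_gt0 ?dot_gt0 //.
  by apply: sin_gt0_pi; rewrite th0.
have d0 := dist_gt0 hK oU Ux cy.
have := closest_bd hK oU Ux cy; rewrite -(bp_range (gb_boundary hK)) => -[a _ ka].
have [n nE] : exists z, z = - nu g a by eexists.
have hn : exists2 a, (distK K U x)^-1 *: (x - y) = g a & n = - nu g a by exists a.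
have Hp : dot tp n <= 0.
  apply: (tangent_out Ux cy hn (f := c i)).
    move=> e e0; have [d d0' dP] := (is_derive_epsP _ _ _ _).1 ip e e0.
    exists d => // h /andP[h0 hd]; have := dP h; rewrite gtr0_norm // => /(_ hd).
    by rewrite add0r [h *: 1]mulr1 yi.
  by move=> h /andP[h0 h1]; apply: (arc_bd hU); rewrite !ltW.
have Hm : dot (- tm) n <= 0.
  apply: (tangent_out Ux cy hn (f := fun h => c j (1 - h))).
    move=> e e0; have [d d0' dP] := (is_derive_epsP _ _ _ _).1 im e e0.
    exists d => // h /andP[h0 hd]; have := dP (- h); rewrite normrN gtr0_norm // => /(_ hd).
    by rewrite [- h *: 1]mulr1 scalerN scaleNr.
  by move=> h /andP[h0 h1]; apply: (arc_bd hU); apply/andP; split; lra.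
(* [dot m] is constant along [w] and has the same positive derivative [X] along both arcs at the
   corner. It separates the points of the arcs on lines parallel to [w]. *)
pose w := tm - tp; pose m := perp w.
have wn : 0 < dot w n.
  have e : dot w n = - dot tp n - dot (- tm) n by rewrite /w; plane.
  rewrite lt_neqAle eq_sym; apply/andP; split; last by rewrite e; lra.
  apply/eqP => w0.
  have e1 : dot tp n = 0 by lra.
  have e2 : dot (- tm) n = 0 by lra.
  have nn0 : n != 0 by rewrite nE oppr_eq0 perp_neq0; exact: bp_regular (gb_boundary hK) a.
  have : X * dot n n = 0.
    have -> : X * dot n n = dot tp n * cross n (- tm) - dot (- tm) n * cross n tp by rewrite /X; plane.
    by rewrite e1 e2 !mul0r subrr.
  by apply/eqP; rewrite mulf_neq0 // gt_eqF // dot_gt0.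
have mtp : dot m tp = X by rewrite /m /w /X; plane.
have mtm : dot m tm = X by rewrite /m /w /X; plane.
have mw : dot m w = 0 by rewrite /m; plane.
have cdot l (t : R) u : 0 <= t <= 1 -> 0 < dot u (derive1 (c l) t) ->
    exists2 d : R, 0 < d & forall b, `|b - t| < d -> 0 < dot u (derive1 (c l) b).
  move=> t01 p.
  have cu : {for t, continuous (fun b => dot u (derive1 (c l) b))}.
    exact: (cvg_dot (cvg_cst u) (arc_continuous1 hs hU (i:=l) t01)).
  have [d d0' dP] := (continuous_epsP (fun b => dot u (derive1 (c l) b)) t).1 cu _ p; exists d; [exact: d0'|move=> b /dP].
  by rewrite ltr_norml => /andP[h1 _]; move: h1; rewrite -subr_gt0 opprK subrK.
have [|d1 d10 D1] := cdot i 0 m in0; first by rewrite -tpE mtp.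
have [|d2 d20 D2] := cdot j 1 m in1; first by rewrite -tmE mtm.
have [e [r [e0 r0 H]]] := closest_cone Ux cy hn wn.
(* Near [y] the boundary consists of the beginning of arc [i] and the end of arc [j], where [dot m]
   is monotone. *)
pose P (l : 'I_N) (b : R) := (l = i /\ b < d1) \/ (l = j /\ 1 - d2 < b).
have [||l b b01 eb|rho rho0 rhoP] := @arcs_local R N c P y.
- exact: (arc_within hs hU).
- move=> l; apply: open_closedC; rewrite openE => b [[li bd]|[lj bd]];
    apply/interior_ballP.
    exists (d1 - b); first by rewrite subr_gt0.
    by move=> z zb; left; split=> //; have := le_lt_trans (ler_norm _) zb; lra.
  exists (b - (1 - d2)); first by rewrite subr_gt0.
  by move=> z; rewrite distrC => zb; right; split=> //; have := le_lt_trans (ler_norm _) zb; lra.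
- have [li|li] := eqVneq l i.
    subst l; case/andP: (b01) => b0 b1; move: b0; rewrite le_eqVlt => /orP[/eqP <-|b0].
      by left.
    have [_ h si] := pb_simple hU (lexx 0) b0 b1 (etrans yi (esym eb)).
    by right; split; [exact: (@perm_inj _ succ)|rewrite h; lra].
  rewrite eq_sym in li.
  have [[h _ _]|[_ h si]] := pb_meet hU li in0 b01 (etrans yi (esym eb)).
    by have := @ltr01 R; rewrite -h ltxx.
  by right; split; [exact/esym/(@perm_inj _ succ)|rewrite h; lra].
have w0 : w != 0 by apply: contraTneq wn => ->; rewrite dotC dot0r ltxx.
have nw0 : 0 < `|w| by rewrite normr_gt0.
(* Steps up to [s1] along [w] remain admissible in the cone at [y] and move by at most half of
   [rho]. *)
pose s1 := Num.min e (rho / (2 * `|w|)).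
have s10 : 0 < s1 by rewrite lt_min e0 divr_gt0 // mulr_gt0.
have s1w : s1 * (2 * `|w|) <= rho.
  by rewrite -ler_pdivlMr; [rewrite ge_min lexx orbT|rewrite mulr_gt0].
(* The point [c i ep] is taken so close to [y] that, seen from [y] at scale [s1], the direction to
   [c i ep + s1 *: w] still lies within [r] of [w]. *)
have q0 : 0 < Num.min (rho / 2) (s1 * r) by rewrite lt_min divr_gt0 // mulr_gt0.
have [d3 d30 D3] := (continuous_epsP _ _).1 (arc_continuous hs hU (i:=i) in0) _ q0.
pose M := Num.min 1 (Num.min d1 d3); have M0 : 0 < M by rewrite !lt_min ltr01 d10 d30.
pose ep := M / 2; have ep0 : 0 < ep by rewrite divr_gt0.
have epM : ep < M by rewrite ltr_pdivrMr // ltr_pMr // ltr1n.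
move: (epM); rewrite /M !lt_min => /and3P[ep1 epd1 epd3].
have := D3 ep; rewrite subr0 gtr0_norm // => /(_ epd3).
rewrite yi lt_min => /andP[Y1 Y2].
have epi : 0 < ep < 1 by rewrite ep0.
have gi : good c i ep by left.
have mep : dot m y < dot m (c i ep).
  have [xi /andP[x0 x1] ee] := arc_MVT i m (lexx 0) (ltW ep0) (ltW ep1).
  rewrite -subr_gt0 -yi ee subr0 mulr_gt0 //; apply: D1.
  by rewrite subr0 ger0_norm //; exact: le_lt_trans epd1.
(* A boundary point on this ray has the same [dot m] as [c i ep]. Strict monotonicity along arc [i]
   leaves only [c i ep] itself, and along arc [j] the values do not exceed the smaller value at
   [y]. *)
have nobd t : 0 < t <= s1 -> ~ bd U (c i ep + t *: w).
  move=> /andP[t0 t1] bz; have [l [b [b01 zb]]] := bd_arc hU bz.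
  have /(rhoP l b b01) : `|c l b - y| < rho.
    rewrite -zb addrAC; apply: le_lt_trans (ler_normD _ _) _.
    rewrite normrZ gtr0_norm //; have := ler_wpM2r (ltW nw0) t1; lra.
  have me : dot m (c l b) = dot m (c i ep) by rewrite -zb dotDr dotZr mw mulr0 addr0.
  case/andP: b01 => b0 b1; case=> -[ll bd]; subst l.
    case: (ltgtP b ep) => bep.
    - have [xi /andP[x0 x1] ee] := arc_MVT i m b0 (ltW bep) (ltW ep1).
      have : 0 < dot m (derive1 (c i) xi) * (ep - b).
        rewrite mulr_gt0 ?subr_gt0 //; apply: D1; rewrite subr0 ger0_norm ?(le_trans b0) //.
        exact: le_lt_trans epd1.
      by rewrite -ee me subrr ltxx.
    - have [xi /andP[x0 x1] ee] := arc_MVT i m (ltW ep0) (ltW bep) b1.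
      have : 0 < dot m (derive1 (c i) xi) * (b - ep).
        rewrite mulr_gt0 ?subr_gt0 //; apply: D1; rewrite subr0 ger0_norm ?(le_trans (ltW ep0)) //.
        exact: le_lt_trans bd.
      by rewrite -ee me subrr ltxx.
    - move: zb; rewrite bep => /eqP; rewrite -subr_eq0 addrAC subrr add0r scaler_eq0.
      by rewrite (negbTE w0) gt_eqF.
  have [xi /andP[x0 x1] ee] := arc_MVT j m b0 b1 (lexx 1).
  have : 0 <= dot m (derive1 (c j) xi) * (1 - b).
    rewrite mulr_ge0 ?subr_ge0 //; apply/ltW/D2; rewrite distrC ger0_norm ?subr_ge0 //.
    by lra.
  by rewrite -ee me subr_ge0 leNgt mep.
have Uq : U (c i ep + s1 *: w).
  have -> : c i ep + s1 *: w = y + s1 *: (w + s1^-1 *: (c i ep - y)).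
    rewrite [s1 *: (w + _)]scalerDr [s1 *: (_ *: _)]scalerA divff ?gt_eqF // scale1r.
    by rewrite [RHS]addrCA [y + _]addrC subrK addrC.
  apply: H; first by rewrite s10 ge_min lexx.
  rewrite addrAC subrr add0r normrZ gtr0_norm ?invr_gt0 //.
  by rewrite mulrC ltr_pdivrMr // mulrC.
have in_ep : 0 <= ep <= 1 by rewrite !ltW.
(* At the regular point [c i ep] the direction [w] points to the right of the arc, hence out of the
   closure of [U]. *)
have [|e4 e40 E4] := transversality oU (arc_derive hs hU i in_ep)
  (good_regular hU gi) (good_local hs oU hU gi) (good_into hU gi) (v := w).
  have -> : dot w (perp (derive1 (c i) ep)) = - dot m (derive1 (c i) ep) by rewrite /m; move: (derive1 _ _) => z; plane.
  by rewrite oppr_lt0; apply: D1; rewrite subr0 gtr0_norm.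
pose t := Num.min e4 s1 / 2.
have M40 : 0 < Num.min e4 s1 by rewrite lt_min e40.
have t0 : 0 < t by rewrite divr_gt0.
have : t < Num.min e4 s1 by rewrite ltr_pdivrMr // ltr_pMr // ltr1n.
rewrite lt_min => /andP[te4 ts1].
apply: (E4 t); first by rewrite t0.
apply: subset_closure; apply: (segment_in oU _ Uq) => h /andP[h0 h1].
have -> : c i ep + s1 *: w + h *: (c i ep + t *: w - (c i ep + s1 *: w)) =
  c i ep + (s1 + h * (t - s1)) *: w by apply: row2P; plane.
apply: nobd; apply/andP; split; nra.
Qed.

(** An end time of an arc that is not closed is a corner: time 1 of the arc itself, or time 0, which
    is time 1 of its predecessor. *)
Lemma closest_is_good x i (t : R) : (forall j, corner c j -> nonreentrant c succ j) ->
  U x -> 0 <= t <= 1 -> closest K U x (c i t) -> good c i t.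
Proof.
move=> hc Ux t01 cx.
have [pi|npi] := pselect (one_periodic (c i)).
  by right; split=> //; case/andP: t01 => *; apply/andP; split; lra.
left; case/andP: t01; rewrite le_eqVlt => /orP[/eqP t0|t0]; last first.
  rewrite le_eqVlt => /orP[/eqP t1|->]; last by rewrite t0.
  by rewrite t1 in cx; have := corner_not_closest Ux (hc _ npi) cx.
move=> _; exfalso; rewrite -t0 in cx.
pose j := (perm_inv succ) i; have sj : succ j = i by rewrite permKV.
have e : c j 1 = c i 0 by rewrite (pb_succ hU) sj.
have nj : corner c j.
  move=> pj; apply: npi; suff <- : j = i by [].
  by rewrite -sj (periodic_succ hU pj).
by rewrite -e in cx; have := corner_not_closest Ux (hc _ nj) cx.
Qed.

End Corner.

(** * The equations of a closest point *)

Section ImplicitSystem.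
Variable R : realType.
Variables (c c1 c2 g g1 g2 : R -> 'rV[R]_2).
Implicit Types (x v : 'rV[R]_2).

(** Taken coordinate by coordinate, since the intermediate point of the mean value theorem differs
    from one coordinate to the other. *)
Definition ddiffv (f df : R -> 'rV[R]_2) a b : 'rV[R]_2 :=
  \row_j ddiff (fun z => f z 0 j) (fun z => df z 0 j) a b.

Lemma ddiffvE f df a b : f a - f b = (a - b) *: ddiffv f df a b.
Proof. by apply/rowP => j; rewrite !mxE mulrC -ddiffE. Qed.

Lemma cvg_row2 (T : Type) (F : set_system T) {FF : Filter F} (f : T -> 'rV[R]_2) (u : 'rV[R]_2) :
  f x 0 0 @[x --> F] --> u 0 0 -> f x 0 1 @[x --> F] --> u 0 1 -> f x @[x --> F] --> u.
Proof.
move=> /cvgrPdist_lt f0 /cvgrPdist_lt f1; apply/cvgrPdist_lt => e e0; near=> x.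
rewrite norm2E !mxE gt_max; apply/andP; split; near: x; [exact: f0|exact: f1].
Unshelve. all: by end_near. Qed.

Lemma cvg_ddiffv (T : Type) (F : set_system T) {FF : Filter F} f df (s : R) (a b : T -> R) :
  (\forall u \near s, is_derive (u : R) 1 f (df u)) -> {for s, continuous df} ->
  a x @[x --> F] --> s -> b x @[x --> F] --> s ->
  ddiffv f df (a x) (b x) @[x --> F] --> df s.
Proof.
move=> fd cdf ca cb.
have H j : ddiff (fun z => f z 0 j) (fun z => df z 0 j) (a x) (b x) @[x --> F] --> df s 0 j.
  apply: (cvg_ddiff (f := fun z => f z 0 j) (df := fun z => df z 0 j)) => //.
    by apply: filterS fd => u /(is_derive_coord j).
  exact: cvg_coord.
by apply: cvg_row2;
  [move: (H 0)|move: (H 1)]; apply: cvg_trans; apply: near_eq_cvg; near=> x; rewrite mxE.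
Unshelve. all: by end_near. Qed.

Lemma cvg_cross (T : Type) (F : set_system T) {FF : Filter F}
    (f h : T -> 'rV[R]_2) (u v : 'rV[R]_2) :
  f x @[x --> F] --> u -> h x @[x --> F] --> v ->
  cross (f x) (h x) @[x --> F] --> cross u v.
Proof.
move=> fu hv; rewrite /cross.
by apply: cvgB; apply: cvgM; exact: cvg_coord.
Qed.

Lemma cvg_perp (T : Type) (F : set_system T) {FF : Filter F} (f : T -> 'rV[R]_2) (u : 'rV[R]_2) :
  f x @[x --> F] --> u -> perp (f x) @[x --> F] --> perp u.
Proof.
move=> fu; apply: cvg_row2; rewrite ?perp0 ?perp1.
  have -> : (fun z => perp (f z) 0 0) = (fun z => - f z 0 1).
    by apply/funext => z; rewrite perp0.
  by apply: cvgN; exact: cvg_coord.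
have -> : (fun z => perp (f z) 0 1) = (fun z => f z 0 0).
  by apply/funext => z; rewrite perp1.
exact: cvg_coord.
Qed.

(* [x = c tau + lam g sigma], where the normals of [c] at [tau] and of [g] at
   [sigma] are parallel. *)
Definition solves x (tau sigma lam : R) :=
  x = c tau + lam *: g sigma /\ dot (perp (c1 tau)) (g1 sigma) = 0.

(** Crossing the first equation with [e] eliminates the increment of [lam]. This is the determinant
    of the remaining two equations in the increments of [tau] and [sigma]. *)
Definition jac (al be lam : R) (a b e : 'rV[R]_2) : R :=
  be * cross a e - al * lam * cross b e.

Section TwoPoints.
Variables (x x' : 'rV[R]_2) (ta sa la tb sb lb : R).
Let a := ddiffv c c1 ta tb.
Let b := ddiffv g g1 sa sb.
Let al := dot (perp (ddiffv c1 c2 ta tb)) (g1 sa).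
Let be := dot (perp (c1 tb)) (ddiffv g1 g2 sa sb).
Let D := jac al be lb a b (g sa).

(** The difference of the two systems is written exactly as a linear system whose coefficients are
    divided differences, and solved by Cramer's rule. The last identity is the projection on the
    normal at [ta]. The mixed arguments in [al] and [be] are those that split the difference of the
    two orthogonality equations. *)
Lemma two_point : solves x ta sa la -> solves x' tb sb lb ->
  [/\ D * (ta - tb) = be * cross (x - x') (g sa),
      D * (sa - sb) = - al * cross (x - x') (g sa) &
      dot (perp (c1 ta)) (g sa) * (la - lb) = dot (perp (c1 ta)) (x - x')
        - (ta - tb) * dot (perp (c1 ta)) a - (sa - sb) * (lb * dot (perp (c1 ta)) b)].
Proof.
move=> [ex e1] [ex' e1'].
have E1 : (ta - tb) * al + (sa - sb) * be = 0.
  have -> : (ta - tb) * al = dot (perp (c1 ta - c1 tb)) (g1 sa).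
    rewrite (ddiffvE c1 c2) /al; move: (ddiffv _ _ _ _) (g1 sa) (ta - tb) => u v r; plane.
  have -> : (sa - sb) * be = dot (perp (c1 tb)) (g1 sa - g1 sb).
    by rewrite (ddiffvE g1 g2) dotZr.
  have -> : perp (c1 ta - c1 tb) = perp (c1 ta) - perp (c1 tb) by apply: row2P; plane.
  by rewrite dotBl dotBr e1 e1'; ring.
have E2 : x - x' = (ta - tb) *: a + (sa - sb) *: (lb *: b) + (la - lb) *: g sa.
  have -> : (sa - sb) *: (lb *: b) = lb *: (g sa - g sb).
    by rewrite (ddiffvE g g1) !scalerA mulrC.
  rewrite -(ddiffvE c c1) ex ex'; move: (c ta) (c tb) (g sa) (g sb) => u v w z.
  by apply: row2P; plane.
have E3 : cross (x - x') (g sa) = (ta - tb) * cross a (g sa) + (sa - sb) * lb * cross b (g sa).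
  by rewrite E2; move: a b (g sa) => u v w; plane.
have E4 : dot (perp (c1 ta)) (x - x') = (ta - tb) * dot (perp (c1 ta)) a
    + (sa - sb) * (lb * dot (perp (c1 ta)) b) + (la - lb) * dot (perp (c1 ta)) (g sa).
  by rewrite E2 !dotDr !dotZr.
rewrite /D /jac E3 E4; move: E1; move: (cross a _) (cross b _) al be => u v p q E1.
have E1' : (sa - sb) * q = - ((ta - tb) * p) by lra.
split; last by ring.
- have -> : q * ((ta - tb) * u + (sa - sb) * lb * v)
     = q * (ta - tb) * u + (sa - sb) * q * lb * v by ring.
  by rewrite E1'; ring.
- have -> : (q * u - p * lb * v) * (sa - sb) = (sa - sb) * q * u - p * lb * v * (sa - sb) by ring.
  by rewrite E1'; ring.
Qed.

End TwoPoints.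

Section Limits.
Variables (t s l : R).
Hypothesis cd : \forall u \near t, is_derive (u : R) 1 c (c1 u).
Hypothesis c1d : \forall u \near t, is_derive (u : R) 1 c1 (c2 u).
Hypothesis c2c : {for t, continuous c2}.
Hypothesis gd : \forall u \near s, is_derive (u : R) 1 g (g1 u).
Hypothesis g1d : \forall u \near s, is_derive (u : R) 1 g1 (g2 u).
Hypothesis g2c : {for s, continuous g2}.

Let c1c : {for t, continuous c1}.
Proof. exact: is_derive_continuous (nbhs_singleton c1d). Qed.
Let gc : {for s, continuous g}.
Proof. exact: is_derive_continuous (nbhs_singleton gd). Qed.
Let g1c : {for s, continuous g1}.
Proof. exact: is_derive_continuous (nbhs_singleton g1d). Qed.

Definition alpha0 := dot (perp (c2 t)) (g1 s).
Definition beta0 := dot (perp (c1 t)) (g2 s).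
Definition jac0 := jac alpha0 beta0 l (c1 t) (g1 s) (g s).

Section Filter.
Variables (T : Type) (F : set_system T).
Context {FF : Filter F}.
Variables (ta sa la tb sb lb : T -> R).
Hypothesis cta : ta x @[x --> F] --> t.
Hypothesis csa : sa x @[x --> F] --> s.
Hypothesis ctb : tb x @[x --> F] --> t.
Hypothesis csb : sb x @[x --> F] --> s.
Hypothesis clb : lb x @[x --> F] --> l.

Lemma cvg_alpha :
  dot (perp (ddiffv c1 c2 (ta x) (tb x))) (g1 (sa x)) @[x --> F] --> alpha0.
Proof.
apply: cvg_dot; last exact: (cvg_comp _ _ csa g1c).
by apply: cvg_perp; apply: cvg_ddiffv.
Qed.

Lemma cvg_beta :
  dot (perp (c1 (tb x))) (ddiffv g1 g2 (sa x) (sb x)) @[x --> F] --> beta0.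
Proof.
apply: cvg_dot; last exact: cvg_ddiffv.
by apply: cvg_perp; exact: (cvg_comp _ _ ctb c1c).
Qed.

Lemma cvg_gs : g (sa x) @[x --> F] --> g s.
Proof. exact: (cvg_comp _ _ csa gc). Qed.

Lemma cvg_nu : perp (c1 (ta x)) @[x --> F] --> perp (c1 t).
Proof. by apply: cvg_perp; exact: (cvg_comp _ _ cta c1c). Qed.

Lemma cvg_jac :
  jac (dot (perp (ddiffv c1 c2 (ta x) (tb x))) (g1 (sa x)))
      (dot (perp (c1 (tb x))) (ddiffv g1 g2 (sa x) (sb x))) (lb x)
      (ddiffv c c1 (ta x) (tb x)) (ddiffv g g1 (sa x) (sb x)) (g (sa x))
    @[x --> F] --> jac0.
Proof.
apply: cvgB; apply: cvgM.
- exact: cvg_beta.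
- by apply: cvg_cross; [exact: cvg_ddiffv|exact: cvg_gs].
- by apply: cvgM; [exact: cvg_alpha|].
- by apply: cvg_cross; [exact: cvg_ddiffv|exact: cvg_gs].
Qed.

(** The limit is the product of a normal with its own tangent. With [cvg_nub], it removes the
    variations of [tau] and [sigma] from the derivative of [lam]. *)
Lemma cvg_nua : dot (perp (c1 (ta x))) (ddiffv c c1 (ta x) (tb x)) @[x --> F] --> (0 : R).
Proof.
have -> : (0 : R) = dot (perp (c1 t)) (c1 t) by move: (c1 t) => u; plane.
by apply: cvg_dot; [exact: cvg_nu|exact: cvg_ddiffv].
Qed.

Lemma cvg_nub : dot (perp (c1 t)) (g1 s) = 0 ->
  lb x * dot (perp (c1 (ta x))) (ddiffv g g1 (sa x) (sb x)) @[x --> F] --> (0 : R).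
Proof.
move=> e; have -> : (0 : R) = l * dot (perp (c1 t)) (g1 s) by rewrite e mulr0.
by apply: cvgM => //; apply: cvg_dot; [exact: cvg_nu|exact: cvg_ddiffv].
Qed.

End Filter.
End Limits.
End ImplicitSystem.

Section BoxFilter.
Variables (R : realType) (T : Type) (p : 'I_6 -> T -> R) (p0 : 'I_6 -> R).

Definition box (d : R) (q : T) := forall i, `|p i q - p0 i| < d.
(** One filter for six simultaneous parameters: limits along it become bounds with a common
    radius. *)
Definition box_filter : set_system T := [set P | exists2 d : R, 0 < d & forall q, box d q -> P q].

Lemma box_filter_filter : Filter box_filter.
Proof.
split.
- by exists 1.
- move=> P Q [d d0 dP] [e e0 eQ]; exists (Num.min d e); first by rewrite lt_min d0.
  move=> q bq; split; [apply: dP|apply: eQ] => i; have := bq i; rewrite lt_min => /andP[] //.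
- by move=> P Q PQ [d d0 dP]; exists d => // q /dP /PQ.
Qed.

Lemma cvg_box i : p i q @[q --> box_filter] --> p0 i.
Proof.
have FF := box_filter_filter.
apply/cvgrPdist_lt => e e0; exists e => // q /(_ i); rewrite distrC.
by [].
Qed.

End BoxFilter.

Section Lipschitz.
Variable R : realType.
Variables (c c1 c2 g g1 g2 : R -> 'rV[R]_2).
Variables (t s l : R).
Hypothesis cd : \forall u \near t, is_derive (u : R) 1 c (c1 u).
Hypothesis c1d : \forall u \near t, is_derive (u : R) 1 c1 (c2 u).
Hypothesis c2c : {for t, continuous c2}.
Hypothesis gd : \forall u \near s, is_derive (u : R) 1 g (g1 u).
Hypothesis g1d : \forall u \near s, is_derive (u : R) 1 g1 (g2 u).
Hypothesis g2c : {for s, continuous g2}.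
Hypothesis J0 : jac0 c1 c2 g g1 g2 t s l != 0.
Hypothesis G0 : dot (perp (c1 t)) (g s) != 0.
Hypothesis N0 : dot (perp (c1 t)) (g1 s) = 0.

Local Notation sol := (solves c c1 g g1).

(** Near the base point the determinant and the normal component stay away from 0 and all
    coefficients of [two_point] stay bounded. Taking [x = x'] also gives uniqueness of the
    parameters. *)
Lemma solution_lipschitz : exists2 d : R, 0 < d & exists C : R,
  forall x x' ta sa la tb sb lb, sol x ta sa la -> sol x' tb sb lb ->
  `|ta - t| < d -> `|sa - s| < d -> `|la - l| < d ->
  `|tb - t| < d -> `|sb - s| < d -> `|lb - l| < d ->
  [/\ `|ta - tb| <= C * `|x - x'|, `|sa - sb| <= C * `|x - x'| & `|la - lb| <= C * `|x - x'|].
Proof.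
pose T := ((R * R * R) * (R * R * R))%type.
pose p (i : 'I_6) (q : T) : R := nth 0 [:: q.1.1.1; q.1.1.2; q.1.2; q.2.1.1; q.2.1.2; q.2.2] i.
pose p0 (i : 'I_6) : R := nth 0 [:: t; s; l; t; s; l] i.
pose F := box_filter p p0.
have FF : Filter F by exact: box_filter_filter.
have cta : (fun q : T => q.1.1.1) @ F --> t := @cvg_box R T p p0 (@Ordinal 6 0 isT).
have csa : (fun q : T => q.1.1.2) @ F --> s := @cvg_box R T p p0 (@Ordinal 6 1 isT).
have ctb : (fun q : T => q.2.1.1) @ F --> t := @cvg_box R T p p0 (@Ordinal 6 3 isT).
have csb : (fun q : T => q.2.1.2) @ F --> s := @cvg_box R T p p0 (@Ordinal 6 4 isT).
have clb : (fun q : T => q.2.2) @ F --> l := @cvg_box R T p p0 (@Ordinal 6 5 isT).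
have Ha := cvg_alpha (FF := FF) c1d c2c g1d cta csa ctb.
have Hb := cvg_beta (FF := FF) c1d g1d g2c csa ctb csb.
have He := cvg_gs gd csa.
have Hn := cvg_nu (FF := FF) c1d cta.
have Hj := cvg_jac (FF := FF) cd c1d c2c gd g1d g2c cta csa ctb csb clb.
have Hna := cvg_nua (FF := FF) cd c1d cta ctb.
have Hnb := cvg_nub (FF := FF) c1d gd g1d cta csa csb clb N0.
have Hg := cvg_dot (FF := FF) Hn He.
pose J := `|jac0 c1 c2 g g1 g2 t s l|; have Jp : 0 < J by rewrite normr_gt0.
pose G := `|dot (perp (c1 t)) (g s)|; have Gp : 0 < G by rewrite normr_gt0.
pose A := `|alpha0 c2 g1 t s| + 1; pose B := `|beta0 c1 g2 t s| + 1.
pose E := `|g s| + 1; pose Nn := `|perp (c1 t)| + 1.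
have up (V : normedModType R) (f : T -> V) v : f q @[q --> F] --> v ->
    \forall q \near F, `|f q| <= `|v| + 1.
  by move=> fv; apply: (cvgr_norm_le (FF := FF) v fv); rewrite ltrDl.
have down (f : T -> R) v : v != 0 -> f q @[q --> F] --> v ->
    \forall q \near F, `|v| / 2 <= `|f q|.
  move=> v0 fv; apply: (cvgr_norm_ge (FF := FF) v fv).
  by rewrite ltr_pdivrMr // ltr_pMr ?normr_gt0 // ltr1n.
have : \forall q \near F, [/\ J / 2 <= `|jac (dot (perp (ddiffv c1 c2 q.1.1.1 q.2.1.1)) (g1 q.1.1.2))
      (dot (perp (c1 q.2.1.1)) (ddiffv g1 g2 q.1.1.2 q.2.1.2)) q.2.2
      (ddiffv c c1 q.1.1.1 q.2.1.1) (ddiffv g g1 q.1.1.2 q.2.1.2) (g q.1.1.2)|,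
    `|dot (perp (ddiffv c1 c2 q.1.1.1 q.2.1.1)) (g1 q.1.1.2)| <= A,
    `|dot (perp (c1 q.2.1.1)) (ddiffv g1 g2 q.1.1.2 q.2.1.2)| <= B,
    `|g q.1.1.2| <= E & [/\ `|perp (c1 q.1.1.1)| <= Nn,
    G / 2 <= `|dot (perp (c1 q.1.1.1)) (g q.1.1.2)|,
    `|dot (perp (c1 q.1.1.1)) (ddiffv c c1 q.1.1.1 q.2.1.1)| <= `|0 : R| + 1 &
    `|q.2.2 * dot (perp (c1 q.1.1.1)) (ddiffv g g1 q.1.1.2 q.2.1.2)| <= `|0 : R| + 1]].
  near=> q; split; last split; near: q.
  - exact: down Hj.
  - exact: up Ha.
  - exact: up Hb.
  - exact: up He.
  - exact: up Hn.
  - exact: down Hg.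
  - exact: up Hna.
  - exact: up Hnb.
move=> [d d0 dP]; exists d => //.
(* Numerator bounds divided by [J / 2] and [G / 2]; the factor [2 * E] bounds the cross product with
   [g sa]. *)
pose C1 := B * (2 * E) * 2 / J; pose C2 := A * (2 * E) * 2 / J.
pose C3 := (2 * Nn + C1 + C2) * 2 / G.
have E0 : 0 < E by rewrite ltr_wpDl.
have B0 : 0 < B by rewrite ltr_wpDl.
have A0 : 0 < A by rewrite ltr_wpDl.
have Nn0 : 0 < Nn by rewrite ltr_wpDl.
have C10 : 0 <= C1 by rewrite !mulr_ge0 ?invr_ge0 // ltW.
have C20 : 0 <= C2 by rewrite !mulr_ge0 ?invr_ge0 // ltW.
have C30 : 0 <= C3 by apply: divr_ge0 (ltW Gp); rewrite mulr_ge0 // !addr_ge0 // mulr_ge0 // ltW.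
exists (C1 + C2 + C3) => x x' ta sa la tb sb lb s1 s2 h1 h2 h3 h4 h5 h6.
have [|HJ HA HB HE [HN HG Hu Hv]] := dP ((ta, sa, la), (tb, sb, lb)).
  by move=> [[|[|[|[|[|[|//]]]]]] hi].
have [/= e1 e2 e3] := two_point c2 g2 s1 s2.
move: HJ HA HB HG Hu Hv e1 e2 e3 => /=.
set D := jac _ _ _ _ _ _; set al := dot _ (g1 sa); set be := dot _ (ddiffv g1 g2 _ _).
set Gv := dot _ (g sa); set u := dot _ (ddiffv c _ _ _); set v := _ * dot _ (ddiffv g _ _ _).
rewrite normr0 add0r => HJ HA HB HG Hu Hv e1 e2 e3.
set X := `|x - x'|; have X0 : 0 <= X by exact: normr_ge0.
have cr : `|cross (x - x') (g sa)| <= 2 * E * X.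
  have -> : cross (x - x') (g sa) = dot (x - x') (- perp (g sa)) by move: (x - x') (g sa) => w z; plane.
  apply: le_trans (dot_le _ _) _; rewrite normrN.
  have -> : `|perp (g sa)| = `|g sa| by rewrite !norm2E perp0 perp1 normrN maxC.
  by have := ler_wpM2l X0 HE; rewrite -/X /=; lra.
have core (z k K1 : R) : 0 < K1 -> `|k| <= K1 -> D * z = k * cross (x - x') (g sa) ->
    `|z| <= K1 * (2 * E) * 2 / J * X.
  move=> K10 kK ez; rewrite mulrAC ler_pdivlMr //.
  have h : `|D| * `|z| <= K1 * (2 * E * X).
    rewrite -normrM ez normrM; apply: ler_pM => //.
  have := ler_wpM2r (normr_ge0 z) HJ; move: h => /=; lra.
have T1 : `|ta - tb| <= C1 * X by exact: core e1.
have T2 : `|sa - sb| <= C2 * X by apply: core e2; rewrite ?normrN.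
have T3 : `|la - lb| <= C3 * X.
  rewrite /C3 mulrAC ler_pdivlMr //.
  have h : `|Gv| * `|la - lb| <= 2 * Nn * X + C1 * X + C2 * X.
    rewrite -normrM e3; apply: le_trans (ler_normB _ _) _; apply: lerD; last first.
      by rewrite normrM; have := ler_pM (normr_ge0 _) (normr_ge0 _) T2 Hv; rewrite mulr1.
    apply: le_trans (ler_normB _ _) _; apply: lerD; last first.
      by rewrite normrM; have := ler_pM (normr_ge0 _) (normr_ge0 _) T1 Hu; rewrite mulr1.
    apply: le_trans (dot_le _ _) _; rewrite -/X.
    by apply: ler_wpM2r => //; apply: ler_wpM2l.
  have := ler_wpM2r (normr_ge0 (la - lb)) HG; move: h => /=; lra.
have K1 := mulr_ge0 C10 X0; have K2 := mulr_ge0 C20 X0; have K3 := mulr_ge0 C30 X0.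
split; rewrite !mulrDl.
- by apply: le_trans T1 _; rewrite -addrA lerDl addr_ge0.
- by apply: le_trans T2 _; rewrite [C1 * X + _]addrC -addrA lerDl addr_ge0.
- by apply: le_trans T3 _; rewrite lerDr addr_ge0.
Unshelve. all: by end_near. Qed.

End Lipschitz.

Section Derivatives.
Variable R : realType.
Variables (c c1 c2 g g1 g2 : R -> 'rV[R]_2).
Variables (x : 'rV[R]_2) (tau sigma lam : 'rV[R]_2 -> R).
Let t := tau x. Let s := sigma x. Let l := lam x.
Hypothesis cd : \forall u \near t, is_derive (u : R) 1 c (c1 u).
Hypothesis c1d : \forall u \near t, is_derive (u : R) 1 c1 (c2 u).
Hypothesis c2c : {for t, continuous c2}.
Hypothesis gd : \forall u \near s, is_derive (u : R) 1 g (g1 u).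
Hypothesis g1d : \forall u \near s, is_derive (u : R) 1 g1 (g2 u).
Hypothesis g2c : {for s, continuous g2}.
Hypothesis J0 : jac0 c1 c2 g g1 g2 t s l != 0.
Hypothesis G0 : dot (perp (c1 t)) (g s) != 0.
Hypothesis ctau : {for x, continuous tau}.
Hypothesis csig : {for x, continuous sigma}.
Hypothesis clam : {for x, continuous lam}.
Hypothesis slv : \forall z \near x, solves c c1 g g1 z (tau z) (sigma z) (lam z).

Let D := jac0 c1 c2 g g1 g2 t s l.

(** The identities of [two_point] between the solutions at [z h] and at [x], divided by [h]. Only
    continuity of the three functions is assumed. *)
Lemma solution_derive v :
  [/\ is_derive x v tau (beta0 c1 g2 t s * cross v (g s) / D),
      is_derive x v sigma (- alpha0 c2 g1 t s * cross v (g s) / D) &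
      is_derive x v lam (dot (perp (c1 t)) v / dot (perp (c1 t)) (g s))].
Proof.
pose z (h : R) := h *: v + x.
have FF : Filter (0 : R)^' by exact: dnbhs_filter.
have cz : z h @[h --> 0^'] --> x.
  have -> : x = 0 *: v + x by rewrite scale0r add0r.
  apply: cvg_within_filter; apply: cvgD; last exact: cvg_cst.
  by apply: cvgZr_tmp; exact: cvg_id.
have cta : tau (z h) @[h --> 0^'] --> t by exact: (cvg_comp _ _ cz ctau).
have csa : sigma (z h) @[h --> 0^'] --> s by exact: (cvg_comp _ _ cz csig).
have cla : lam (z h) @[h --> 0^'] --> l by exact: (cvg_comp _ _ cz clam).
have ctb : (fun=> t) @ (0 : R)^' --> t by exact: cvg_cst.
have csb : (fun=> s) @ (0 : R)^' --> s by exact: cvg_cst.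
have clb : (fun=> l) @ (0 : R)^' --> l by exact: cvg_cst.
have N0 : dot (perp (c1 t)) (g1 s) = 0 by have [_] := nbhs_singleton slv.
have Ha := cvg_alpha (FF := FF) c1d c2c g1d cta csa ctb.
have Hb := cvg_beta (FF := FF) c1d g1d g2c csa ctb csb.
have He := cvg_gs gd csa.
have Hn := cvg_nu (FF := FF) c1d cta.
have Hj := cvg_jac (FF := FF) cd c1d c2c gd g1d g2c cta csa ctb csb clb.
have Hna := cvg_nua (FF := FF) cd c1d cta ctb.
have Hnb := cvg_nub (FF := FF) c1d gd g1d cta csa csb clb N0.
have Hg := cvg_dot (FF := FF) Hn He.
have Hv : cross v (g (sigma (z h))) @[h --> 0^'] --> cross v (g s).
  by apply: cvg_cross => //; exact: cvg_cst.
have Hnv : dot (perp (c1 (tau (z h)))) v @[h --> 0^'] --> dot (perp (c1 t)) v.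
  by apply: cvg_dot => //; exact: cvg_cst.
have sz : \forall h \near 0^', solves c c1 g g1 (z h) (tau (z h)) (sigma (z h)) (lam (z h)) := cz _ slv.
have sx := nbhs_singleton slv.
have dif (h : R) : z h - x = h *: v by rewrite /z addrK.
have nz : \forall h \near (0 : R)^', h != 0 by exact: nbhs_dnbhs_neq.
have Jn := cvgr_neq0 (FF := FF) _ Hj J0.
have Gn := cvgr_neq0 (FF := FF) _ Hg G0.
pose dq (f : 'rV[R]_2 -> R) (h : R) := h^-1 *: ((f \o shift x) (h *: v) - f x).
have mk f L : dq f h @[h --> 0^'] --> L -> is_derive x v f L.
  by move=> H; split; [apply/cvg_ex; exists L|exact/cvg_lim].
have quo (J h T k w : R) : J != 0 -> h != 0 -> J * T = k * (h * w) -> h^-1 * T = k * w / J.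
  by move=> j0 h0 e; apply: (mulfI j0); rewrite mulrCA e; field; rewrite j0.
have quo2 (G h L V T na S nb : R) : G != 0 -> h != 0 -> G * L = h * V - T * na - S * nb ->
    (V - h^-1 * T * na - h^-1 * S * nb) * G^-1 = h^-1 * L.
  move=> g0 h0 e; apply: (mulfI g0); rewrite [RHS]mulrCA e; field.
  by rewrite g0 h0.
have crh (h : R) e : cross (z h - x) e = h * cross v e by rewrite dif; move: (h) => r; plane.
have doh (h : R) e : dot e (z h - x) = h * dot e v by rewrite dif dotZr.
have Dt : dq tau h @[h --> 0^'] --> beta0 c1 g2 t s * cross v (g s) / D.
  have H := cvgM (FF := FF) (cvgM (FF := FF) Hb Hv) (cvgV (FF := FF) J0 Hj).
  apply: cvg_trans H; apply: near_eq_cvg; near=> h.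
  have h0 : h != 0 by near: h.
  have szh : solves c c1 g g1 (z h) (tau (z h)) (sigma (z h)) (lam (z h)) by near: h.
  have [+ _ _] := two_point c2 g2 szh sx; rewrite crh => e.
  apply/esym/quo => //; near: h; exact: Jn.
have Ds : dq sigma h @[h --> 0^'] --> - alpha0 c2 g1 t s * cross v (g s) / D.
  have H := cvgM (FF := FF) (cvgM (FF := FF) (cvgN (FF := FF) Ha) Hv) (cvgV (FF := FF) J0 Hj).
  apply: cvg_trans H; apply: near_eq_cvg; near=> h.
  have h0 : h != 0 by near: h.
  have szh : solves c c1 g g1 (z h) (tau (z h)) (sigma (z h)) (lam (z h)) by near: h.
  have [_ + _] := two_point c2 g2 szh sx; rewrite crh => e.
  apply/esym/quo => //; near: h; exact: Jn.
(* The quotients of [tau] and [sigma] converge and are multiplied by factors tending to 0, so only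
   the normal component of [v] remains. *)
have Dl : dq lam h @[h --> 0^'] --> dot (perp (c1 t)) v / dot (perp (c1 t)) (g s).
  have H := cvgM (FF := FF) (cvgB (FF := FF) (cvgB (FF := FF) Hnv (cvgM (FF := FF) Dt Hna)) (cvgM (FF := FF) Ds Hnb)) (cvgV (FF := FF) G0 Hg).
  rewrite !mulr0 !subr0 in H.
  apply: cvg_trans H; apply: near_eq_cvg; near=> h.
  have h0 : h != 0 by near: h.
  have szh : solves c c1 g g1 (z h) (tau (z h)) (sigma (z h)) (lam (z h)) by near: h.
  have Gh : dot (perp (c1 (tau (z h)))) (g (sigma (z h))) != 0 by near: h; exact: Gn.
  have [_ _ +] := two_point c2 g2 szh sx; rewrite doh => e.
  exact: quo2 e.
by split; exact: mk.
Unshelve. all: by end_near. Qed.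

End Derivatives.

(** * Regularity of the solutions *)

Section LocallyHolder.
Variables (R : realType) (al : R).
Hypothesis al01 : 0 <= al <= 1.
Variable A : set 'rV[R]_2.
Hypothesis oA : open A.
Implicit Types f h : 'rV[R]_2 -> R.

Lemma near_pairP (V : normedModType R) (a : V) (P : V -> V -> Prop) :
  (\forall u \near a & w \near a, P u w) <->
  exists2 d : R, 0 < d & forall u w, `|u - a| < d -> `|w - a| < d -> P u w.
Proof.
split=> [[[X Y] /= [/nbhs_ballN[d d0 dX] /nbhs_ballN[e e0 eY]] XY]|[d d0 dP]].
  exists (Num.min d e); first by rewrite lt_min d0.
  move=> u w; rewrite !lt_min => /andP[ud _] /andP[_ we].
  by apply: (XY (u, w)); split; [exact: dX|exact: eY].
exists ([set u | `|u - a| < d], [set u | `|u - a| < d]) => /=.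
  by split; apply/nbhs_ballN; exists d.
by move=> [u w] [/= h1 h2]; exact: dP.
Qed.

(** Continuity is carried along because for exponent 0 the Hoelder condition only bounds the
    oscillation. *)
Definition cont_holder f := (forall a, A a -> {for a, continuous f}) /\ locally_Holder al A f.

(** The radius 1/2 forces [|u - w| <= 1], where a smaller exponent gives a larger power; hence
    Lipschitz functions are Hoelder. Distance 0 is separate because of the exponent 0. *)
Lemma holder_powR (a u w : 'rV[R]_2) (d : R) : d <= 1 / 2 -> `|u - a| < d -> `|w - a| < d ->
  `|u - w| <= `|u - w| `^ al.
Proof.
move=> d2 ua wa.
have h1 : `|u - w| <= 1.
  have -> : u - w = (u - a) - (w - a) by rewrite opprB addrA subrK.
  by apply: le_trans (ler_normB _ _) _; lra.
have [->|uw0] := eqVneq `|u - w| 0; first exact: powR_ge0.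
rewrite -{1}[`|u - w|]powRr1 //; case/andP: al01 => a0 a1.
by apply: ger_powR; rewrite // h1 andbT lt_neqAle eq_sym uw0 normr_ge0.
Qed.

Lemma holder_cst (r : R) : cont_holder (fun _ => r).
Proof.
split=> [a _|a _]; first exact: cst_continuous.
exists 0; apply/near_pairP; exists 1 => // u w _ _.
by rewrite subrr normr0 mul0r.
Qed.

Lemma holder_ext f h : (forall a, A a -> f a = h a) -> cont_holder f -> cont_holder h.
Proof.
move=> fh [cf hf]; split=> a Aa.
  have /nbhs_ballN[e e0 eA] := open_nbhs_nbhs (conj oA Aa).
  apply/continuous_epsP => r r0; have [d d0 dP] := (continuous_epsP _ _).1 (cf a Aa) r r0.
  exists (Num.min d e); first by rewrite lt_min d0.
  by move=> b; rewrite lt_min => /andP[b1 b2]; rewrite -!fh //; [exact: dP|exact: eA].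
have [C /near_pairP[d d0 dP]] := hf a Aa.
have /nbhs_ballN[e e0 eA] := open_nbhs_nbhs (conj oA Aa).
exists C; apply/near_pairP; exists (Num.min d e); first by rewrite lt_min d0.
move=> u w; rewrite !lt_min => /andP[u1 u2] /andP[w1 w2].
by rewrite -!fh; [exact: dP|exact: eA|exact: eA].
Unshelve. all: by end_near. Qed.

Lemma holderD f h : cont_holder f -> cont_holder h -> cont_holder (f \+ h).
Proof.
move=> [cf hf] [ch hh]; split=> a Aa.
  exact: (cvgD (cf a Aa) (ch a Aa)).
have [C /near_pairP[d d0 dP]] := hf a Aa; have [B /near_pairP[e e0 eP]] := hh a Aa.
exists (C + B); apply/near_pairP; exists (Num.min d e); first by rewrite lt_min d0.
move=> u w; rewrite !lt_min => /andP[u1 u2] /andP[w1 w2] /=.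
have -> : f u + h u - (f w + h w) = (f u - f w) + (h u - h w) by ring.
by apply: le_trans (ler_normD _ _) _; rewrite mulrDl; apply: lerD; [exact: dP|exact: eP].
Qed.

Lemma bounded_near_cont f a : {for a, continuous f} ->
  exists2 d : R, 0 < d & forall u, `|u - a| < d -> `|f u| <= `|f a| + 1.
Proof.
move=> /continuous_epsP /(_ 1 ltr01)[d d0 dP]; exists d => // u /dP h.
have -> : f u = f a + (f u - f a) by ring.
by apply: le_trans (ler_normD _ _) _; rewrite lerD2l ltW.
Qed.

Lemma holderM f h : cont_holder f -> cont_holder h -> cont_holder (f \* h).
Proof.
move=> [cf hf] [ch hh]; split=> a Aa.
  exact: (cvgM (cf a Aa) (ch a Aa)).
have [C /near_pairP[d d0 dP]] := hf a Aa; have [B /near_pairP[e e0 eP]] := hh a Aa.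
have [p p0 pP] := bounded_near_cont (cf a Aa); have [q q0 qP] := bounded_near_cont (ch a Aa).
exists ((`|f a| + 1) * B + (`|h a| + 1) * C); apply/near_pairP.
exists (Num.min (Num.min d e) (Num.min p q)); first by rewrite !lt_min d0 e0 p0.
move=> u w; rewrite !lt_min => /andP[/andP[u1 u2] /andP[u3 u4]] /andP[/andP[w1 w2] /andP[w3 w4]] /=.
have -> : f u * h u - f w * h w = f u * (h u - h w) + h w * (f u - f w) by ring.
apply: le_trans (ler_normD _ _) _; rewrite !normrM mulrDl -!mulrA.
by apply: lerD; apply: ler_pM => //; [exact: pP|exact: eP|exact: qP|exact: dP].
Qed.

Lemma holderV f (b : R) : 0 < b -> (forall a, A a -> b <= `|f a|) -> cont_holder f ->
  cont_holder (fun a => (f a)^-1).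
Proof.
move=> b0 fb [cf hf].
have f0 a : A a -> f a != 0 by move=> Aa; rewrite -normr_gt0 (lt_le_trans b0) // fb.
split=> a Aa; first exact: (cvgV (f0 a Aa) (cf a Aa)).
have [C /near_pairP[d d0 dP]] := hf a Aa.
have /nbhs_ballN[e e0 eA] := open_nbhs_nbhs (conj oA Aa).
exists (b^-1 * b^-1 * C); apply/near_pairP; exists (Num.min d e); first by rewrite lt_min d0.
move=> u w; rewrite !lt_min => /andP[u1 u2] /andP[w1 w2] /=.
have Au := eA _ u2; have Aw := eA _ w2.
have -> : (f u)^-1 - (f w)^-1 = (f u)^-1 * (f w)^-1 * (f w - f u).
  by field; rewrite f0 //= f0.
have iv z : A z -> `|(f z)^-1| <= b^-1.
  by move=> Az; rewrite normfV lef_pV2 ?posrE ?normr_gt0 ?f0 ?fb.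
rewrite !normrM -[leRHS]mulrA; apply: ler_pM; rewrite ?mulr_ge0 //.
  by apply: ler_pM => //; exact: iv.
by rewrite distrC; exact: dP.
Qed.

Lemma holder_lipschitz f (C : R) : (forall u w, A u -> A w -> `|f u - f w| <= C * `|u - w|) ->
  cont_holder f.
Proof.
move=> L.
pose C' := `|C| + 1; have C'0 : 0 < C' by rewrite ltr_wpDl.
have L' u w : A u -> A w -> `|f u - f w| <= C' * `|u - w|.
  move=> Au Aw; apply: le_trans (L u w Au Aw) _; apply: ler_wpM2r => //.
  by rewrite /C' (le_trans (ler_norm _)) // lerDl.
split=> a Aa; have /nbhs_ballN[e e0 eA] := open_nbhs_nbhs (conj oA Aa).
  apply/continuous_epsP => r r0; exists (Num.min e (r / C')).
    by rewrite lt_min e0 divr_gt0.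
  move=> b; rewrite lt_min => /andP[b1 b2]; apply: le_lt_trans (L' _ _ (eA _ b1) Aa) _.
  by rewrite mulrC -ltr_pdivlMr.
exists C'; apply/near_pairP; exists (Num.min e (1 / 2)); first by rewrite lt_min e0 divr_gt0.
move=> u w; rewrite !lt_min => /andP[u1 u2] /andP[w1 w2].
apply: le_trans (L' _ _ (eA _ u1) (eA _ w1)) _; apply: ler_wpM2l; first exact: ltW.
exact: (holder_powR (lexx _) u2 w2).
Qed.

(** A Lipschitz inner function preserves the exponent, whereas exponents of two Hoelder functions
    would multiply. Replacing [C] and [B] by their absolute values plus 1 secures their signs. *)
Lemma holder_comp (phi : R -> R) f (C : R) : (forall u w, A u -> A w -> `|f u - f w| <= C * `|u - w|) ->
  (forall a, A a -> {for f a, continuous phi}) ->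
  (forall a, A a -> exists B : R, \forall r \near f a & s \near f a,
     `|phi r - phi s| <= B * `|r - s| `^ al) ->
  cont_holder (phi \o f).
Proof.
move=> L cphi hphi; have [cf _] := holder_lipschitz L.
pose C' := `|C| + 1; have C'0 : 0 < C' by rewrite ltr_wpDl.
have L' u w : A u -> A w -> `|f u - f w| <= C' * `|u - w|.
  move=> Au Aw; apply: le_trans (L u w Au Aw) _; apply: ler_wpM2r => //.
  by rewrite /C' (le_trans (ler_norm _)) // lerDl.
split=> a Aa; first exact: (continuous_comp (cf a Aa) (cphi a Aa)).
have [B /near_pairP[d d0 dP]] := hphi a Aa.
have /continuous_epsP /(_ d d0)[e e0 eP] := cf a Aa.
have /nbhs_ballN[e' e'0 eA] := open_nbhs_nbhs (conj oA Aa).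
exists ((`|B| + 1) * C' `^ al); apply/near_pairP; exists (Num.min e e'); first by rewrite lt_min e0.
move=> u w; rewrite !lt_min => /andP[u1 u2] /andP[w1 w2] /=.
apply: le_trans (dP _ _ (eP _ u1) (eP _ w1)) _.
apply: (@le_trans _ _ ((`|B| + 1) * `|f u - f w| `^ al)).
  by apply: ler_wpM2r; [exact: powR_ge0|rewrite (le_trans (ler_norm _)) // lerDl].
rewrite -mulrA; apply: ler_wpM2l; first by rewrite addr_ge0.
rewrite -powRM ?(ltW C'0) //; apply: ge0_ler_powR; rewrite ?nnegrE ?mulr_ge0 ?(ltW C'0) //.
  by case/andP: al01.
exact: L' (eA _ u2) (eA _ w2).
Qed.

End LocallyHolder.

(* Polynomials in the functions [Y i]: [m] bounds the orders [o i] that occur,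
   [N] the total weight of the monomials, and [B] the sum of the absolute values
   of the monomials when [Y i] is bounded by [kp i].  A derivative raises [m] by
   one, [N] by a constant, and multiplies [B] by at most a constant times [N], so
   that [n] derivatives are bounded by [K * C ^+ n * n`!]. *)
Section Polynomials.
Variables (R : realType) (A : set 'rV[R]_2).
Hypothesis oA : open A.
Variables (I : Type) (Y : I -> 'rV[R]_2 -> R) (o : I -> nat) (wt kp : I -> R).
Hypothesis wt0 : forall i, 0 <= wt i.
Hypothesis kp0 : forall i, 0 <= kp i.
Implicit Types (f h F : 'rV[R]_2 -> R) (m : nat) (N B : R).

Inductive pol : nat -> R -> R -> ('rV[R]_2 -> R) -> Prop :=
| pol_cst a : pol 0 0 `|a| (fun _ => a)
| pol_gen i : pol (o i) (wt i) (kp i) (Y i)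
| pol_add m N B B' f h : pol m N B f -> pol m N B' h -> pol m N (B + B') (f \+ h)
| pol_mul m N N' B B' f h : pol m N B f -> pol m N' B' h -> pol m (N + N') (B * B') (f \* h)
| pol_le m m' N N' B B' f : (m <= m')%N -> N <= N' -> B <= B' -> pol m N B f -> pol m' N' B' f
| pol_ext m N B f h : (forall a, A a -> f a = h a) -> pol m N B f -> pol m N B h.

Lemma pol_ge0 m N B f : pol m N B f -> 0 <= N /\ 0 <= B.
Proof.
elim=> {m N B f} //.
- by move=> m N B B' f h _ [? ?] _ [? ?]; split=> //; exact: addr_ge0.
- by move=> m N N' B B' f h _ [? ?] _ [? ?]; split; [exact: addr_ge0|exact: mulr_ge0].
- by move=> m m' N N' B B' f _ NN BB _ [? ?]; split; [exact: le_trans NN|exact: le_trans BB].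
Qed.

Lemma pol_scale m N B f (a : R) : pol m N B f -> pol m N (`|a| * B) (fun z => a * f z).
Proof.
move=> pf; have := pol_mul (pol_le (leq0n m) (lexx 0) (lexx _) (pol_cst a)) pf.
by rewrite add0r; apply: pol_ext.
Qed.

(** Two coefficient functions serve all directions [v], so the estimates depend on the direction
    only through its norm. *)
Definition gradient f F0 F1 := forall a v, A a -> is_derive a v f (v 0 0 * F0 a + v 0 1 * F1 a).

Lemma gradient_mul f h F0 F1 H0 H1 : gradient f F0 F1 -> gradient h H0 H1 ->
  gradient (f \* h) (fun a => f a * H0 a + h a * F0 a) (fun a => f a * H1 a + h a * F1 a).
Proof.
move=> gf gh a v Aa; apply: is_derive_eq (is_deriveM (gf a v Aa) (gh a v Aa)) _.
by rewrite /GRing.scale /=; ring.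
Qed.

Lemma gradient_add f h F0 F1 H0 H1 : gradient f F0 F1 -> gradient h H0 H1 ->
  gradient (f \+ h) (F0 \+ H0) (F1 \+ H1).
Proof.
move=> gf gh a v Aa; apply: is_derive_eq (is_deriveD (gf a v Aa) (gh a v Aa)) _.
by rewrite /=; ring.
Qed.

Lemma gradient_ext f h F0 F1 : (forall a, A a -> f a = h a) -> gradient f F0 F1 -> gradient h F0 F1.
Proof. by move=> fh gf a v Aa; apply: near_is_derive fh (gf a v Aa). Qed.

Variables (ok : nat -> Prop) (C d : R).
Hypothesis okle : forall m m', (m <= m')%N -> ok m' -> ok m.
Hypothesis C0 : 0 <= C.
Hypothesis d0 : 0 <= d.
Hypothesis gen_gradient : forall i, ok (o i).+1 -> exists F0 F1,
  [/\ pol (o i).+1 (wt i + d) (C * wt i * kp i) F0,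
      pol (o i).+1 (wt i + d) (C * wt i * kp i) F1 & gradient (Y i) F0 F1].

(** Leibniz' rule: weights add in a product, so the factor [C * N] distributes over the two terms
    exactly. The predicate [ok] tells which orders of derivatives exist: those up to k in a Hoelder
    class, all of them in the smooth and analytic classes. *)
Lemma pol_gradient m N B f : pol m N B f -> ok m.+1 -> exists F0 F1,
  [/\ pol m.+1 (N + d) (C * N * B) F0, pol m.+1 (N + d) (C * N * B) F1 & gradient f F0 F1].
Proof.
elim=> {m N B f}.
- move=> a _; exists (fun _ => 0), (fun _ => 0).
  have p0 : pol 1 (0 + d) (C * 0 * `|a|) (fun _ => 0).
    by apply: pol_le (pol_cst 0); rewrite ?add0r // mulr0 mul0r normr0.
  by split=> // b v Ab; rewrite !mulr0 addr0; exact: is_derive_cst.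
- by move=> i /gen_gradient.
- move=> m N B B' f h pf IHf ph IHh okm.
  have [F0 [F1 [p0 p1 gf]]] := IHf okm; have [H0 [H1 [q0 q1 gh]]] := IHh okm.
  exists (F0 \+ H0), (F1 \+ H1); rewrite mulrDr; split; try exact: pol_add.
  exact: gradient_add.
- move=> m N N' B B' f h pf IHf ph IHh okm.
  have [F0 [F1 [p0 p1 gf]]] := IHf okm; have [H0 [H1 [q0 q1 gh]]] := IHh okm.
  have H F H : pol m.+1 (N + d) (C * N * B) F -> pol m.+1 (N' + d) (C * N' * B') H ->
      pol m.+1 (N + N' + d) (C * (N + N') * (B * B')) (fun a => f a * H a + h a * F a).
    move=> pF pH.
    have -> : C * (N + N') * (B * B') = B * (C * N' * B') + B' * (C * N * B) by ring.
    apply: (pol_add (f := f \* H) (h := h \* F)).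
      by rewrite -addrA; apply: pol_mul => //; apply: pol_le pf.
    by rewrite -addrA addrCA; apply: pol_mul => //; apply: pol_le ph.
  exists (fun a => f a * H0 a + h a * F0 a), (fun a => f a * H1 a + h a * F1 a).
  by split; [exact: H|exact: H|exact: gradient_mul].
- move=> m m' N N' B B' f mm NN BB pf IH okm.
  have [F0 [F1 [p0 p1 gf]]] := IH (okle (mm : (m.+1 <= m'.+1)%N) okm).
  have [N0 B0] := pol_ge0 pf.
  have L : C * N * B <= C * N' * B'.
    by apply: ler_pM => //; [exact: mulr_ge0|exact: ler_wpM2l].
  by exists F0, F1; split=> //; [apply: pol_le p0|apply: pol_le p1]; rewrite ?lerD2r.
- move=> m N B f h fh pf IH okm; have [F0 [F1 [p0 p1 gf]]] := IH okm.
  by exists F0, F1; split=> //; exact: gradient_ext gf.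
Qed.

Lemma pol_derive m N B f v : pol m N B f -> ok m.+1 -> exists2 F,
  pol m.+1 (N + d) (2 * `|v| * (C * N * B)) F & forall a, A a -> is_derive a v f (F a).
Proof.
move=> pf okm; have [F0 [F1 [p0 p1 gf]]] := pol_gradient pf okm.
have [N0 B0] := pol_ge0 pf.
exists (fun a => v 0 0 * F0 a + v 0 1 * F1 a); last by move=> a; exact: gf.
have vj j : `|v 0 j| <= `|v|.
  by rewrite norm2E le_max; case: (ord2P j) => ->; rewrite lexx ?orbT.
have -> : 2 * `|v| * (C * N * B) = `|v| * (C * N * B) + `|v| * (C * N * B) by ring.
apply: (pol_add (f := fun a => v 0 0 * F0 a) (h := fun a => v 0 1 * F1 a)).
  by apply: pol_le (pol_scale (v 0 0) p0) => //; apply: ler_wpM2r => //; rewrite !mulr_ge0.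
by apply: pol_le (pol_scale (v 0 1) p1) => //; apply: ler_wpM2r => //; rewrite !mulr_ge0.
Qed.

(** After j derivatives the weight is [N + j d], so the next one multiplies the bound by twice [C]
    times this weight times the norm of the direction; the 2 counts the coordinates. *)
Definition iter_bound N B (vs : seq 'rV[R]_2) : R :=
  B * \prod_(j < size vs) (2 * C * (N + j%:R * d)) * \prod_(v <- vs) `|v|.

Lemma pol_iter m N B f vs : pol m N B f -> ok (m + size vs)%N ->
  exists2 F, pol (m + size vs)%N (N + (size vs)%:R * d) (iter_bound N B vs) F &
    forall a, A a -> Defs.iterD f vs a = F a.
Proof.
move=> pf; elim: vs => [|v vs IH] okm.
  exists f => //; rewrite /iter_bound /= addn0 mul0r addr0 big_ord0 big_nil !mulr1.
  exact: pf.
have [F pF FE] : exists2 F, pol (m + size vs)%N (N + (size vs)%:R * d) (iter_bound N B vs) F &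
    forall a, A a -> Defs.iterD f vs a = F a.
  by apply: IH; apply: okle okm; rewrite leq_add2l.
have [|G pG GE] := pol_derive v pF; first by rewrite -addnS.
exists G; last first.
  move=> a Aa /=; rewrite -(derive_val (is_derive := GE a Aa)).
  apply: near_eq_derive; have : nbhs a A by exact: open_nbhs_nbhs.
  by apply: filterS => b /FE.
rewrite /= addnS.
have -> : iter_bound N B (v :: vs) =
    2 * `|v| * (C * (N + (size vs)%:R * d) * iter_bound N B vs).
  by rewrite /iter_bound /= big_ord_recr /= big_cons; ring.
have -> : N + (size vs).+1%:R * d = N + (size vs)%:R * d + d by rewrite -natr1; ring.
exact: pG.
Qed.

Lemma pol_bound m N B f a : (forall i b, ok (o i) -> A b -> `|Y i b| <= kp i) ->
  pol m N B f -> ok m -> A a -> `|f a| <= B.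
Proof.
move=> Yb pf okm Aa; elim: pf okm => {m N B f}.
- by [].
- by move=> i oki; exact: Yb.
- move=> m N B B' f h _ IHf _ IHh okm /=.
  by apply: le_trans (ler_normD _ _) _; apply: lerD; [exact: IHf|exact: IHh].
- move=> m N N' B B' f h _ IHf _ IHh okm /=.
  by rewrite normrM; apply: ler_pM => //; [exact: IHf|exact: IHh].
- by move=> m m' N N' B B' f mm _ BB _ IH okm; apply: le_trans BB; apply: IH; exact: okle okm.
- by move=> m N B f h fh _ IH okm; rewrite -fh //; exact: IH.
Qed.

Lemma pol_holder al m N B f : 0 <= al <= 1 ->
  (forall i, ok (o i) -> cont_holder al A (Y i)) ->
  pol m N B f -> ok m -> cont_holder al A f.
Proof.
move=> al01 Yh pf; elim: pf => {m N B f}.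
- by move=> a _; exact: holder_cst.
- by move=> i oki; exact: Yh.
- by move=> m N B B' f h _ IHf _ IHh okm; apply: holderD; [exact: IHf|exact: IHh].
- by move=> m N N' B B' f h _ IHf _ IHh okm; apply: holderM; [exact: IHf|exact: IHh].
- by move=> m m' N N' B B' f mm _ BB _ IH okm; apply: IH; exact: okle okm.
- by move=> m N B f h fh _ IH okm; apply: holder_ext (IH okm).
Qed.

(** A function of order 0 becomes, after k derivatives, a polynomial of order k, hence in generators
    that are still continuous and Hoelder. *)
Lemma pol_Ck k al N B f : 0 <= al <= 1 -> ok k ->
  (forall i, ok (o i) -> cont_holder al A (Y i)) -> pol 0 N B f ->
  Ck k A f /\ forall vs, size vs = k -> locally_Holder al A (Defs.iterD f vs).
Proof.
move=> al01 okk Yh pf.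
have main vs : (size vs <= k)%N -> cont_holder al A (Defs.iterD f vs).
  move=> sk; have okvs : ok (0 + size vs)%N by apply: okle okk.
  have [F pF FE] := pol_iter pf okvs.
  apply: (holder_ext oA (fun a Aa => esym (FE a Aa))).
  exact: pol_holder pF okvs.
split=> [vs a sk Aa|vs sk]; last by have [] := main vs (eq_leq sk).
split; first by have [+ _] := main vs sk; apply.
move=> sk' v; have okvs : ok (0 + size vs)%N by apply: okle okk.
have [F pF FE] := pol_iter pf okvs.
have [|G pG GE] := pol_derive v pF; first by apply: okle okk.
have [] := near_is_derive (conj oA Aa) (f := F) (g := Defs.iterD f vs) _ (GE a Aa) => //.
by move=> b Ab; rewrite FE.
Qed.

End Polynomials.

(** * The generators: derivatives of the curves, the distance, and two inverses *)

Section Generators.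
Variables (R : realType) (A : set 'rV[R]_2).
Hypothesis oA : open A.
Variables (c g : R -> 'rV[R]_2) (tau sigma lam : 'rV[R]_2 -> R).

Definition mu_at a := dot (perp (drv c 1 (tau a))) (g (sigma a)).
Definition jac_at a := jac0 (drv c 1) (drv c 2) g (drv g 1) (drv g 2) (tau a) (sigma a) (lam a).

(** The curve [c] enters only through its derivatives, hence the shift in [Gc]. [GE] and [GJ] are
    the inverses by which the derivatives of the solution divide. *)
Inductive gen := Gc of 'I_2 & nat | Gg of 'I_2 & nat | Gl | GE | GJ.

Definition Ygen i : 'rV[R]_2 -> R :=
  match i with
  | Gc j l => fun a => drv c l.+1 (tau a) 0 j
  | Gg j l => fun a => drv g l (sigma a) 0 j
  | Gl => lam
  | GE => fun a => (mu_at a)^-1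
  | GJ => fun a => (jac_at a)^-1
  end.

(** The order is the highest derivative of the curves involved. [Gg _ 0] is raised to 1 because its
    gradient contains that of [sigma], which has order 2. [Gl] has order 0 and a gradient of order
    1: this is why the distance is as regular as the curves. *)
Definition ogen i : nat :=
  match i with Gc _ l => l.+1 | Gg _ l => maxn l 1 | Gl => 0 | GE => 1 | GJ => 2 end.

(** For a derivative of a curve, the weight times [rho] is the ratio of two successive bounds in
    [kgen], so one chain rule costs a constant times the weight. *)
Definition wgen i : R :=
  match i with Gc _ l => l.+2%:R | Gg _ l => l.+1%:R | _ => 1 end.

Variables (M rho L : R).
Hypothesis M0 : 0 <= M.
Hypothesis rho0 : 0 <= rho.
Hypothesis L0 : 0 < L.

Definition kgen i : R :=
  match i with
  | Gc _ l => M * rho ^+ l.+1 * (l.+1)`!%:R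
  | Gg _ l => M * rho ^+ l * (l`!)%:R
  | _ => L
  end.

Local Notation pol := (pol A Ygen ogen wgen kgen).

Lemma wgen_ge0 i : 0 <= wgen i. Proof. by case: i. Qed.
Lemma kgen_ge0 i : 0 <= kgen i.
Proof. by case: i => /= *; rewrite ?(ltW L0) // !mulr_ge0 ?exprn_ge0. Qed.

(** Forgets the weight and the bound; it is used for the finitely many functions for which their
    mere existence matters. *)
Definition qt m f := exists N B, pol m N B f.

Lemma qt_gen i m : (ogen i <= m)%N -> qt m (Ygen i).
Proof. by move=> im; exists (wgen i), (kgen i); apply: pol_le im _ _ (pol_gen _ _ _ _ _ _). Qed.

Lemma qt_le m m' f : (m <= m')%N -> qt m f -> qt m' f.
Proof. by move=> mm [N [B pf]]; exists N, B; exact: pol_le pf. Qed.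

Lemma qt_mul m f h : qt m f -> qt m h -> qt m (fun a => f a * h a).
Proof. by move=> [N [B pf]] [N' [B' ph]]; exists (N + N'), (B * B'); exact: (pol_mul pf ph). Qed.

Lemma qt_add m f h : qt m f -> qt m h -> qt m (fun a => f a + h a).
Proof.
move=> [N [B pf]] [N' [B' ph]]; have [N0 B0] := pol_ge0 wgen_ge0 kgen_ge0 pf.
have [N0' B0'] := pol_ge0 wgen_ge0 kgen_ge0 ph.
by exists (N + N'), (B + B'); apply: pol_add; [apply: pol_le pf|apply: pol_le ph];
  rewrite ?lerDl ?lerDr.
Qed.

Lemma qt_cst m r : qt m (fun _ => r).
Proof. by exists 0, `|r|; apply: pol_le (pol_cst _ _ _ _ _ r). Qed.

Lemma qt_opp m f : qt m f -> qt m (fun a => - f a).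
Proof.
move=> qf; have [N [B p]] := qt_mul (qt_cst m (-1)) qf.
by exists N, B; apply: pol_ext p => a _; rewrite mulN1r.
Qed.

Definition gq m f := exists F0 F1, [/\ qt m F0, qt m F1 & gradient A f F0 F1].

Lemma gq_add m f h : gq m f -> gq m h -> gq m (fun a => f a + h a).
Proof.
move=> [F0 [F1 [p0 p1 gf]]] [H0 [H1 [q0 q1 gh]]].
by exists (fun a => F0 a + H0 a), (fun a => F1 a + H1 a); split;
  [exact: qt_add|exact: qt_add|exact: (gradient_add gf gh)].
Qed.

Lemma gq_mul m f h : qt m f -> qt m h -> gq m f -> gq m h -> gq m (fun a => f a * h a).
Proof.
move=> qf qh [F0 [F1 [p0 p1 gf]]] [H0 [H1 [q0 q1 gh]]].
exists (fun a => f a * H0 a + h a * F0 a), (fun a => f a * H1 a + h a * F1 a).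
by split; [by apply: qt_add; exact: qt_mul|by apply: qt_add; exact: qt_mul|exact: (gradient_mul gf gh)].
Qed.

Lemma gq_opp m f : gq m f -> gq m (fun a => - f a).
Proof.
move=> [F0 [F1 [p0 p1 gf]]]; exists (fun a => - F0 a), (fun a => - F1 a).
split; [exact: qt_opp|exact: qt_opp|move=> a v Aa].
by apply: is_derive_eq (is_deriveN (gf a v Aa)) _; ring.
Qed.

Lemma gq_inv m f : (forall a, A a -> f a != 0) -> qt m (fun a => (f a)^-1) -> gq m f ->
  gq m (fun a => (f a)^-1).
Proof.
move=> f0 qi [F0 [F1 [p0 p1 gf]]].
exists (fun a => - ((f a)^-1 * (f a)^-1 * F0 a)), (fun a => - ((f a)^-1 * (f a)^-1 * F1 a)).
have H F : qt m F -> qt m (fun a => - ((f a)^-1 * (f a)^-1 * F a)).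
  by move=> pF; apply: qt_opp; apply: qt_mul => //; exact: qt_mul.
split; [exact: H|exact: H|move=> a v Aa].
have [fa fE] := gf a v Aa; apply: DeriveDef; first by apply: derivableV => //; exact: f0.
by rewrite deriveV //; [rewrite fE /GRing.scale /= -exprVn expr2; ring|exact: f0].
Qed.

Variable ok : nat -> Prop.
Hypothesis okle : forall m m', (m <= m')%N -> ok m' -> ok m.
Hypothesis cd : forall l a, ok l.+1 -> A a -> is_derive (tau a) 1 (drv c l) (drv c l.+1 (tau a)).
Hypothesis gd : forall l a, ok l.+1 -> A a -> is_derive (sigma a) 1 (drv g l) (drv g l.+1 (sigma a)).
Hypothesis mu0 : forall a, A a -> mu_at a != 0.
Hypothesis jac0' : forall a, A a -> jac_at a != 0.
Hypothesis td : forall a v, A a -> is_derive a v tau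
  (beta0 (drv c 1) (drv g 2) (tau a) (sigma a) * cross v (g (sigma a)) / jac_at a).
Hypothesis sd : forall a v, A a -> is_derive a v sigma
  (- alpha0 (drv c 2) (drv g 1) (tau a) (sigma a) * cross v (g (sigma a)) / jac_at a).
Hypothesis ld : forall a v, A a -> is_derive a v lam
  (dot (perp (drv c 1 (tau a))) v / mu_at a).

Let be a := - Ygen (Gc 1 0) a * Ygen (Gg 0 2) a + Ygen (Gc 0 0) a * Ygen (Gg 1 2) a.
Let al a := - Ygen (Gc 1 1) a * Ygen (Gg 0 1) a + Ygen (Gc 0 1) a * Ygen (Gg 1 1) a.

Let beE a : beta0 (drv c 1) (drv g 2) (tau a) (sigma a) = be a.
Proof. by rewrite /beta0 dotE perp0 perp1. Qed.

Let alE a : alpha0 (drv c 2) (drv g 1) (tau a) (sigma a) = al a.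
Proof. by rewrite /alpha0 dotE perp0 perp1. Qed.

Let q_be : qt 2 be.
Proof. by apply: qt_add; apply: qt_mul; [apply: qt_opp| | |]; exact: qt_gen. Qed.

Let q_al : qt 2 al.
Proof. by apply: qt_add; apply: qt_mul; [apply: qt_opp| | |]; exact: qt_gen. Qed.

(** Order 2, since the determinant and its cofactors contain second derivatives of both curves. *)
Lemma gq_tau : gq 2 tau.
Proof.
exists (fun a => be a * Ygen (Gg 1 0) a * Ygen GJ a), (fun a => be a * - Ygen (Gg 0 0) a * Ygen GJ a).
split; try by apply: qt_mul; [apply: qt_mul; [|try apply: qt_opp]|]; by [exact: q_be|exact: qt_gen].
by move=> a v Aa; apply: is_derive_eq (td v Aa) _; rewrite beE /cross /=; ring.
Qed.

Lemma gq_sigma : gq 2 sigma.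
Proof.
exists (fun a => - al a * Ygen (Gg 1 0) a * Ygen GJ a), (fun a => - al a * - Ygen (Gg 0 0) a * Ygen GJ a).
split; try by apply: qt_mul; [apply: qt_mul; [apply: qt_opp|try apply: qt_opp]|]; by [exact: q_al|exact: qt_gen].
by move=> a v Aa; apply: is_derive_eq (sd v Aa) _; rewrite alE /cross /=; ring.
Qed.

(** Only c' and the inverse normal component occur, so the order is 1 and not 2. *)
Lemma gq_lam : gq 1 lam.
Proof.
exists (fun a => - Ygen (Gc 1 0) a * Ygen GE a), (fun a => Ygen (Gc 0 0) a * Ygen GE a).
split; try by apply: qt_mul; [try apply: qt_opp|]; exact: qt_gen.
by move=> a v Aa; apply: is_derive_eq (ld v Aa) _; rewrite dotE perp0 perp1 /=; ring.
Qed.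

Lemma gq_Gc j l : ok l.+2 -> gq l.+2 (Ygen (Gc j l)).
Proof.
move=> okl; have [F0 [F1 [p0 p1 gf]]] := gq_tau.
exists (fun a => Ygen (Gc j l.+1) a * F0 a), (fun a => Ygen (Gc j l.+1) a * F1 a); split.
- by apply: qt_mul; [exact: qt_gen|exact: qt_le p0].
- by apply: qt_mul; [exact: qt_gen|exact: qt_le p1].
move=> a v Aa.
have h := is_derive_comp1 (gf a v Aa) (is_derive_coord j (cd okl Aa)).
by apply: is_derive_eq h _; rewrite /=; ring.
Qed.

Lemma gq_Gg j l m : (l < m)%N -> (1 < m)%N -> ok l.+1 -> gq m (Ygen (Gg j l)).
Proof.
move=> lm m1 okl; have [F0 [F1 [p0 p1 gf]]] := gq_sigma.
exists (fun a => Ygen (Gg j l.+1) a * F0 a), (fun a => Ygen (Gg j l.+1) a * F1 a); split.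
- by apply: qt_mul; [apply: qt_gen => /=; rewrite geq_max lm ltnW|exact: qt_le p0].
- by apply: qt_mul; [apply: qt_gen => /=; rewrite geq_max lm ltnW|exact: qt_le p1].
move=> a v Aa.
have h := is_derive_comp1 (gf a v Aa) (is_derive_coord j (gd okl Aa)).
by apply: is_derive_eq h _; rewrite /=; ring.
Qed.

Lemma gq_GE : ok 2 -> gq 2 (Ygen GE).
Proof.
move=> ok2; apply: gq_inv => //; first exact: (@qt_gen GE).
pose mu' a := - Ygen (Gc 1 0) a * Ygen (Gg 0 0) a + Ygen (Gc 0 0) a * Ygen (Gg 1 0) a.
have -> : mu_at = mu' by apply/funext => a; rewrite /mu_at dotE perp0 perp1.
have ok1 : ok 1 by exact: okle ok2.
apply: gq_add; apply: gq_mul.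
- by apply: qt_opp; exact: qt_gen.
- exact: qt_gen.
- by apply: gq_opp; exact: gq_Gc.
- exact: gq_Gg.
- exact: qt_gen.
- exact: qt_gen.
- exact: gq_Gc.
- exact: gq_Gg.
Qed.

Lemma gq_GJ : ok 3 -> gq 3 (Ygen GJ).
Proof.
move=> ok3; apply: gq_inv => //; first exact: (@qt_gen GJ).
have ok2 : ok 2 by exact: okle ok3.
have ok1 : ok 1 by exact: okle ok3.
have qc j l : (l < 3)%N -> qt 3 (Ygen (Gc j l)) by move=> l3; exact: qt_gen.
have qg j l : (l <= 3)%N -> qt 3 (Ygen (Gg j l)).
  by move=> l3; apply: qt_gen; rewrite /= geq_max l3.
have ql : qt 3 (Ygen Gl) by exact: qt_gen.
have gc j l : (l < 2)%N -> gq 3 (Ygen (Gc j l)).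
  move=> l2; have okl : ok l.+2 by exact: okle ok3.
  have [F0 [F1 [p0 p1 gf]]] := gq_Gc j okl.
  by exists F0, F1; split=> //; [exact: qt_le p0|exact: qt_le p1].
have gg j l : (l < 3)%N -> gq 3 (Ygen (Gg j l)).
  by move=> l2; apply: gq_Gg => //; exact: okle ok3.
have gl : gq 3 (Ygen Gl).
  have [F0 [F1 [p0 p1 gf]]] := gq_lam.
  by exists F0, F1; split=> //; [exact: qt_le p0|exact: qt_le p1].
pose cr (f0 f1 h0 h1 : 'rV[R]_2 -> R) a := f0 a * h1 a + - (f1 a * h0 a).
pose J a := be a * cr (Ygen (Gc 0 0)) (Ygen (Gc 1 0)) (Ygen (Gg 0 0)) (Ygen (Gg 1 0)) a
  + - (al a * Ygen Gl a * cr (Ygen (Gg 0 1)) (Ygen (Gg 1 1)) (Ygen (Gg 0 0)) (Ygen (Gg 1 0)) a).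
have -> : jac_at = J.
  by apply/funext => a; rewrite /jac_at /jac0 /jac beE alE /J /cr /cross.
have gmul f h : qt 3 f /\ gq 3 f -> qt 3 h /\ gq 3 h ->
    qt 3 (fun a => f a * h a) /\ gq 3 (fun a => f a * h a).
  by move=> [? ?] [? ?]; split; [exact: qt_mul|exact: gq_mul].
have gadd f h : qt 3 f /\ gq 3 f -> qt 3 h /\ gq 3 h ->
    qt 3 (fun a => f a + h a) /\ gq 3 (fun a => f a + h a).
  by move=> [? ?] [? ?]; split; [exact: qt_add|exact: gq_add].
have gopp f : qt 3 f /\ gq 3 f -> qt 3 (fun a => - f a) /\ gq 3 (fun a => - f a).
  by move=> [? ?]; split; [exact: qt_opp|exact: gq_opp].
have bc j l : (l < 2)%N -> qt 3 (Ygen (Gc j l)) /\ gq 3 (Ygen (Gc j l)).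
  by move=> l2; split; [apply: qc; exact: ltnW|exact: gc].
have bg j l : (l < 3)%N -> qt 3 (Ygen (Gg j l)) /\ gq 3 (Ygen (Gg j l)).
  by move=> l2; split; [apply: qg; exact: ltnW|exact: gg].
have bl : qt 3 (Ygen Gl) /\ gq 3 (Ygen Gl) by [].
suff [] : qt 3 J /\ gq 3 J by [].
have cr_ok f0 f1 h0 h1 : qt 3 f0 /\ gq 3 f0 -> qt 3 f1 /\ gq 3 f1 -> qt 3 h0 /\ gq 3 h0 ->
    qt 3 h1 /\ gq 3 h1 -> qt 3 (cr f0 f1 h0 h1) /\ gq 3 (cr f0 f1 h0 h1).
  by move=> ? ? ? ?; apply: gadd; [exact: gmul|apply: gopp; exact: gmul].
have b_be := gadd _ _ (gmul _ _ (gopp _ (bc 1 0%N isT)) (bg 0 2 isT)) (gmul _ _ (bc 0 0%N isT) (bg 1 2 isT)).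
have b_al := gadd _ _ (gmul _ _ (gopp _ (bc 1 1%N isT)) (bg 0 1%N isT)) (gmul _ _ (bc 0 1%N isT) (bg 1 1%N isT)).
have b_cr := cr_ok _ _ _ _ (bc 0 0%N isT) (bc 1 0%N isT) (bg 0 0%N isT) (bg 1 0%N isT).
have b_cr' := cr_ok _ _ _ _ (bg 0 1%N isT) (bg 1 1%N isT) (bg 0 0%N isT) (bg 1 0%N isT).
exact: (gadd _ _ (gmul _ _ b_be b_cr) (gopp _ (gmul _ _ (gmul _ _ b_al bl) b_cr'))).
Qed.

(** For the infinitely many curve generators, the gradient is the next generator times the gradient
    of [tau] or [sigma]. Five fixed gradients therefore determine constants valid for all
    generators. *)
Lemma gen_gradients : exists C d, [/\ 0 <= C, 0 <= d & forall i, ok (ogen i).+1 -> exists F0 F1,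
  [/\ pol (ogen i).+1 (wgen i + d) (C * wgen i * kgen i) F0,
      pol (ogen i).+1 (wgen i + d) (C * wgen i * kgen i) F1 & gradient A (Ygen i) F0 F1]].
Proof.
have aux (a1 a2 a3 a4 a5 e : R) : 0 <= a1 -> 0 <= a2 -> 0 <= a3 -> 0 <= a4 -> 0 <= a5 -> 0 <= e ->
    let N := a1 + a2 + a3 + a4 + a5 + e in
    [/\ e + a1 <= N, e + a2 <= N, a3 <= N, a4 <= N & a5 <= N].
  by move=> h1 h2 h3 h4 h5 h6 N; rewrite /N; split; lra.
have H (P : Prop) m f : (P -> gq m f) -> exists N B, [/\ 0 <= N, 0 <= B &
    P -> exists F0 F1, [/\ pol m N B F0, pol m N B F1 & gradient A f F0 F1]].
  move=> Pg; have [p|np] := pselect P; last by exists 0, 0.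
  have [F0 [F1 [[N [B p0]] [N' [B' p1]] gf]]] := Pg p.
  have [N0 B0] := pol_ge0 wgen_ge0 kgen_ge0 p0.
  have [N0' B0'] := pol_ge0 wgen_ge0 kgen_ge0 p1.
  exists (N + N'), (B + B'); split; [exact: addr_ge0|exact: addr_ge0|move=> _].
  by exists F0, F1; split=> //; [apply: pol_le p0|apply: pol_le p1]; rewrite ?lerDl ?lerDr.
have [N1 [B1 [N10 B10 H1]]] := H True 2 _ (fun _ => gq_tau).
have [N2 [B2 [N20 B20 H2]]] := H True 2 _ (fun _ => gq_sigma).
have [N3 [B3 [N30 B30 H3]]] := H True 1 _ (fun _ => gq_lam).
have [N4 [B4 [N40 B40 H4]]] := H _ 2 _ gq_GE.
have [N5 [B5 [N50 B50 H5]]] := H _ 3 _ gq_GJ.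
(* The summand 1 pays for the weight gained when a curve generator is replaced by the next one. *)
pose N := N1 + N2 + N3 + N4 + N5 + 1; pose B := B1 + B2 + B3 + B4 + B5.
have [NA NB NC ND NE] := aux _ _ _ _ _ _ N10 N20 N30 N40 N50 (ler01 : 0 <= (1 : R)).
have [BA BB BC BD BE] := aux _ _ _ _ _ _ B10 B20 B30 B40 B50 (lexx 0 : 0 <= (0 : R)).
rewrite -/N in NA NB NC ND NE; rewrite /= addr0 -/B !add0r in BA BB BC BD BE.
have B0 : 0 <= B by rewrite !addr_ge0.
have BL : 0 <= B / L by rewrite divr_ge0 // ltW.
have C0 : 0 <= rho * B + B / L by rewrite addr_ge0 // mulr_ge0.
(* The term [rho * B] serves the curve generators, and [B / L] the three generators of weight 1 and
   bound [L]. *)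
exists (rho * B + B / L), N; split=> //; first by rewrite !addr_ge0.
have LE (b : R) : b <= B -> b <= (rho * B + B / L) * 1 * L.
  move=> bB; rewrite mulr1 mulrDl divfK ?gt_eqF //; apply: le_trans bB _.
  by rewrite lerDr !mulr_ge0 // ltW.
case=> [j l|j l| | |] /= oki.
- have [F0 [F1 [p0 p1 gf]]] := H1 I.
  have okl : ok l.+2 by [].
  have E (b : R) : 0 <= b -> b <= B -> M * rho ^+ l.+2 * (l.+2)`!%:R * b <=
      (rho * B + B / L) * l.+2%:R * (M * rho ^+ l.+1 * (l.+1)`!%:R).
    move=> b0 bB; rewrite exprS (factS l.+1) natrM.
    set P := rho ^+ l.+1; set Q := (l.+1)`!%:R; set S := l.+2%:R.
    have -> : M * (rho * P) * (S * Q) * b = rho * b * (S * (M * P * Q)) by ring.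
    have -> : (rho * B + B / L) * S * (M * P * Q) = (rho * B + B / L) * (S * (M * P * Q)) by ring.
    apply: ler_wpM2r; first by rewrite !mulr_ge0 ?exprn_ge0.
    by apply: le_trans (_ : rho * B <= _); [exact: ler_wpM2l|rewrite lerDl].
  have mk F : pol 2 N1 B1 F -> pol l.+2 (l.+2%:R + N)
      ((rho * B + B / L) * l.+2%:R * (M * rho ^+ l.+1 * (l.+1)`!%:R))
      (fun a => Ygen (Gc j l.+1) a * F a).
    move=> pF; apply: pol_le (leqnn _) _ _ (pol_mul (pol_gen _ _ _ _ _ (Gc j l.+1)) (pol_le (_ : (2 <= l.+2)%N) (lexx _) (lexx _) pF)) => //.
      by rewrite /= -[l.+3%:R]natr1 -addrA lerD2l.
    exact: E.
  exists (fun a => Ygen (Gc j l.+1) a * F0 a), (fun a => Ygen (Gc j l.+1) a * F1 a).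
  split; [exact: mk|exact: mk|move=> a v Aa].
  have h := is_derive_comp1 (gf a v Aa) (is_derive_coord j (cd okl Aa)).
  by apply: is_derive_eq h _; rewrite /=; ring.
- have [F0 [F1 [p0 p1 gf]]] := H2 I.
  have okl : ok l.+1 by apply: okle oki; rewrite ltnS leq_maxl.
  have E (b : R) : 0 <= b -> b <= B -> M * rho ^+ l.+1 * (l.+1)`!%:R * b <=
      (rho * B + B / L) * l.+1%:R * (M * rho ^+ l * (l`!)%:R).
    move=> b0 bB; rewrite exprS factS natrM.
    set P := rho ^+ l; set Q := (l`!)%:R; set S := l.+1%:R.
    have -> : M * (rho * P) * (S * Q) * b = rho * b * (S * (M * P * Q)) by ring.
    have -> : (rho * B + B / L) * S * (M * P * Q) = (rho * B + B / L) * (S * (M * P * Q)) by ring.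
    apply: ler_wpM2r; first by rewrite !mulr_ge0 ?exprn_ge0.
    by apply: le_trans (_ : rho * B <= _); [exact: ler_wpM2l|rewrite lerDl].
  have mk F : pol 2 N2 B2 F -> pol (maxn l 1).+1 (l.+1%:R + N)
      ((rho * B + B / L) * l.+1%:R * (M * rho ^+ l * (l`!)%:R))
      (fun a => Ygen (Gg j l.+1) a * F a).
    move=> pF; have o1 : (ogen (Gg j l.+1) <= (maxn l 1).+1)%N.
      by rewrite /= geq_max ltnS leq_maxl.
    have o2 : (2 <= (maxn l 1).+1)%N by rewrite ltnS leq_maxr.
    apply: pol_le (leqnn _) _ _ (pol_mul (pol_le o1 (lexx _) (lexx _) (pol_gen _ _ _ _ _ (Gg j l.+1))) (pol_le o2 (lexx _) (lexx _) pF)) => //.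
      by rewrite /= -[l.+2%:R]natr1 -addrA lerD2l.
    exact: E.
  exists (fun a => Ygen (Gg j l.+1) a * F0 a), (fun a => Ygen (Gg j l.+1) a * F1 a).
  split; [exact: mk|exact: mk|move=> a v Aa].
  have h := is_derive_comp1 (gf a v Aa) (is_derive_coord j (gd okl Aa)).
  by apply: is_derive_eq h _; rewrite /=; ring.
- have [F0 [F1 [p0 p1 gf]]] := H3 I; exists F0, F1; split=> //;
    [apply: pol_le p0|apply: pol_le p1]; rewrite ?LE // (le_trans NC) // lerDr ler01 //.
- have [F0 [F1 [p0 p1 gf]]] := H4 oki; exists F0, F1; split=> //;
    [apply: pol_le p0|apply: pol_le p1]; rewrite ?LE // (le_trans ND) // lerDr ler01 //.
- have [F0 [F1 [p0 p1 gf]]] := H5 oki; exists F0, F1; split=> //;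
    [apply: pol_le p0|apply: pol_le p1]; rewrite ?LE // (le_trans NE) // lerDr ler01 //.
Qed.

End Generators.

(** * Factorial bounds and convergence of Taylor series *)

Section PowerSeries.
Variable R : realType.
Implicit Types (a : nat -> R) (q M z : R).

Lemma fact_add_le n l : ((n + l)`! <= 2 ^ (n + l) * (n`! * l`!))%N.
Proof.
rewrite -(bin_fact (leq_addr l n)) addKn leq_mul2r.
suff -> : ('C(n + l, n) <= 2 ^ (n + l))%N by rewrite orbT.
rewrite -[2%N]/(1 + 1)%N expnDn.
have h : (n < (n + l).+1)%N by rewrite ltnS leq_addr.
by rewrite (bigD1 (Ordinal h)) //= !exp1n !muln1 leq_addr.
Qed.

Lemma iter_diffs a l n : (n`!)%:R * iter l (@pseries_diffs R) a n = ((n + l)`!)%:R * a (n + l)%N.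
Proof.
elim: l n => [|l IH] n; first by rewrite addn0.
rewrite iterS /pseries_diffs mulrA -natrM mulnC -factS.
by have := IH n.+1; rewrite addSnnS.
Qed.

(** The l-th derived series has coefficients (n + l)! / n! times a(n + l). The binomial bound turns
    the quotient into l! at the price of doubling the ratio [q]. *)
Lemma iter_diffs_le a M q l n : 0 <= M -> 0 <= q -> (forall n, `|a n| <= M * q ^+ n) ->
  `|iter l (@pseries_diffs R) a n| <= M * (2 * q) ^+ l * (l`!)%:R * (2 * q) ^+ n.
Proof.
move=> M0 q0 aM.
have f0 : 0 < (n`!)%:R :> R by rewrite ltr0n fact_gt0.
rewrite -(ler_pM2l f0) -{1}(gtr0_norm f0) -normrM iter_diffs normrM ger0_norm ?ler0n //.
apply: (@le_trans _ _ ((2 ^ (n + l) * (n`! * l`!))%:R * (M * q ^+ (n + l)))).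
  by apply: ler_pM => //; rewrite ler_nat fact_add_le.
rewrite !natrM natrX !exprMn !exprD le_eqVlt; apply/orP; left; apply/eqP; ring.
Qed.

(** Comparison with a geometric series of ratio at most 1/2, whose sum is at most twice its first
    term. *)
Lemma pseries_geometric a B q z : 0 <= B -> 0 <= q -> (forall n, `|a n| <= B * q ^+ n) ->
  q * `|z| <= 1 / 2 -> cvgn (pseries a z) /\ `|limn (pseries a z)| <= 2 * B.
Proof.
move=> B0 q0 aB qz.
have x0 : 0 <= q * `|z| by rewrite mulr_ge0.
have x1 : `|q * `|z| | < 1 by rewrite ger0_norm //; lra.
have tb n : `|a n * z ^+ n| <= geometric B (q * `|z|) n.
  rewrite /geometric /= normrM normrX exprMn mulrA.
  by apply: ler_wpM2r (aB n); rewrite exprn_ge0.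
have cg := is_cvg_geometric_series (a := B) x1.
have cn : cvgn [normed pseries a z].
  by apply: series_le_cvg cg => n; [exact: normr_ge0|rewrite /geometric /= mulr_ge0 ?exprn_ge0|exact: tb].
split; first exact: normed_cvg.
apply: le_trans (lim_series_norm cn) _.
apply: le_trans (lim_series_le cn cg tb) _.
rewrite (cvg_lim _ (cvg_geometric_series (a := B) x1)) //.
rewrite ler_pdivrMr; last by lra.
have := ler_wpM2l B0 qz; lra.
Qed.

Lemma cvg_terms_bounded a z : cvgn (pseries a z) -> exists2 M, 0 <= M & forall n, `|a n * z ^+ n| <= M.
Proof.
move=> /cvg_series_bounded [K [Kr Kf]]; exists `|K + 1|; first exact: normr_ge0.
by move=> n; apply: Kf => //; rewrite (lt_le_trans _ (ler_norm _)) // ltrDl.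
Qed.

End PowerSeries.

Section AnalyticCurve.
Variables (R : realType) (A : set R) (f : R -> 'rV[R]_2).
Hypothesis oA : open A.
Hypothesis sm : forall k, Ck k A f.

Lemma iterD_curve n (h b : R) : A b -> Defs.iterD f (nseq n h) b = h ^+ n *: drv f n b.
Proof.
elim: n b => [|n IH] b Ab /=; first by rewrite expr0 scale1r.
have H : is_derive b h (fun z => h ^+ n *: drv f n z) (h ^+ n *: (h *: drv f n.+1 b)).
  have d1 := Ck_is_derive (@sm n.+1) (ltnSn n) Ab.
  have := is_deriveZv h d1; rewrite [h *: 1]mulr1 => d2.
  exact: (is_deriveZ (h ^+ n) d2).
have := near_is_derive (conj oA Ab) (fun z Az => esym (IH z Az)) H.
by move=> [_ ->]; rewrite scalerA exprSr.
Qed.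

Lemma analytic_bounds a : A a -> taylor_converges A f ->
  exists d M rho : R, [/\ 0 < d, 0 <= M, 0 <= rho &
    forall b, `|b - a| < d -> forall l j, `|drv f l b 0 j| <= M * rho ^+ l * (l`!)%:R].
Proof.
move=> Aa /(_ a Aa) /nbhs_ballN[e e0 eP].
have /nbhs_ballN[e' e'0 eA] := open_nbhs_nbhs (conj oA Aa).
pose co j n := drv f n a 0 j / (n`!)%:R.
have cvg_co j h : `|h| < e -> pseries (co j) h @ \oo --> f (a + h) 0 j.
  move=> he; have := eP h; rewrite subr0 => /(_ he) /(cvg_coord (j := j)).
  apply: cvg_trans; apply: near_eq_cvg; near=> n.
  rewrite /pseries /series /= big_mkord summxE; apply: eq_bigr => i _.
  by rewrite iterD_curve // !mxE /co; field; rewrite pnatr_eq0 -lt0n fact_gt0.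
(* The series converges at [h0], so its terms are bounded there; this gives coefficients of growth
   [q = 1 / h0]. *)
pose h0 := e / 2; have h00 : 0 < h0 by rewrite divr_gt0.
have h0e : `|h0| < e by rewrite gtr0_norm // ltr_pdivrMr // ltr_pMr // ltr1n.
pose q := h0^-1; have q0 : 0 < q by rewrite invr_gt0.
have coM j : exists2 M, 0 <= M & forall n, `|co j n| <= M * q ^+ n.
  have [|M M0 MP] := @cvg_terms_bounded R (co j) h0.
    by apply/cvg_ex; exists (f (a + h0) 0 j); exact: cvg_co.
  exists M => // n; have := MP n; rewrite normrM normrX (gtr0_norm h00) /q exprVn.
  by rewrite ler_pdivlMr // exprn_gt0.
have [M1 M10 M1P] := coM 0; have [M2 M20 M2P] := coM 1.
pose M := M1 + M2; have M0 : 0 <= M by rewrite addr_ge0.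
have MP j n : `|co j n| <= M * q ^+ n.
  case: (ord2P j) => ->; [apply: le_trans (M1P n) _|apply: le_trans (M2P n) _];
  by apply: ler_wpM2r; rewrite ?exprn_ge0 ?(ltW q0) // ?lerDl ?lerDr.
have IB j l n := iter_diffs_le l n M0 (ltW q0) (MP j).
(* Differentiation doubles the ratio to [2 * q]; at radius [K] the geometric ratio is then 1/2 for
   every derived series. *)
pose K := (4 * q)^-1; have K0 : 0 < K by rewrite invr_gt0 mulr_gt0.
have qK : 2 * q * K = 1 / 2 by rewrite /K; field; rewrite gt_eqF.
have Bp l : 0 <= M * (2 * q) ^+ l * (l`!)%:R by rewrite !mulr_ge0 // exprn_ge0 // mulr_ge0 // ltW.
have q20 : 0 <= 2 * q by rewrite mulr_ge0 // ltW.
have cK j l : cvgn (pseries (iter l (@pseries_diffs R) (co j)) K).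
  have qz : 2 * q * `|K| <= 1 / 2 by rewrite (gtr0_norm K0) qK.
  by have [] := pseries_geometric (Bp l) q20 (IB j l) qz.
pose r := Num.min (Num.min e e') K.
have r0 : 0 < r by rewrite !lt_min e0 e'0.
(* By induction on [l]: both sides have the same derivative, since they agree on a neighbourhood. *)
have E j l h : `|h| < r -> drv f l (a + h) 0 j = limn (pseries (iter l (@pseries_diffs R) (co j)) h).
  elim: l h => [|l IH] h; rewrite !lt_min => /andP[/andP[h1 h2] h3].
    by rewrite (cvg_lim _ (cvg_co j h h1)).
  have hK : `|h| < `|K| by rewrite (gtr0_norm K0).
  have D1 := pseries_snd_diffs (cK j l) (cK j l.+1) (cK j l.+2) hK.
  have Ah : A (a + h) by apply: eA; rewrite addrAC subrr add0r.
  have D2 := is_derive_coord j (Ck_is_derive (@sm l.+1) (ltnSn l) Ah).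
  have D3 : is_derive h 1 (fun z => drv f l (a + z) 0 j) (drv f l.+1 (a + h) 0 j).
    apply/is_derive_epsP => ep ep0; have [d d0 dP] := (is_derive_epsP _ _ _ _).1 D2 ep ep0.
    by exists d => // z /dP; rewrite addrA.
  have op : open_nbhs h [set z : R | `|z| < r].
    split; last by rewrite /= !lt_min h1 h2.
    have -> : [set z : R | `|z| < r] = ball_ (fun x => `|x|) 0 r.
      by apply/seteqP; split=> z /=; rewrite sub0r normrN.
    by rewrite ball_normE; exact: ball_open.
  by apply: is_derive_unique D3 _; apply: near_is_derive op _ D1 => z /IH ->.
exists r, (2 * M), (2 * q); split=> //; first by rewrite mulr_ge0.
move=> b br l j; have -> : b = a + (b - a) by rewrite addrC subrK.
rewrite (E j l _ br); have := pseries_geometric (z := b - a) (Bp l) q20 (IB j l).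
have bK : 2 * q * `|b - a| <= 1 / 2.
  by rewrite -qK; apply: ler_wpM2l => //; apply: ltW; move: br; rewrite !lt_min => /andP[].
by move=> /(_ bK) [_]; rewrite !mulrA.
Unshelve. all: by end_near. Qed.

End AnalyticCurve.

Section Taylor.
Variable R : realType.

Lemma derive_ge0_le (G dG : R -> R) (r : R) : 0 <= r <= 1 ->
  (forall u : R, 0 <= u <= 1 -> is_derive u 1 G (dG u)) ->
  (forall u : R, 0 <= u <= 1 -> 0 <= dG u) -> G 0 <= G r.
Proof.
move=> /andP[r0 r1] Gd G0.
have sub u : u \in `[0, r] -> 0 <= u <= 1.
  by rewrite in_itv /= => /andP[-> ur]; exact: le_trans r1.
have [u ur e] : exists2 u, u \in `[0, r] & G r - G 0 = dG u * (r - 0).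
  apply: MVT_segment => // [u ur|]; first by apply/Gd/sub/(subset_itv_oo_cc ur).
  by apply: derivable_within_continuous => u /sub /Gd [].
by rewrite -subr_ge0 e subr0 mulr_ge0 // G0 // sub.
Qed.

Lemma is_derive_pow (j : nat) (k r : R) :
  is_derive r 1 (fun u : R => k * (u ^+ j.+1 / (j.+1)`!%:R)) (k * (r ^+ j / (j`!)%:R)).
Proof.
have h := is_deriveZ (k / (j.+1)`!%:R) (is_deriveX j.+1 (is_derive_id r (1 : R))).
have e : (fun u : R => k * (u ^+ j.+1 / (j.+1)`!%:R)) = (k / (j.+1)`!%:R) \*: (@id R ^+ j.+1).
  by apply/funext => u; rewrite exprfctE /GRing.scale /= mulrA mulrAC.
rewrite e; apply: is_derive_eq h _.
rewrite /GRing.scale /= mulr1 factS natrM; field.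
by rewrite nat1r !pnatr_eq0 -lt0n fact_gt0.
Qed.

(** The remainder of order n + 1 vanishes at 0 and its derivative is the remainder of [phi 1]. By
    induction this is dominated by the derivative of the claimed bound, and monotonicity of the two
    sums concludes. *)
Lemma taylor_remainder n (phi : nat -> R -> R) (B : R) :
  (forall j (u : R), (j < n)%N -> 0 <= u <= 1 -> is_derive u 1 (phi j) (phi j.+1 u)) ->
  (forall u : R, 0 <= u <= 1 -> `|phi n u| <= B) ->
  forall r, 0 <= r <= 1 ->
  `|phi 0%N r - \sum_(j < n) phi j 0 * (r ^+ j / (j`!)%:R)| <= B * (r ^+ n / (n`!)%:R).
Proof.
elim: n phi => [|n IH] phi dphi Bphi r r01.
  by rewrite big_ord0 subr0 expr0 fact0 divr1 mulr1; exact: Bphi.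
pose S u := \sum_(j < n) phi j.+1 0 * (u ^+ j / (j`!)%:R).
pose F u := phi 0%N u - (phi 0%N 0 + \sum_(j < n) phi j.+1 0 * (u ^+ j.+1 / (j.+1)`!%:R)).
have FE u : phi 0%N u - \sum_(j < n.+1) phi j 0 * (u ^+ j / (j`!)%:R) = F u.
  by rewrite /F big_ord_recl /= expr0 fact0 divr1 mulr1.
have F0 : F 0 = 0.
  rewrite /F big1 ?addr0 ?subrr // => j _.
  by rewrite expr0n /= mul0r mulr0.
have dF (u : R) : 0 <= u <= 1 -> is_derive u 1 F (phi 1%N u - S u).
  move=> u01.
  have h1 : is_derive u 1 (fun z => \sum_(j < n) phi j.+1 0 * (z ^+ j.+1 / (j.+1)`!%:R)) (S u).
    have -> : (fun z : R => \sum_(j < n) phi j.+1 0 * (z ^+ j.+1 / (j.+1)`!%:R)) =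
        \sum_(j < n) (fun z : R => phi j.+1 0 * (z ^+ j.+1 / (j.+1)`!%:R)).
      by apply/funext => z; rewrite fct_sumE.
    by apply: is_derive_sum => j; exact: is_derive_pow.
  have h2 := is_deriveB (dphi 0%N u isT u01) (is_deriveD (is_derive_cst (phi 0%N 0) u (1:R)) h1).
  by apply: is_derive_eq h2 _; rewrite add0r.
have dS (u : R) : 0 <= u <= 1 -> `|phi 1%N u - S u| <= B * (u ^+ n / (n`!)%:R).
  apply: (IH (fun j => phi j.+1)); last exact: Bphi.
  by move=> j w jn; apply: dphi.
have dP u := is_derive_pow n B u.
rewrite FE ler_norml; apply/andP; split.
  have := @derive_ge0_le (fun u => F u + B * (u ^+ n.+1 / (n.+1)`!%:R))
    (fun u => phi 1%N u - S u + B * (u ^+ n / (n`!)%:R)) r r01.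
  rewrite F0 expr0n /= mul0r mulr0 addr0 -subr_ge0 subr0 -lerBlDr sub0r; apply.
    by move=> u u01; exact: (is_deriveD (dF u u01) (dP u)).
  by move=> u /dS; rewrite ler_norml => /andP[h _]; rewrite -lerBlDr sub0r.
have := @derive_ge0_le (fun u => B * (u ^+ n.+1 / (n.+1)`!%:R) - F u)
  (fun u => B * (u ^+ n / (n`!)%:R) - (phi 1%N u - S u)) r r01.
rewrite F0 expr0n /= mul0r mulr0 subr0 subr_ge0; apply.
  by move=> u u01; exact: (is_deriveB (dP u) (dF u u01)).
by move=> u /dS; rewrite ler_norml subr_ge0 => /andP[_].
Qed.

(** The n! of the derivative bound cancels that of the Taylor remainder, leaving a geometric
    sequence. *)
Lemma taylor_converges_bounds (A : set 'rV[R]_2) (f : 'rV[R]_2 -> R) : open A ->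
  (forall k, Ck k A f) ->
  (forall a, A a -> exists d B q : R, [/\ 0 < d, 0 <= B, 0 <= q &
    forall b v n, `|b - a| < d -> `|Defs.iterD f (nseq n v) b| <= B * (q * `|v|) ^+ n * (n`!)%:R]) ->
  taylor_converges A f.
Proof.
move=> oA sm bnd a Aa; have [d [B [q [d0 B0 q0 bP]]]] := bnd a Aa.
have /nbhs_ballN[e e0 eA] := open_nbhs_nbhs (conj oA Aa).
(* The radius 1 / (2 (q + 1)) makes the ratio at most 1/2; adding 1 covers [q = 0]. *)
have q1 : 0 < 2 * (q + 1) by rewrite mulr_gt0 // ltr_wpDl.
apply/nbhs_ballN; exists (Num.min (Num.min d e) (2 * (q + 1))^-1).
  by rewrite !lt_min d0 e0 invr_gt0.
move=> h; rewrite subr0 !lt_min => /andP[/andP[hd he] hq].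
have x0 : 0 <= q * `|h| by rewrite mulr_ge0.
have x1 : q * `|h| <= 1 / 2.
  have h1 : `|h| * (2 * (q + 1)) < 1 by rewrite -ltr_pdivlMr // div1r.
  have := normr_ge0 h; lra.
have inb (r : R) : 0 <= r <= 1 -> `|a + r *: h - a| <= `|h|.
  move=> /andP[r0 r1]; rewrite addrAC subrr add0r normrZ ger0_norm //.
  by rewrite -[leRHS]mul1r ler_wpM2r.
pose phi j r := Defs.iterD f (nseq j h) (a + r *: h).
have key n : `|f (a + h) - \sum_(j < n) (j`!%:R)^-1 *: Defs.iterD f (nseq j h) a| <= B * (q * `|h|) ^+ n.
  have H := @taylor_remainder n phi (B * (q * `|h|) ^+ n * (n`!)%:R) _ _ 1 _.
  have {}H := H _ _ _.
  have -> : f (a + h) = phi 0%N 1 by rewrite /phi scale1r.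
  have -> : \sum_(j < n) (j`!%:R)^-1 *: Defs.iterD f (nseq j h) a =
      \sum_(j < n) phi j 0 * (1 ^+ j / (j`!)%:R).
    by apply: eq_bigr => j _; rewrite /phi scale0r addr0 expr1n div1r mulrC.
  apply: le_trans (H _ _ _) _.
  - move=> j u jn u01; have Au : A (a + u *: h) by apply: eA; apply: le_lt_trans (inb u u01) he.
    have [||_ /(_ _ h) dj] := (@sm j.+1) (nseq j h) (a + u *: h); rewrite ?size_nseq //.
    have sz : (size (nseq j h) < j.+1)%N by rewrite size_nseq.
    have /is_derive_epsP H1 := derivableP (dj sz).
    apply/is_derive_epsP => ep ep0; have [d' d'0 dP] := H1 ep ep0; exists d' => // z /dP.
    by rewrite /phi [z *: 1]mulr1 scalerDl addrA.
  - by move=> u u01; apply: bP; apply: le_lt_trans (inb u u01) hd.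
  - by rewrite ler01 lexx.
  - rewrite expr1n div1r -mulrA divff ?mulr1 // pnatr_eq0 -lt0n fact_gt0 //.
apply/cvgrPdist_le => ep ep0.
have g0 : (fun n => B * (q * `|h|) ^+ n) @ \oo --> (0 : R).
  have -> : (0 : R) = B * 0 by rewrite mulr0.
  by apply: cvgM; [exact: cvg_cst|apply: cvg_expr; rewrite ger0_norm //; lra].
move/cvgrPdist_le : g0 => /(_ ep ep0) g0.
near=> n; apply: le_trans (key n) _.
have : `|0 - B * (q * `|h|) ^+ n| <= ep by near: n.
by rewrite sub0r normrN; apply: le_trans; exact: ler_norm.
Unshelve. all: by end_near. Qed.

End Taylor.

(** * From the regularity of the curves to that of the distance *)

Section CurveRegularity.
Variables (R : realType) (B : set R) (f : R -> 'rV[R]_2).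
Hypothesis oB : open B.

Lemma Ck_near_derive k l (b : R) : Ck k B f -> (l < k)%N -> B b ->
  \forall u \near b, is_derive (u : R) 1 (drv f l) (drv f l.+1 u).
Proof.
move=> Ckf lk Bb; have : nbhs b B by exact: open_nbhs_nbhs.
by apply: filterS => u; exact: (Ck_is_derive Ckf lk).
Qed.

(** The hypothesis concerns the top order only; lower derivatives are continuously differentiable,
    hence locally Lipschitz. *)
Lemma curve_holder k l al (j : 'I_2) (r : R) : 0 <= al <= 1 -> Ck k B f ->
  locally_Holder al B (drv f k) -> (l <= k)%N -> B r ->
  exists C : R, \forall u \near r & w \near r,
    `|drv f l u 0 j - drv f l w 0 j| <= C * `|u - w| `^ al.
Proof.
move=> al01 Ckf hf; have cl (u : 'rV[R]_2) : `|u 0 j| <= `|u|.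
  by rewrite norm2E le_max; case: (ord2P j) => ->; rewrite lexx ?orbT.
rewrite leq_eqVlt => /orP[/eqP -> Br|lk Br].
  have [C /near_pairP[d d0 dP]] := hf r Br; exists C; apply/near_pairP; exists d => // u w ur wr.
  by apply: le_trans (dP u w ur wr); have := cl (drv f k u - drv f k w); rewrite !mxE.
have /nbhs_ballN[d d0 dP] := Ck_near_derive Ckf lk Br.
have [e e0 eP] := (continuous_epsP _ _).1 (Ck_drv Ckf lk Br) 1 ltr01.
pose C := `|drv f l.+1 r| + 1.
exists C; apply/near_pairP; exists (Num.min (Num.min d e) (1 / 2)).
  by rewrite !lt_min d0 e0 divr_gt0.
move=> u w hu hw.
have fd z : `|z - r| < Num.min (Num.min d e) (1 / 2) ->
    is_derive z 1 (fun z => drv f l z 0 j) (drv f l.+1 z 0 j).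
  by rewrite !lt_min => /andP[/andP[/dP h _] _]; exact: is_derive_coord.
have [z zr ->] := MVT_ball fd hu hw.
rewrite normrM; apply: ler_pM => //.
  apply: le_trans (cl _) _; move: zr; rewrite !lt_min => /andP[/andP[_ /eP h] _].
  have -> : drv f l.+1 z = drv f l.+1 r + (drv f l.+1 z - drv f l.+1 r) by rewrite addrC subrK.
  by apply: le_trans (ler_normD _ _) _; rewrite lerD2l ltW.
move: hu hw; rewrite !lt_min => /andP[_ hu] /andP[_ hw].
have h1 : `|u - w| <= 1.
  have -> : u - w = (u - r) - (w - r) by ring.
  by apply: le_trans (ler_normB _ _) _; lra.
have [->|uw0] := eqVneq `|u - w| 0; first exact: powR_ge0.
apply: ger1_powR; last by case/andP: al01.
by rewrite h1 andbT lt_neqAle eq_sym uw0 normr_ge0.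
Qed.

(** Continuity bounds the oscillation near each point, which is all that exponent 0 asks. It lets
    the smooth case use the Hoelder one. *)
Lemma curve_holder0 k : Ck k B f -> locally_Holder 0 B (drv f k).
Proof.
move=> Ckf a Ba; have [e e0 eP] := (continuous_epsP _ _).1 (Ck_drv Ckf (leqnn k) Ba) 1 ltr01.
exists 2; apply/near_pairP; exists e => // u w /eP hu /eP hw; rewrite powRr0 mulr1.
have -> : drv f k u - drv f k w = (drv f k u - drv f k a) - (drv f k w - drv f k a).
  by rewrite opprB addrA subrK.
by apply: le_trans (ler_normB _ _) _; lra.
Qed.

Lemma curve_bounded k (t d : R) : Ck k B f -> (forall b, `|b - t| <= d -> B b) -> 0 < d ->
  exists2 M : R, 0 <= M & forall l b j, (l <= k)%N -> `|b - t| <= d -> `|drv f l b 0 j| <= M.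
Proof.
move=> Ckf dB d0.
have cl (u : 'rV[R]_2) j : `|u 0 j| <= `|u|.
  by rewrite norm2E le_max; case: (ord2P j) => ->; rewrite lexx ?orbT.
have dI b : (b \in `[t - d, t + d]) = (`|b - t| <= d).
  by rewrite in_itv /= ler_norml; apply/idP/idP => /andP[? ?]; apply/andP; split; lra.
have one l : (l <= k)%N -> exists2 M : R, 0 <= M & forall b, `|b - t| <= d -> `|drv f l b| <= M.
  move=> lk.
  have cw : {within `[t - d, t + d], continuous (fun b => `|drv f l b|)}.
    apply: continuous_in_subspaceT => b /set_mem /=; rewrite dI => /dB Bb.
    exact: (cvg_norm (Ck_drv Ckf lk Bb)).
  have [|m mI mP] := EVT_max _ cw; first by lra.
  by exists `|drv f l m| => // b; rewrite -dI => /mP.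
have H n : (n <= k)%N -> exists2 M : R, 0 <= M & forall l b j, (l <= n)%N -> `|b - t| <= d -> `|drv f l b 0 j| <= M.
  elim: n => [|n IH] nk.
    have [M M0 MP] := one 0%N (leq0n k); exists M => // l b j; rewrite leqn0 => /eqP -> /MP.
    exact: le_trans (cl _ _).
  have [M M0 MP] := IH (ltnW nk); have [M' M'0 MP'] := one n.+1 nk.
  exists (M + M'); first exact: addr_ge0.
  move=> l b j; rewrite leq_eqVlt ltnS => /orP[/eqP -> /MP' h|ln bd].
    by apply: le_trans (cl _ _) (le_trans h _); rewrite lerDr.
  by apply: le_trans (MP l b j ln bd) _; rewrite lerDl.
exact: H.
Qed.

End CurveRegularity.

Lemma jac0E (R : realType) (c1 c2 g g1 g2 : R -> 'rV[R]_2) (t s l : R) :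
  jac0 c1 c2 g g1 g2 t s l =
  (- c1 t 0 1 * g2 s 0 0 + c1 t 0 0 * g2 s 0 1) * (c1 t 0 0 * g s 0 1 + - c1 t 0 1 * g s 0 0)
  + - ((- c2 t 0 1 * g1 s 0 0 + c2 t 0 0 * g1 s 0 1) * l)
    * (g1 s 0 0 * g s 0 1 + - g1 s 0 1 * g s 0 0).
Proof.
rewrite /jac0 /jac /alpha0 /beta0.
move: (c1 t) (c2 t) (g s) (g1 s) (g2 s) => u v w p q.
by rewrite !dotE !perp0 !perp1 /cross; ring.
Qed.

Section SolutionRegularity.
Variables (R : realType) (B : set R) (c g : R -> 'rV[R]_2).
Variables (A : set 'rV[R]_2) (tau sigma lam : 'rV[R]_2 -> R) (t s d L C : R).
Hypothesis oB : open B.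
Hypothesis oA : open A.
Hypothesis d0 : 0 < d.
Hypothesis L0 : 0 < L.
Hypothesis dB : forall b, `|b - t| <= d -> B b.
Hypothesis hA : forall a, A a -> [/\ `|tau a - t| <= d, `|sigma a - s| <= d, `|lam a| <= L,
  L^-1 <= `|mu_at c g tau sigma a| & L^-1 <= `|jac_at c g tau sigma lam a|].
Hypothesis hLip : forall u w, A u -> A w -> [/\ `|tau u - tau w| <= C * `|u - w|,
  `|sigma u - sigma w| <= C * `|u - w| & `|lam u - lam w| <= C * `|u - w|].
Hypothesis hsol : forall a, A a -> solves c (drv c 1) g (drv g 1) a (tau a) (sigma a) (lam a).

Let Li0 : 0 < L^-1. Proof. by rewrite invr_gt0. Qed.
Let mu0 a : A a -> mu_at c g tau sigma a != 0.
Proof. by move=> /hA[_ _ _ h _]; rewrite -normr_gt0; exact: lt_le_trans h. Qed.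
Let jac0' a : A a -> jac_at c g tau sigma lam a != 0.
Proof. by move=> /hA[_ _ _ _ h]; rewrite -normr_gt0; exact: lt_le_trans h. Qed.

Lemma solution_derivatives a v : Ck 2 B c -> Ck 2 setT g -> A a ->
  [/\ is_derive a v tau (beta0 (drv c 1) (drv g 2) (tau a) (sigma a) * cross v (g (sigma a)) / jac_at c g tau sigma lam a),
      is_derive a v sigma (- alpha0 (drv c 2) (drv g 1) (tau a) (sigma a) * cross v (g (sigma a)) / jac_at c g tau sigma lam a) &
      is_derive a v lam (dot (perp (drv c 1 (tau a))) v / mu_at c g tau sigma a)].
Proof.
move=> C2c C2g Aa; have Ba : B (tau a) by apply: dB; have [] := hA Aa.
have al01 : (0 : R) <= (0 : R) <= (1 : R) by apply/andP; split; lra.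
apply: (solution_derive (c := c) (c1 := drv c 1) (c2 := drv c 2) (g := g) (g1 := drv g 1) (g2 := drv g 2)).
- exact: (Ck_near_derive oB C2c (l := 0)).
- exact: (Ck_near_derive oB C2c (l := 1)).
- exact: (Ck_drv C2c).
- exact: (Ck_near_derive openT C2g (l := 0)).
- exact: (Ck_near_derive openT C2g (l := 1)).
- exact: (Ck_drv C2g).
- exact: jac0'.
- exact: mu0.
- have H u w (Au : A u) (Aw : A w) : `|tau u - tau w| <= C * `|u - w| by have [] := hLip Au Aw.
  by have [+ _] := holder_lipschitz al01 oA H; apply.
- have H u w (Au : A u) (Aw : A w) : `|sigma u - sigma w| <= C * `|u - w| by have [] := hLip Au Aw.
  by have [+ _] := holder_lipschitz al01 oA H; apply.
- have H u w (Au : A u) (Aw : A w) : `|lam u - lam w| <= C * `|u - w| by have [] := hLip Au Aw.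
  by have [+ _] := holder_lipschitz al01 oA H; apply.
- have : nbhs a A by exact: open_nbhs_nbhs.
  by apply: filterS => z; exact: hsol.
Qed.

(** The distance is the generator [Gl], of order 0. Every generator of order at most k is Hoelder: a
    derivative of a curve composed with a Lipschitz parameter, or the inverse of a combination
    bounded away from 0. *)
Lemma solution_Holder k al : (2 <= k)%N -> 0 <= al <= 1 ->
  Ck k B c -> locally_Holder al B (drv c k) ->
  Ck k setT g -> locally_Holder al setT (drv g k) ->
  Ck k A lam /\ forall vs, size vs = k -> locally_Holder al A (Defs.iterD lam vs).
Proof.
move=> k2 al01 Ckc hc Ckg hg.
have C2c := Ck_le k2 Ckc; have C2g := Ck_le k2 Ckg.
pose ok m := (m <= k)%N.
have okle m m' : (m <= m')%N -> ok m' -> ok m by move=> h1 h2; exact: leq_trans h2.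
have Bt a : A a -> B (tau a) by move=> Aa; apply: dB; have [] := hA Aa.
have [M1 M10 M1P] := curve_bounded Ckc dB d0.
have [M2 M20 M2P] := curve_bounded (t := s) Ckg (fun _ _ => I) d0.
have M0 : 0 <= M1 + M2 by rewrite addr_ge0.
have [||C' [d' [C'0 d'0 grads]]] := @gen_gradients R A c g tau sigma lam (M1 + M2) 1 L M0 ler01 L0
  ok okle _ _ mu0 jac0' (fun a v Aa => let: And3 h _ _ := solution_derivatives v C2c C2g Aa in h)
  (fun a v Aa => let: And3 _ h _ := solution_derivatives v C2c C2g Aa in h)
  (fun a v Aa => let: And3 _ _ h := solution_derivatives v C2c C2g Aa in h).
- by move=> l a okl Aa; apply: (Ck_is_derive Ckc) => //; exact: Bt.
- by move=> l a okl Aa; exact: (Ck_is_derive Ckg).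
have Lt u w (Au : A u) (Aw : A w) : `|tau u - tau w| <= C * `|u - w| by have [] := hLip Au Aw.
have Ls u w (Au : A u) (Aw : A w) : `|sigma u - sigma w| <= C * `|u - w| by have [] := hLip Au Aw.
have Ll u w (Au : A u) (Aw : A w) : `|lam u - lam w| <= C * `|u - w| by have [] := hLip Au Aw.
have hGc j l : (l <= k)%N -> cont_holder al A (fun a => drv c l (tau a) 0 j).
  move=> lk; apply: (holder_comp (phi := fun z => drv c l z 0 j) al01 oA Lt).
    by move=> a Aa; apply: cvg_coord; exact: (Ck_drv Ckc lk (Bt _ Aa)).
  by move=> a Aa; apply: (curve_holder oB j al01 Ckc hc lk); exact: Bt.
have hGg j l : (l <= k)%N -> cont_holder al A (fun a => drv g l (sigma a) 0 j).
  move=> lk; apply: (holder_comp (phi := fun z => drv g l z 0 j) al01 oA Ls).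
    by move=> a Aa; apply: cvg_coord; exact: (Ck_drv Ckg lk I).
  by move=> a Aa; exact: (curve_holder openT j al01 Ckg hg lk).
have hl : cont_holder al A lam by exact: holder_lipschitz Ll.
have hneg f : cont_holder al A f -> cont_holder al A (fun a => - f a).
  move=> hf; apply: (holder_ext oA (f := (fun=> -1) \* f)); first by move=> a _ /=; rewrite mulN1r.
  by apply: holderM hf; exact: holder_cst.
have k1 : (1 <= k)%N by exact: ltnW.
have k0 : (0 <= k)%N by [].
have hm f0 f1 h0 h1 : cont_holder al A f0 -> cont_holder al A f1 -> cont_holder al A h0 ->
    cont_holder al A h1 -> cont_holder al A (fun a => f0 a * h0 a + f1 a * h1 a).
  by move=> ? ? ? ?; apply: holderD; exact: holderM.
have hmu : cont_holder al A (mu_at c g tau sigma).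
  have H := hm _ _ _ _ (hneg _ (hGc 1 1%N k1)) (hGc 0 1%N k1) (hGg 0 0%N k0) (hGg 1 0%N k0).
  by apply: (holder_ext oA _ H) => a _; rewrite /mu_at dotE perp0 perp1.
have hbe := hm _ _ _ _ (hneg _ (hGc 1 1%N k1)) (hGc 0 1%N k1) (hGg 0 2 k2) (hGg 1 2 k2).
have hal := hm _ _ _ _ (hneg _ (hGc 1 2 k2)) (hGc 0 2 k2) (hGg 0 1%N k1) (hGg 1 1%N k1).
have hcr1 := hm _ _ _ _ (hGc 0 1%N k1) (hneg _ (hGc 1 1%N k1)) (hGg 1 0%N k0) (hGg 0 0%N k0).
have hcr2 := hm _ _ _ _ (hGg 0 1%N k1) (hneg _ (hGg 1 1%N k1)) (hGg 1 0%N k0) (hGg 0 0%N k0).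
have hJ : cont_holder al A (jac_at c g tau sigma lam).
  have H := hm _ _ _ _ hbe (hneg _ (holderM hal hl)) hcr1 hcr2.
  by apply: (holder_ext oA _ H) => a _; exact/esym/jac0E.
apply: (pol_Ck oA (@wgen_ge0 R) (kgen_ge0 M0 ler01 L0) okle C'0 d'0 grads al01 (leqnn k)).
  move=> [j l|j l| | |] oki; [exact: hGc|apply: hGg|exact: hl| |].
  - by apply: leq_trans oki; exact: leq_maxl.
  - by apply: (holderV oA Li0 _ hmu) => a /hA[].
  - by apply: (holderV oA Li0 _ hJ) => a /hA[].
exact: (pol_gen A (Ygen c g tau sigma lam) ogen (wgen R) (kgen (M1 + M2) 1 L) Gl).
Qed.

Lemma solution_smooth : (forall k, Ck k B c) -> (forall k, Ck k setT g) -> forall k, Ck k A lam.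
Proof.
move=> Ckc Ckg k; have k2 : (2 <= maxn k 2)%N by exact: leq_maxr.
have al01 : (0 : R) <= (0 : R) <= (1 : R) by apply/andP; split; lra.
have [H _] := solution_Holder k2 al01 (Ckc _) (curve_holder0 (Ckc _)) (Ckg _) (curve_holder0 (Ckg _)).
exact: Ck_le (leq_maxl k 2) H.
Qed.

(** With all orders available, [pol_iter] bounds the n-th derivative by a product of n linear
    factors, that is by a geometric term times n!. *)
Lemma solution_analytic (M rho : R) : 0 <= M -> 0 <= rho ->
  (forall k, Ck k B c) -> (forall k, Ck k setT g) ->
  (forall b, `|b - t| <= d -> forall l j, `|drv c l b 0 j| <= M * rho ^+ l * (l`!)%:R) ->
  (forall b, `|b - s| <= d -> forall l j, `|drv g l b 0 j| <= M * rho ^+ l * (l`!)%:R) ->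
  taylor_converges A lam.
Proof.
move=> M0 rho0 Ckc Ckg bc bg.
have Bt a : A a -> B (tau a) by move=> Aa; apply: dB; have [] := hA Aa.
pose ok (m : nat) := True.
have okle m m' : (m <= m')%N -> ok m' -> ok m by [].
have [||C' [d' [C'0 d'0 grads]]] := @gen_gradients R A c g tau sigma lam M rho L M0 rho0 L0
  ok okle _ _ mu0 jac0' (fun a v Aa => let: And3 h _ _ := solution_derivatives v (Ckc _) (Ckg _) Aa in h)
  (fun a v Aa => let: And3 _ h _ := solution_derivatives v (Ckc _) (Ckg _) Aa in h)
  (fun a v Aa => let: And3 _ _ h := solution_derivatives v (Ckc _) (Ckg _) Aa in h).
- by move=> l a okl Aa; apply: (Ck_is_derive (Ckc l.+1)) => //; exact: Bt.
- by move=> l a okl Aa; exact: (Ck_is_derive (Ckg l.+1)).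
apply: taylor_converges_bounds => //; first exact: solution_smooth.
move=> a Aa; have /nbhs_ballN[e e0 eA] := open_nbhs_nbhs (conj oA Aa).
exists e, L, (2 * C' * (1 + d')); split; [exact: e0|exact: ltW|by rewrite !mulr_ge0 // addr_ge0|].
move=> b v n bae; have Ab := eA _ bae.
have pl := pol_gen A (Ygen c g tau sigma lam) ogen (wgen R) (kgen M rho L) Gl.
have [F pF FE] := pol_iter oA (@wgen_ge0 R) (kgen_ge0 M0 rho0 L0) okle C'0 d'0 grads pl (vs := nseq n v) I.
rewrite FE //.
apply: le_trans (pol_bound okle _ pF I Ab) _.
  move=> [j l|j l| | |] u _ Au /=.
  - by apply: bc; have [] := hA Au.
  - by apply: bg; have [] := hA Au.
  - by have [] := hA Au.
  - by have [_ _ _ h _] := hA Au; rewrite normfV -[L]invrK lef_pV2 // posrE ?normr_gt0 ?mu0.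
  - by have [_ _ _ _ h] := hA Au; rewrite normfV -[L]invrK lef_pV2 // posrE ?normr_gt0 ?jac0'.
rewrite /iter_bound size_nseq big_nseq /= -mulrA -mulrA; apply: ler_wpM2l; first exact: ltW.
have -> : iter n ( *%R `|v|) 1 = `|v| ^+ n by elim: n {bae pF FE} => //= m ->; rewrite exprS.
have P0 m : 0 <= \prod_(j < m) (2 * C' * (1 + j%:R * d')).
  by apply: prodr_ge0 => j _; rewrite !mulr_ge0 // addr_ge0 // mulr_ge0.
(* Factor by factor, [1 + j * d' <= (1 + d') * (j + 1)]. *)
have H : \prod_(j < n) (2 * C' * (1 + j%:R * d')) <= (2 * C' * (1 + d')) ^+ n * (n`!)%:R.
  elim: n {bae pF FE} => [|m IH]; first by rewrite big_ord0 expr0 fact0 mulr1.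
  rewrite big_ord_recr /= exprSr factS mulnC natrM.
  have -> : (2 * C' * (1 + d')) ^+ m * (2 * C' * (1 + d')) * ((m`!)%:R * m.+1%:R) =
    ((2 * C' * (1 + d')) ^+ m * (m`!)%:R) * (2 * C' * ((1 + d') * m.+1%:R)) by ring.
  apply: ler_pM; [exact: P0|by rewrite !mulr_ge0 // addr_ge0 // mulr_ge0|exact: IH|].
  apply: ler_wpM2l; first by rewrite mulr_ge0.
  by rewrite -natr1; have : 0 <= (m%:R : R) by []; nra.
have Q0 : 0 <= `|v| ^+ n by exact: exprn_ge0.
apply: le_trans (ler_wpM2r Q0 H) _.
by rewrite [(_ * `|v|) ^+ n]exprMn mulrAC.
Qed.

End SolutionRegularity.

(** * Gradient and Hessian of the polar gauge *)

Section CurvatureFormulas.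
Variable R : realType.
Implicit Types c : R -> 'rV[R]_2.

Lemma is_derive_perp (V : normedModType R) (f : V -> 'rV[R]_2) a v df :
  is_derive a v f df -> is_derive a v (fun b => perp (f b)) (perp df).
Proof.
move=> fd; apply: is_derive_row2.
  have -> : (fun b => perp (f b) 0 0) = - (fun b => f b 0 1).
    by apply/funext => b; rewrite perp0.
  by rewrite perp0; apply: is_deriveN; exact: is_derive_coord.
have -> : (fun b => perp (f b) 0 1) = (fun b => f b 0 0).
  by apply/funext => b; rewrite perp1.
by rewrite perp1; exact: is_derive_coord.
Qed.

Lemma derive1_nu c (t : R) (c2 : 'rV[R]_2) : is_derive t 1 (derive1 c) c2 -> derive1 (nu c) t = perp c2.
Proof. by move=> /is_derive_perp [_ e]; rewrite derive1E. Qed.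

Lemma curvatureE c (t : R) (c2 : 'rV[R]_2) : is_derive t 1 (derive1 c) c2 -> derive1 c t != 0 ->
  curvature c t * enorm (nu c t) ^+ 3 = dot c2 (nu c t).
Proof.
move=> cd c0; rewrite /curvature (derive1_nu cd) divfK.
  by rewrite /nu; move: (derive1 c t) => u; plane.
by rewrite expf_neq0 // gt_eqF // enorm_gt0 perp_neq0.
Qed.

End CurvatureFormulas.

Section Polar.
Variable R : realType.
Variables (s : regularity R) (K : set 'rV[R]_2) (g : R -> 'rV[R]_2).
Hypothesis hs : admissible s.
Hypothesis hK : gauge_body s K g.

Let kK : compact K := gb_compact hK.
Let cK := convex_setP (gb_convex hK).
Let K0 : interior K 0 := gb_zero hK.

Lemma closure_interior_body z : K z -> closure (interior K) z.
Proof.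
move=> Kz B /nbhs_ballN[d d0 dB].
pose r := Num.min 1 (d / (`|z| + 1)).
have z1 : 0 < `|z| + 1 by rewrite ltr_wpDl.
have r0 : 0 < r by rewrite lt_min ltr01 divr_gt0.
have r1 : r <= 1 by rewrite ge_min lexx.
have rd : r * `|z| < d.
  have h : r * (`|z| + 1) <= d by rewrite -ler_pdivlMr // ge_min lexx orbT.
  by apply: lt_le_trans h; rewrite mulrDr mulr1 ltrDl.
exists (z + r *: (0 - z)); split.
  by apply: (interior_convex cK Kz K0); rewrite r0.
apply: dB; rewrite addrAC subrr add0r sub0r normrZ normrN gtr0_norm //.
Qed.

(** By strict convexity the maximum over the points of K at distance at least [e] from [k] is
    strictly smaller. A small change of [u] does not close this gap. *)
Lemma maximizer_continuous u k : u != 0 -> maximizes K u k -> forall e : R, 0 < e ->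
  exists2 d : R, 0 < d & forall w k', `|w - u| < d -> maximizes K w k' -> `|k' - k| < e.
Proof.
move=> u0 km e e0; have [M M0 MK] := K_bounded kK.
pose F := K `&` [set z | e <= `|z - k|].
have [F0|/set0P F0] := eqVneq F set0.
  exists 1 => // w k' _ [Kk' _]; rewrite ltNge; apply/negP => h.
  by have : F k' by []; rewrite F0.
have kF : compact F.
  apply: compact_closedI => //.
  have -> : [set z | e <= `|z - k|] = (fun z => `|z - k|) @^-1` [set t | e <= t] by [].
  apply: closed_comp; last exact: closed_ge.
  move=> z _; apply/continuous_epsP => r r0; exists r => // w wz.
  apply: le_lt_trans wz; apply: le_trans (ler_dist_dist _ _) _.
  by rewrite opprB addrA subrK.
have [z0 /set_mem[Kz0 z0e] zm] := EVT_max_rV F0 kF (continuous_subspaceT (@dot_continuous R u)).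
have eta0 : 0 < dot u k - dot u z0.
  rewrite subr_gt0 lt_neqAle (km.2 _ Kz0) andbT; apply/eqP => h.
  have : maximizes K u z0 by split=> // z Kz; rewrite h; exact: km.2.
  move=> /(maximizes_uniq hK u0 km) kz; move: z0e.
  by rewrite /= kz subrr normr0 leNgt e0.
(* Each of two products changes by at most [2 * M] times the displacement of [u], so their sum stays
   within half of the gap. *)
exists ((dot u k - dot u z0) / (8 * M)); first by rewrite divr_gt0 // mulr_gt0.
move=> w k'; rewrite ltr_pdivlMr ?mulr_gt0 // => hw [Kk' km'].
rewrite ltNge; apply/negP => h.
have Fk' : F k' by [].
have h1 := zm _ (mem_set Fk'); have h2 := km' _ km.1.
have b1 := dot_le (w - u) k; have b2 := dot_le (w - u) k'.
have m1 := ler_wpM2l (normr_ge0 (w - u)) (ltW (MK _ km.1)).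
have m2 := ler_wpM2l (normr_ge0 (w - u)) (ltW (MK _ Kk')).
have w0 := normr_ge0 (w - u).
move: b1 b2; rewrite !dotBl !ler_norml => /andP[b1 b1'] /andP[b2 b2'].
have P0 := mulr_ge0 w0 (ltW M0).
by lra.
Qed.

(** Envelope argument: maximality of [k] and of [k'] places the error between 0 and
    [h * dot v (k' - k)], which is small relative to [h] by continuity of the maximizer. No
    curvature is involved. *)
Lemma derive_polar u k v : u != 0 -> maximizes K u k ->
  is_derive u v (gauge (polar K)) (dot k v).
Proof.
move=> u0 km; apply/is_derive_epsP => e e0.
have v1 : 0 < 2 * (`|v| + 1) by rewrite mulr_gt0 // ltr_wpDl.
have [d d0 dP] := maximizer_continuous u0 km (divr_gt0 e0 v1).
have nu0 : 0 < `|u| by rewrite normr_gt0.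
exists (Num.min d `|u| / (`|v| + 1)).
  by rewrite divr_gt0 ?lt_min ?d0 ?nu0 // ltr_wpDl.
move=> h; rewrite ltr_pdivlMr ?ltr_wpDl // => hd.
have hv : `|h *: v| < Num.min d `|u|.
  by apply: le_lt_trans hd; rewrite normrZ ler_wpM2l // lerDl.
move: hv; rewrite lt_min => /andP[hd' hu].
have w0 : u + h *: v != 0.
  apply: contraTneq hu => /eqP; rewrite addr_eq0 => /eqP ->.
  by rewrite normrN ltxx.
have [k' km'] := maximizer_exists kK K0 (u + h *: v).
have kk : `|k' - k| < e / (2 * (`|v| + 1)).
  by apply: dP km'; rewrite addrAC subrr add0r.
rewrite (gauge_polar K0 w0 km') (gauge_polar K0 u0 km).
have h1 := km.2 _ km'.1; have h2 := km'.2 _ km.1.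
have E : dot (u + h *: v) k' - dot u k - h *: dot k v = (dot u k' - dot u k) + h * dot v (k' - k).
  by rewrite /GRing.scale /= dotDl dotZl dotBr [dot k v]dotC; ring.
rewrite E.
have E0 : 0 <= dot u k' - dot u k + h * dot v (k' - k).
  by move: h2; rewrite !dotDl !dotZl dotBr -subr_ge0 => h2; apply: le_trans h2 _; rewrite le_eqVlt; apply/orP; left; apply/eqP; ring.
rewrite ger0_norm //.
apply: le_trans (_ : h * dot v (k' - k) <= _); first by rewrite gerDr subr_le0.
apply: le_trans (ler_norm _) _; rewrite normrM mulrC ler_wpM2r //.
apply: le_trans (dot_le _ _) _.
have := ltW kk; rewrite ler_pdivlMr // => kk'.
apply: le_trans kk'; rewrite mulrC; apply: ler_wpM2l => //.
by rewrite ler_wpM2l // lerDl.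
Qed.

Lemma grad_polar u k : u != 0 -> maximizes K u k -> grad (gauge (polar K)) u = k.
Proof.
move=> u0 km; have H j : 'D_(delta_mx 0 j) (gauge (polar K)) u = k 0 j.
  have [_ ->] := derive_polar (delta_mx 0 j) u0 km.
  by rewrite dotE !mxE; case: (ord2P j) => -> /=; ring.
by apply: row2P; rewrite mxE H.
Qed.

(** The maximizer for [u + h v] is [g b] with [b] near [a] and normal to g'(b). Subtracting the two
    orthogonality relations gives an exact formula for [b - a], in which the divided difference of
    g' tends to g''. *)
Lemma maximizer_derive u a v (p : 'rV[R]_2 -> 'rV[R]_2) : u != 0 -> maximizes K u (g a) ->
  dot u (derive1 (derive1 g) a) != 0 -> (forall w, maximizes K w (p w)) ->
  is_derive u v p (- (dot v (derive1 g a) / dot u (derive1 (derive1 g) a)) *: derive1 g a).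
Proof.
move=> u0 km b0 pm.
have g1d (b : R) : is_derive b 1 g (derive1 g b) by exact: (body_derive hs hK).
have g2d (b : R) : is_derive b 1 (derive1 g) (derive1 (derive1 g) b) by exact: (body_derive2 hs hK).
have g2c : {for a, continuous (derive1 (derive1 g))} by exact: (body_continuous2 hs hK).
move: b0 g1d g2d g2c; set g1 := derive1 g; set g2 := derive1 g1 => b0 g1d g2d g2c.
have pu : p u = g a by exact: (maximizes_uniq hK u0 (pm u) km).
have ng0 : 0 < `|u| by rewrite normr_gt0.
apply/is_derive_epsP => e e0.
pose H (b : R) := - (dot v (g1 b) / dot u (ddiffv g1 g2 b a)) *: ddiffv g g1 b a.
have FF : Filter (nbhs a) by exact: nbhs_filter.
have PF : ProperFilter (nbhs a) by exact: nbhs_pfilter.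
have cid : (fun b : R => b) @ a --> a by exact: cvg_id.
have ccst : (fun _ : R => a) @ a --> a by exact: cvg_cst.
have c1 : ddiffv g g1 b a @[b --> a] --> g1 a.
  apply: (cvg_ddiffv (FF := FF)) cid ccst; first by near=> b; exact: g1d.
  exact: is_derive_continuous (g2d a).
have c2 : ddiffv g1 g2 b a @[b --> a] --> g2 a.
  apply: (cvg_ddiffv (FF := FF)) cid ccst; last exact: g2c.
  by near=> b; exact: g2d.
have c3 : dot u (ddiffv g1 g2 b a) @[b --> a] --> dot u (g2 a).
  by apply: cvg_dot c2; exact: cvg_cst.
have c4 : dot v (g1 b) @[b --> a] --> dot v (g1 a).
  by apply: cvg_dot; [exact: cvg_cst|exact: is_derive_continuous (g2d a)].
have cH : H b @[b --> a] --> - (dot v (g1 a) / dot u (g2 a)) *: g1 a.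
  by apply: cvgZ c1; apply: cvgN; apply: cvgM c4 _; exact: cvgV.
have c0 : \forall b \near a, dot u (ddiffv g1 g2 b a) != 0.
  exact: (cvgr_neq0 _ c3 b0).
have HcH : \forall b \near a, `|- (dot v (g1 a) / dot u (g2 a)) *: g1 a - H b| < e.
  by move/cvgrPdist_lt : cH => /(_ e e0).
have /nbhs_ballN[d d0 dP] : \forall b \near a, `|- (dot v (g1 a) / dot u (g2 a)) *: g1 a - H b| < e /\
    dot u (ddiffv g1 g2 b a) != 0 by exact: (filterI HcH c0).
have [r r0 rP] := local_boundary_body hs hK a d0.
have [d' d'0 d'P] := maximizer_continuous u0 km r0.
exists (Num.min d' `|u| / (`|v| + 1)).
  by rewrite divr_gt0 ?lt_min ?d'0 ?ng0 // ltr_wpDl.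
move=> h; rewrite ltr_pdivlMr ?ltr_wpDl // => hd.
have hv : `|h *: v| < Num.min d' `|u|.
  by apply: le_lt_trans hd; rewrite normrZ ler_wpM2l // lerDl.
move: hv; rewrite lt_min => /andP[hd' hu].
have w0 : u + h *: v != 0.
  apply: contraTneq hu => /eqP; rewrite addr_eq0 => /eqP ->.
  by rewrite normrN ltxx.
have mw := pm (u + h *: v).
have near_r : `|p (u + h *: v) - g a| < r by apply: d'P mw; rewrite addrAC subrr add0r.
(* The maximizer is a boundary point of K near [g a], so the local description of the boundary
   yields a parameter near [a]. *)
have [b bd pb] := rP _ (closure_interior_body mw.1) (maximizes_notin_interior w0 mw) near_r.
have [Hb nb] := dP b bd.
have e1 : dot (u + h *: v) (g1 b) = 0.
  by rewrite pb in mw; exact: (maximizes_curve (g1d b) mw (body_K hK)).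
have e2 : dot u (g1 a) = 0 by exact: (maximizes_curve (g1d a) km (body_K hK)).
have e3 : (b - a) * dot u (ddiffv g1 g2 b a) = - h * dot v (g1 b).
  have -> : (b - a) * dot u (ddiffv g1 g2 b a) = dot u (g1 b - g1 a).
    by rewrite (ddiffvE g1 g2) dotZr.
  rewrite dotBr e2 subr0; move: e1; rewrite dotDl dotZl => /eqP; rewrite addr_eq0 => /eqP ->.
  by rewrite mulNr.
have e4 : b - a = h * - (dot v (g1 b) / dot u (ddiffv g1 g2 b a)).
  by apply: (mulIf nb); rewrite e3; move: nb; clear; move: (dot u _) => z nb; field.
rewrite pu pb (ddiffvE g g1) e4 -scalerA -/(H b) -scalerBr normrZ mulrC.
by apply: ler_wpM2r; [exact: normr_ge0|rewrite distrC; exact: ltW].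
Unshelve. all: by end_near. Qed.

(** The gradient is the maximizer at every nonzero vector, so only the maximizer has to be
    differentiated, and nonzero curvature is needed at [u] alone. *)
Lemma hess_polar u a : u != 0 -> maximizes K u (g a) ->
  dot u (derive1 (derive1 g) a) != 0 ->
  hess (gauge (polar K)) u = \matrix_(i, j)
    (- (derive1 g a 0 i * derive1 g a 0 j) / dot u (derive1 (derive1 g) a)).
Proof.
move=> u0 km b0.
have [p pm] : exists p : 'rV[R]_2 -> 'rV[R]_2, forall w, maximizes K w (p w).
  by have [p pP] := choice (maximizer_exists kK K0); exists p.
have dg j w : w != 0 -> 'D_(delta_mx 0 j) (gauge (polar K)) w = p w 0 j.
  move=> w0; have [_ ->] := derive_polar (delta_mx 0 j) w0 (pm w).
  by rewrite dotE !mxE; case: (ord2P j) => -> /=; ring.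
apply/matrixP => i j; rewrite !mxE.
have ou : open_nbhs u [set w : 'rV[R]_2 | w != 0].
  split; last exact: u0.
  rewrite openE => w /= w0; apply/interior_ballP; exists `|w|; first by rewrite normr_gt0.
  move=> z zw; apply: contraTneq zw => ->; rewrite sub0r normrN ltxx //.
have kj := is_derive_coord j (maximizer_derive (delta_mx 0 i) u0 km b0 pm).
have [_ ->] := near_is_derive ou (fun w w0 => esym (dg j w w0)) kj.
move: b0; move: (derive1 (derive1 g) a) (derive1 g a) => g2 g1 b0.
by rewrite !mxE [dot (delta_mx _ _) _]dotE !mxE; case: (ord2P i) => -> /=; field.
Qed.

Lemma KcurvatureE (c : R -> 'rV[R]_2) (t a : R) (c2 : 'rV[R]_2) : ~ flat_segment g c ->
  is_derive t 1 (derive1 c) c2 -> derive1 c t != 0 -> maximizes K (nu c t) (g a) ->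
  dot (nu c t) (derive1 (derive1 g) a) != 0 ->
  Kcurvature K g c t = - (dot (perp c2) (derive1 g a) * dot (derive1 g a) (perp (nu c t)))
    / (dot (nu c t) (derive1 (derive1 g) a) * enorm (nu c t) ^+ 2).
Proof.
move=> nf cd c0 km b0.
have n0 : nu c t != 0 by rewrite perp_neq0.
rewrite /Kcurvature asboolF // (hess_polar n0 km b0) (derive1_nu cd).
have e0 : enorm (nu c t) ^+ 2 != 0 by rewrite expf_neq0 // gt_eqF // enorm_gt0.
move: b0 e0; set be := dot _ (derive1 (derive1 g) a); set en := enorm _ ^+ 2.
move: (derive1 g a) (nu c t) be en => v n be en b0 e0.
rewrite !dotE !mxE !big_ord_recl !big_ord0 /= !mxE.
have -> : lift ord0 ord0 = 1 :> 'I_2 by apply/val_inj.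
have -> : ord0 = 0 :> 'I_2 by apply/val_inj.
by rewrite /=; field; rewrite b0 e0.
Qed.

(** In the plane [v] is a multiple of [perp n], so both cross products are multiples of [dot n k]
    and the determinant factors. *)
Lemma jac_Kcurvature (c1 c2 g2 v n k : 'rV[R]_2) (l kap : R) : n = perp c1 -> c1 != 0 ->
  dot n v = 0 -> dot n g2 != 0 ->
  kap = - (dot (perp c2) v * dot v (perp n)) / (dot n g2 * enorm n ^+ 2) ->
  jac (dot (perp c2) v) (dot n g2) l c1 v k = dot n g2 * (1 - kap * l) * dot n k.
Proof.
move=> nE c10 nv b0 ->.
have n0 : n != 0 by rewrite nE perp_neq0.
rewrite enorm_sqr; have nn : dot n n != 0 by rewrite gt_eqF // dot_gt0.
have vE := orth_perp n0 (etrans (dotC v n) nv).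
have e1 : cross c1 k = dot n k by rewrite nE; plane.
have e2 : cross v k * dot n n = - dot v (perp n) * dot n k.
  rewrite {1}vE; have -> : cross ((dot v (perp n) / dot n n) *: perp n) k =
     dot v (perp n) / dot n n * cross (perp n) k by move: (dot v _ / _) => r; plane.
  rewrite mulrAC divfK // nE; move: (dot v _) => r; plane.
rewrite /jac e1; apply: (mulIf nn).
rewrite mulrBl -[_ * cross v k * _]mulrA e2.
by field; rewrite nn b0.
Qed.

End Polar.

(** * Directions in which the curvature of K vanishes *)

Section Osculation.
Variable R : realType.

Lemma cvg_quotient1 (f : R -> R) (df : R) : is_derive (0 : R) 1 f df ->
  (f h - f 0) / h @[h --> 0^'] --> df.
Proof.
move=> /is_derive_epsP H; apply/cvgrPdist_le => e e0.
have [d d0 dP] := H e e0; exists d => //= h; rewrite /ball_ /= sub0r normrN => hd h0.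
have h0' : 0 < `|h| by rewrite normr_gt0.
have := dP h hd; rewrite add0r [h *: 1]mulr1 -ler_pdivrMr // => H'.
rewrite distrC; apply: le_trans H'; rewrite -normfV -normrM.
suff -> : (f h - f 0) / h - df = (f h - f 0 - h *: df) / h by [].
by rewrite /GRing.scale /=; field.
Qed.

(** The mean value theorem is applied to [f] minus its quadratic part, so [df] need be
    differentiable only at 0. *)
Lemma cvg_quotient2 (f df : R -> R) (d2 : R) :
  (\forall h \near (0 : R), is_derive (h : R) 1 f (df h)) -> df 0 = 0 -> is_derive (0 : R) 1 df d2 ->
  (f h - f 0) / h ^+ 2 @[h --> 0^'] --> d2 / 2.
Proof.
move=> /nbhs_ballN[r r0 fd] df0 /is_derive_epsP H; apply/cvgrPdist_le => e e0.
have [d d0 dP] := H e e0; exists (Num.min r d); first by rewrite /= lt_min r0.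
move=> /= h; rewrite /ball_ /= sub0r normrN => hd h0.
have h0' : 0 < `|h| by rewrite normr_gt0.
pose F z := f z - d2 / 2 * z ^+ 2; pose dF z := df z - d2 * z.
have Fd (z : R) : `|z - 0| < r -> is_derive z 1 F (dF z).
  move=> zr; have fz := fd z zr; rewrite /F /dF.
  apply: is_derive_eq.
  by rewrite /GRing.scale /=; field.
have [z zh E] : exists2 z : R, `|z| <= `|h| & F h - F 0 = dF z * (h - 0).
  have hr : `|h| < r by move: hd; rewrite lt_min => /andP[].
  have cl (a b : R) : a <= b -> (forall z, z \in `[a, b] -> `|z| <= `|h|) ->
      exists2 z : R, `|z| <= `|h| & F b - F a = dF z * (b - a).
    move=> ab inn.
    have [z zab E] : exists2 z, z \in `[a, b] & F b - F a = dF z * (b - a).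
      apply: MVT_segment => // [z zab|].
        by apply: Fd; rewrite subr0; apply: le_lt_trans hr; apply/inn/subset_itv_oo_cc.
      apply: derivable_within_continuous => z /inn zh.
      by have [] := Fd z; rewrite ?subr0; first exact: le_lt_trans hr.
    by exists z => //; exact: inn.
  have [hp|hn] := leP 0 h.
    by apply: cl => // z; rewrite in_itv /= => /andP[z0 zh]; rewrite !ger0_norm.
  have [z|z zh E] := cl h 0 (ltW hn).
    by rewrite in_itv /= => /andP[z0 zh]; rewrite !ler0_norm ?lerN2 // ltW.
  by exists z => //; rewrite -opprB E -mulrN opprB.
have zd : `|z| < d by apply: le_lt_trans zh _; move: hd; rewrite lt_min => /andP[].
have := dP z zd; rewrite add0r [z *: 1]mulr1 df0 subr0 => Hz.
have -> : d2 / 2 - (f h - f 0) / h ^+ 2 = - ((F h - F 0) / h ^+ 2).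
  by rewrite /F; field.
rewrite E normrN subr0 expr2 invfM -mulrA [h * _]mulrA divff // mul1r normrM normfV.
rewrite ler_pdivrMr // /dF [d2 * z]mulrC; apply: le_trans Hz _.
by rewrite ler_pM2l.
Qed.

Lemma near_dist0 (f : R -> R) (l e : R) : f h @[h --> 0^'] --> l -> 0 < e ->
  \forall h \near 0^', `|l - f h| < e.
Proof. by move=> /cvgrPdist_lt H e0; exact: H. Qed.

(* [q] stays in [K] and runs twice as fast as [p], while [p] bends inwards; so [p h]
   lies below the middle of the chord from [p 0] to [q h], hence in the convex hull
   of this chord and of an interior point of [K]. *)
Lemma osculation (K : set 'rV[R]_2) (p p1 q q1 : R -> 'rV[R]_2) (p2 q2 n : 'rV[R]_2) (e0 : R) :
  (forall a b (r : R), K a -> K b -> 0 <= r <= 1 -> K (a + r *: (b - a))) ->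
  (\forall h \near (0 : R), is_derive (h : R) 1 p (p1 h)) -> is_derive (0 : R) 1 p1 p2 ->
  (\forall h \near (0 : R), is_derive (h : R) 1 q (q1 h)) -> is_derive (0 : R) 1 q1 q2 ->
  q 0 = p 0 -> q1 0 = 2 *: p1 0 -> p1 0 != 0 -> n != 0 -> dot n (p1 0) = 0 ->
  dot n p2 < 0 -> dot n q2 = 0 -> (forall h, K (q h)) ->
  0 < e0 -> interior K (p 0 - e0 *: n) ->
  \forall h \near 0^', interior K (p h).
Proof.
move=> cK pd p1d qd q1d qp0 q1E T0 n0 nT np2 nq2 Kq e00 Ik.
set k := p 0 in qp0 Ik; set T := p1 0 in T0 nT q1E.
have TT : 0 < dot T T by rewrite dot_gt0.
have nn : 0 < dot n n by rewrite dot_gt0.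
have FF : Filter (0 : R)^' by exact: dnbhs_filter.
have nT1 : dot n (q1 0) = 0 by rewrite q1E dotZr nT mulr0.
have cA : (dot T (p h) - dot T (p 0)) / h @[h --> 0^'] --> dot T T.
  by apply: cvg_quotient1; apply: is_derive_dot; exact: nbhs_singleton pd.
have cB : (dot T (q h) - dot T (q 0)) / h @[h --> 0^'] --> dot T (q1 0).
  by apply: cvg_quotient1; apply: is_derive_dot; exact: nbhs_singleton qd.
have cC : (dot n (p h) - dot n (p 0)) / h ^+ 2 @[h --> 0^'] --> dot n p2 / 2.
  apply: (cvg_quotient2 (df := fun h => dot n (p1 h))) => //; last exact: is_derive_dot.
  by apply: filterS pd => h; exact: is_derive_dot.
have cD : (dot n (q h) - dot n (q 0)) / h ^+ 2 @[h --> 0^'] --> dot n q2 / 2.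
  apply: (cvg_quotient2 (df := fun h => dot n (q1 h))) => //; last exact: is_derive_dot.
  by apply: filterS qd => h; exact: is_derive_dot.
rewrite qp0 -/k q1E dotZr in cB; rewrite -/k in cA cC; rewrite qp0 nq2 mul0r in cD.
move: cA cB cC cD.
(* [A] and [B] are the tangential first-order quotients of [p] and [q], [C] and [D] their normal
   second-order quotients. Here A / B tends to 1/2, D to 0, and C to a negative limit. *)
set A := fun h => _; set B := fun h => _; set C := fun h => _; set D := fun h => _ => cA cB cC cD.
have B0 : 2 * dot T T != 0 by rewrite mulf_neq0 ?pnatr_eq0 // gt_eqF.
have cr : A h / B h @[h --> 0^'] --> dot T T / (2 * dot T T) by apply: cvgM => //; exact: cvgV.
have cE : - (C h - A h / B h * D h) / dot n n @[h --> 0^'] -->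
    - (dot n p2 / 2 - dot T T / (2 * dot T T) * 0) / dot n n.
  by apply: cvgM; [apply: cvgN; apply: cvgB => //; exact: cvgM|exact: cvg_cst].
have ch : h @[h --> (0 : R)^'] --> (0 : R) by apply: cvg_within.
have cth : - (C h - A h / B h * D h) / dot n n * (h * h) / e0 @[h --> 0^'] -->
    - (dot n p2 / 2 - dot T T / (2 * dot T T) * 0) / dot n n * (0 * 0) / e0.
  by apply: cvgM; [apply: cvgM => //; exact: cvgM|exact: cvg_cst].
rewrite !(mulr0, mul0r) in cth.
have crho : A h / B h / (1 - - (C h - A h / B h * D h) / dot n n * (h * h) / e0) @[h --> 0^'] -->
    dot T T / (2 * dot T T) / (1 - 0).
  apply: cvgM => //; apply: cvgV; first by rewrite subr0 oner_neq0.
  by apply: cvgB => //; exact: cvg_cst.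
have hf : dot T T / (2 * dot T T) = 1 / 2.
  by move: (gt_eqF TT) => /negbT; move: (dot T T) => z z0; field.
rewrite hf in cr cE crho; rewrite subr0 invr1 mulr1 in crho.
rewrite mulr0 subr0 in cE.
have E0 : 0 < - (dot n p2 / 2) / dot n n.
  by apply: divr_gt0 => //; move: np2; clear; move: (dot n p2) => z z0; lra.
have nB := near_dist0 cB (divr_gt0 TT (ltr0n R 2)).
have nE := near_dist0 cE E0.
have q0 : (0 : R) < 1 / 4 by clear; lra.
have nth := near_dist0 cth q0.
have nrho := near_dist0 crho q0.
have nh : \forall h \near (0 : R)^', h != 0 by exact: nbhs_dnbhs_neq.
near=> h.
have h0 : h != 0 by near: h.
have hB : B h != 0.
  have : `|2 * dot T T - B h| < dot T T / 2 by near: h.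
  apply: contraTneq => ->; rewrite subr0 -leNgt ger0_norm ?mulr_ge0 ?ltW //.
  by move: TT; clear; move: (dot T T) => z z0; lra.
pose Eh := - (C h - A h / B h * D h) / dot n n.
have hE : 0 < Eh.
  have : `|- (dot n p2 / 2) / dot n n - Eh| < - (dot n p2 / 2) / dot n n by exact: (near nE h).
  by clear; move: Eh (_ / _) => z w; rewrite ltr_norml => /andP[]; lra.
have hth : `|0 - Eh * (h * h) / e0| < 1 / 4 by exact: (near nth h).
have hrho : `|1 / 2 - A h / B h / (1 - Eh * (h * h) / e0)| < 1 / 4 by exact: (near nrho h).
set th := Eh * (h * h) / e0 in hth hrho; set r := A h / B h in hrho.
have th0 : 0 < th by rewrite divr_gt0 // mulr_gt0 // -expr2 exprn_even_gt0.
have th1 : th <= 1 by move: hth; clear; rewrite ltr_norml => /andP[]; lra.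
have rho01 : 0 <= r / (1 - th) <= 1.
  by move: hrho; clear; move: (r / _) => z; rewrite ltr_norml => /andP[h1 h2]; apply/andP; split; lra.
(* The coefficient [r] matches the components along [T] and [Eh] those along [n]; a vector
   orthogonal to both is zero. *)
have dec : p h = k + r *: (q h - k) - (Eh * (h * h)) *: n.
  apply/eqP; rewrite -subr_eq0; apply/eqP; set w := (X in X = 0).
  have wT : dot T w = 0.
    have eA : dot T (p h) - dot T k = A h * h by rewrite /A divfK.
    have eB : dot T (q h) - dot T k = B h * h by rewrite /B divfK.
    rewrite /w dotBr dotBr dotDr !dotZr dotBr eB [dot T n]dotC nT mulr0 subr0.
    move: eA hB; rewrite /r; clear; move: (A h) (B h) (dot T (p h)) (dot T k) => a b u v e b0.
    have -> : u = a * h + v by rewrite -e subrK.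
    by field.
  have wn : dot n w = 0.
    have eC : dot n (p h) - dot n k = C h * (h * h) by rewrite /C expr2 divfK // mulf_neq0.
    have eD : dot n (q h) - dot n k = D h * (h * h) by rewrite /D expr2 divfK // mulf_neq0.
    have eE : Eh * (h * h) * dot n n = - (C h - r * D h) * (h * h).
      by rewrite /Eh mulrAC divfK // gt_eqF.
    rewrite /w dotBr dotBr dotDr !dotZr dotBr eD eE.
    move: eC; clear; move: (dot n (p h)) (dot n k) (C h) (D h) r => a b u v z e.
    have -> : a = u * (h * h) + b by rewrite -e subrK.
    by ring.
  have [b wE] : exists b, w = b *: perp T by eexists; exact: orth_perp T0 (etrans (dotC w T) wT).
  have [a Tp] : exists a, n = a *: perp T by eexists; exact: orth_perp T0 nT.
  move: wn; rewrite wE {1}Tp dotZl dotZr => /eqP.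
  have pp : dot (perp T) (perp T) != 0 by rewrite gt_eqF // dot_gt0 perp_neq0.
  rewrite !mulf_eq0 (negbTE pp) orbF => /orP[/eqP a0|/eqP ->]; last by rewrite scale0r.
  by move: n0; rewrite Tp a0 scale0r eqxx.
rewrite dec.
have th1' : 1 - th != 0.
  by move: hth; clear; rewrite ltr_norml => /andP[? ?]; rewrite gt_eqF //; lra.
(* The normal defect is moved onto the interior point [k - e0 *: n] with small weight [th]; the rest
   is a point of the chord whose parameter is close to 1/2. *)
have -> : k + r *: (q h - k) - (Eh * (h * h)) *: n =
    (k + (r / (1 - th)) *: (q h - k)) + th *: (k - e0 *: n - (k + (r / (1 - th)) *: (q h - k))).
  have -> : Eh * (h * h) = th * e0 by rewrite /th divfK // gt_eqF.
  move: th1'; clear; move: (q h) => z z1; apply: row2P; rewrite !mxE; field; exact: z1.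
apply: (interior_convex cK) => //; last by rewrite th0.
by apply: cK rho01; rewrite // -[k]qp0; exact: Kq.
Unshelve. all: by end_near. Qed.

End Osculation.

Lemma perpK (R : realType) (u : 'rV[R]_2) : perp (perp u) = - u.
Proof. by apply: row2P; plane. Qed.

Lemma is_derive_affine (R : realType) (V : normedModType R) (f : R -> V) (b a h : R) df :
  is_derive (b + a * h) 1 f df -> is_derive h 1 (fun z => f (b + a * z)) (a *: df).
Proof.
move=> /(is_deriveZv a)/is_derive_epsP H; apply/is_derive_epsP => e e0.
have [d d0 dP] := H e e0; exists d => // z /dP.
suff -> : b + a * h + z *: (a *: 1) = b + a * (h + z *: 1) by [].
by rewrite /GRing.scale /=; ring.
Qed.

Lemma is_derive_cmul (R : realType) (f : R -> 'rV[R]_2) (k h : R) (df : 'rV[R]_2) :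
  is_derive h 1 f df -> is_derive h 1 (fun z => k *: f z) (k *: df).
Proof. by move=> fd; exact: is_deriveZ. Qed.

Lemma near_shift (R : realType) (t : R) (P : R -> Prop) :
  (\forall b \near t, P b) -> \forall h \near (0 : R), P (t + 1 * h).
Proof.
move=> /nbhs_ballN[d d0 dP]; apply/nbhs_ballN; exists d => // h hd; apply: dP.
by rewrite mul1r addrAC subrr add0r -[h]subr0.
Qed.

Lemma pos_min2 (R : realType) (d e : R) : 0 < d -> 0 < e -> exists h : R, [/\ 0 < h, h < d & h < e].
Proof.
move=> d0 e0; have m0 : 0 < Num.min d e by rewrite lt_min d0.
have : Num.min d e / 2 < Num.min d e by rewrite ltr_pdivrMr // ltr_pMr ?ltr1n.
by rewrite lt_min => /andP[h1 h2]; exists (Num.min d e / 2); rewrite divr_gt0.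
Qed.

Section Flat.
Variable R : realType.
Variables (s : regularity R) (K : set 'rV[R]_2) (g : R -> 'rV[R]_2).
Hypothesis hs : admissible s.
Hypothesis hK : gauge_body s K g.
Variables (U : set 'rV[R]_2) (N : nat) (c : 'I_N -> R -> 'rV[R]_2) (succ : {perm 'I_N}).
Hypothesis oU : open U.
Hypothesis bU : bounded_set U.
Hypothesis hU : piecewise_boundary c succ s U.

Let kK : compact K := gb_compact hK.
Let cK := convex_setP (gb_convex hK).
Let K0 : interior K 0 := gb_zero hK.

Lemma arc_derive2 i (t : R) : 0 <= t <= 1 ->
  is_derive t 1 (derive1 (c i)) (derive1 (derive1 (c i)) t).
Proof.
move=> t01; have [A [oA sA cA]] := arc_C2 hs hU i; rewrite -drv2 -drv1.
by apply: (@Ck_is_derive _ 2 A (c i) 1 t cA) => //; apply: sA; rewrite /= in_itv.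
Qed.

Lemma good_derive2 i (t : R) : good c i t ->
  is_derive t 1 (derive1 (c i)) (derive1 (derive1 (c i)) t).
Proof.
move=> /good_base[n [t01 [_ pn]]].
have pn1 b : derive1 (c i) (b + n%:~R) = derive1 (c i) b by exact: shift_derive1.
apply: (shift_derive pn1).
by rewrite -(shift_derive1 t pn1); exact: arc_derive2.
Qed.

Lemma good_near i (t : R) : good c i t -> \forall b \near t, good c i b.
Proof.
case=> [/andP[h0 h1]|[pi /andP[h0 h1]]]; apply/nbhs_ballN.
  exists (Num.min t (1 - t)); first by rewrite lt_min h0 subr_gt0.
  move=> b; rewrite lt_min !ltr_norml => /andP[/andP[? ?] /andP[? ?]]; left.
  by apply/andP; split; lra.
exists (Num.min (t + 1) (2 - t)); first by rewrite lt_min; apply/andP; split; lra.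
move=> b; rewrite lt_min !ltr_norml => /andP[/andP[? ?] /andP[? ?]]; right; split=> //.
by apply/andP; split; lra.
Qed.

Lemma maximizes_normal u a : u != 0 -> maximizes K u (g a) ->
  exists2 l : R, 0 < l & u = - l *: nu g a.
Proof.
move=> u0 km; have [a' [ga [l l0 uE]]] := maximizes_range hs hK u0 km.
have [m pa] := periodic_inj hK ga; exists l; first exact: l0.
by rewrite uE /nu pa (periodic_int (periodic_derive1 (bp_periodic (gb_boundary hK)))).
Qed.

(** In the frame of K the arc becomes (x - c) / d, which cannot enter the interior of K because c
    stays on the boundary of U. Positive curvature of the arc against zero curvature of K would
    force it in, by [osculation]. *)
Lemma curvature_not_pos x i (t : R) a : U x -> good c i t -> closest K U x (c i t) ->
  (distK K U x)^-1 *: (x - c i t) = g a -> curvature g a = 0 -> ~ 0 < curvature (c i) t.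
Proof.
move=> Ux gt cx ka cg cc; have d0 := dist_gt0 hK oU Ux cx.
have km := closest_good_maximizes hs hK oU hU Ux gt cx.
rewrite ka in km; set d := distK K U x in ka d0.
have c10 := good_regular hU gt; have n0 : nu (c i) t != 0 by rewrite perp_neq0.
have [l l0 nE] := maximizes_normal n0 km.
have g10 := bp_regular (gb_boundary hK) a.
have g20 : dot (nu (c i) t) (derive1 (derive1 g) a) = 0.
  have := curvatureE (body_derive2 hs hK a) g10.
  by rewrite cg mul0r nE dotZl [dot (nu g a) _]dotC => <-; rewrite mulr0.
have c2n : 0 < dot (nu (c i) t) (derive1 (derive1 (c i)) t).
  have E := curvatureE (good_derive2 gt) c10.
  by rewrite dotC -E; apply: mulr_gt0; [exact: cc|apply: exprn_gt0; rewrite enorm_gt0; exact: n0].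
have ng : 0 < dot (- nu (c i) t) (nu g a).
  rewrite nE dotNl dotZl mulNr opprK.
  by apply: mulr_gt0; [exact: l0|rewrite dot_gt0 perp_neq0; exact: g10].
have [e0 e00 cone] := tangent_cone hs hK ng.
have Ik := cone e0 (introT andP (conj e00 (lexx e0))).
have [b g1E] : exists b, derive1 g a = b *: derive1 (c i) t.
  have h : dot (derive1 g a) (nu (c i) t) = 0.
    by rewrite nE dotZr /nu; move: (derive1 g a) => u; plane.
  have [z ze] : exists z, derive1 g a = z *: perp (nu (c i) t) by eexists; exact: orth_perp n0 h.
  by exists (- z); rewrite ze /nu perpK scalerN scaleNr.
have b0 : b != 0 by apply: contraNneq g10 => b0; rewrite g1E b0 scale0r.
(* Chosen so that [g] runs along K with exactly twice the velocity of the rescaled arc; with equal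
   speeds the chord parameter would tend to the endpoint 1 and might exceed it. *)
have [r rE] : exists r : R, r = - 2 / (d * b) by eexists.
pose p (h : R) : 'rV[R]_2 := d^-1 *: (x - c i (t + 1 * h)); pose p1 (h : R) : 'rV[R]_2 := - d^-1 *: derive1 (c i) (t + 1 * h).
pose q (h : R) : 'rV[R]_2 := g (a + r * h); pose q1 (h : R) : 'rV[R]_2 := r *: derive1 g (a + r * h).
have gnear := near_shift (good_near gt).
have pd : \forall h \near (0 : R), is_derive (h : R) 1 p (p1 h).
  apply: filterS gnear => h gh; rewrite /p1 scaleNr -scalerN; apply: is_derive_cmul.
  have H := is_derive_affine (good_derive hs hU gh); rewrite scale1r in H.
  by rewrite -[- _]sub0r; apply: is_deriveB.
have p1d : is_derive (0 : R) 1 p1 (- d^-1 *: derive1 (derive1 (c i)) t).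
  have H : is_derive (t + 1 * 0) 1 (derive1 (c i)) (derive1 (derive1 (c i)) t).
    by rewrite mulr0 addr0; exact: good_derive2.
  by apply: is_derive_cmul; have := is_derive_affine H; rewrite scale1r.
have qd : \forall h \near (0 : R), is_derive (h : R) 1 q (q1 h).
  by near=> h; apply: is_derive_affine; exact: (body_derive hs hK).
have q1d : is_derive (0 : R) 1 q1 (r *: (r *: derive1 (derive1 g) a)).
  have H : is_derive (a + r * 0) 1 (derive1 g) (derive1 (derive1 g) a).
    by rewrite mulr0 addr0; exact: (body_derive2 hs hK).
  exact: (is_derive_cmul r (is_derive_affine H)).
have pg0 : p 0 = g a by rewrite /p mulr0 addr0.
have := @osculation R K p p1 q q1 _ _ (nu (c i) t) e0 cK pd p1d qd q1d.
case.
- by rewrite pg0 /q mulr0 addr0.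
- rewrite /q1 /p1 !mulr0 !addr0 g1E !scalerA; congr (_ *: _); rewrite rE.
  by field; rewrite b0 gt_eqF.
- rewrite /p1 mulr0 addr0 scaler_eq0 oppr_eq0 invr_eq0 negb_or (gt_eqF d0); exact: c10.
- exact: n0.
- rewrite /p1 dotZr mulr0 addr0 /nu; move: (derive1 (c i) t) (- d^-1) => u z; plane.
- rewrite dotZr mulNr oppr_lt0; apply: mulr_gt0; [rewrite invr_gt0; exact: d0|exact: c2n].
- by rewrite !dotZr g20 !mulr0.
- by move=> h; exact: body_K hK _.
- exact: e00.
- by rewrite pg0 -scalerN.
move=> e /= e0' H.
(* An interior position of [p h] means gauge distance below the minimum at a boundary point. *)
have /nbhs_ballN[e1 e10 gP] : \forall h \near (0 : R), good c i (t + 1 * h) by exact: gnear.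
have [h [h0 he he1]] := pos_min2 e0' e10.
have Ih : interior K (p h).
  by apply: H; [rewrite /ball_ /= sub0r normrN (gtr0_norm h0)|rewrite (gt_eqF h0)].
have gh : good c i (t + 1 * h) by apply: gP; rewrite subr0 (gtr0_norm h0); exact: he1.
have := dist_le hK x (good_bd hU gh); move/(interior_gauge kK cK K0): Ih.
rewrite /p (gaugeZ cK K0); last by rewrite invr_gt0; exact: d0.
rewrite -/d mulrC (ltr_pdivrMr _ _ d0) !mul1r => h1.
by rewrite leNgt h1.
Unshelve. all: by end_near. Qed.

End Flat.

Section Affine.
Variables (R : realType) (A : set 'rV[R]_2) (f : 'rV[R]_2 -> R) (u : 'rV[R]_2) (b : R).
Hypothesis oA : open A.
Hypothesis fE : forall a, A a -> f a = dot u a + b.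

Definition affine_iter (vs : seq 'rV[R]_2) : 'rV[R]_2 -> R :=
  match vs with
  | [::] => fun a => dot u a + b
  | [:: v] => fun=> dot u v
  | _ => fun=> 0
  end.

Lemma affine_iter_derive vs a v : is_derive a v (affine_iter vs) (affine_iter (v :: vs) a).
Proof.
case: vs => [|w [|w' vs]] /=; [|exact: is_derive_cst|exact: is_derive_cst].
rewrite -[dot u v]addr0; apply: is_deriveD; apply: is_derive_dot; exact: is_derive_id.
Qed.

Lemma affine_iterE vs a : A a -> Defs.iterD f vs a = affine_iter vs a.
Proof.
elim: vs a => [a /fE //|v vs IH a Aa].
have [_ E] := near_is_derive (conj oA Aa) (fun z Az => esym (IH z Az)) (affine_iter_derive vs a v).
exact: E.
Qed.

Lemma affine_derive vs a v : A a -> is_derive a v (Defs.iterD f vs) (affine_iter (v :: vs) a).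
Proof.
move=> Aa.
exact: near_is_derive (conj oA Aa) (fun z Az => esym (affine_iterE vs Az)) (affine_iter_derive vs a v).
Qed.

Lemma affine_Ck k : Ck k A f.
Proof.
move=> vs a _ Aa; split; last by move=> _ v; have [] := affine_derive vs v Aa.
have [d d0 dA] : exists2 d : R, 0 < d & forall z, `|z - a| < d -> A z.
  by apply/nbhs_ballN; exact: open_nbhs_nbhs.
have /continuous_epsP H : {for a, continuous (affine_iter vs)}.
  case: vs => [|w [|w' vs]] /=; [|exact: cst_continuous|exact: cst_continuous].
  have H := @dot_continuous R u a.
  by apply: (cvgD H); exact: cvg_cst.
apply/continuous_epsP => e e0; have [d' d'0 d'P] := H e e0.
exists (Num.min d d'); first by rewrite lt_min d0.
move=> z; rewrite lt_min => /andP[zd zd'].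
by rewrite (affine_iterE vs (dA z zd)) (affine_iterE vs Aa); exact: d'P.
Qed.

Lemma affine_class s : admissible s -> of_class s A f.
Proof.
have big vs : (2 <= size vs)%N -> affine_iter vs = fun=> 0 by case: vs => [|v [|]].
case: s => [k al [k2 _]||_] /=; [split|move=> _ k|split].
- exact: affine_Ck.
- move=> vs vk a Aa; exists 0.
  have [d d0 dA] : exists2 d : R, 0 < d & forall z, `|z - a| < d -> A z.
    by apply/nbhs_ballN; exact: open_nbhs_nbhs.
  apply/near_pairP; exists d => // z w /dA Az /dA Aw.
  by rewrite mul0r !affine_iterE ?big ?vk ?subrr ?normr0.
- exact: affine_Ck.
- exact: affine_Ck.
move=> a Aa.
have [d d0 dA] : exists2 d : R, 0 < d & forall z, `|z - a| < d -> A z.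
  by apply/nbhs_ballN; exact: open_nbhs_nbhs.
apply/nbhs_ballN; exists d => // h; rewrite subr0 => hd.
have Ah : A (a + h) by apply: dA; rewrite addrAC subrr add0r.
apply: cvg_near_cst; exists 2%N => // -[|[|n]] //= _.
rewrite !big_ord_recl big1 => [|j _]; last first.
  by rewrite affine_iterE // big ?scaler0 // size_nseq.
rewrite !affine_iterE // addr0.

by rewrite factS fact0 invr1 !scale1r fE // dotDr /=; ring.
Qed.

End Affine.

Lemma perpZ (R : realType) (a : R) (u : 'rV[R]_2) : perp (a *: u) = a *: perp u.
Proof. by apply: row2P; plane. Qed.

Section LocalClosest.
Variable R : realType.
Variables (s : regularity R) (K : set 'rV[R]_2) (g : R -> 'rV[R]_2).
Hypothesis hs : admissible s.
Hypothesis hK : gauge_body s K g.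
Variables (U : set 'rV[R]_2) (N : nat) (c : 'I_N -> R -> 'rV[R]_2) (succ : {perm 'I_N}).
Hypothesis oU : open U.
Hypothesis bU : bounded_set U.
Hypothesis hU : piecewise_boundary c succ s U.

Let kK : compact K := gb_compact hK.
Let cK := convex_setP (gb_convex hK).
Let K0 : interior K 0 := gb_zero hK.

Lemma maximizes_closest x i (t a : R) : U x -> good c i t -> closest K U x (c i t) ->
  (distK K U x)^-1 *: (x - c i t) = g a -> maximizes K (nu (c i) t) (g a).
Proof. by move=> Ux gt cx <-; exact: (closest_good_maximizes hs hK oU hU Ux gt cx). Qed.

(** Closeness is passed along a chain: closest points near [y], hence times near [t], normals near
    that of [y], support points near [g a], and parameters near [a]. This supplies the solutions of
    the equations near [x]. *)
Lemma closest_nearby x i (t a : R) : U x -> good c i t -> closest K U x (c i t) ->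
  (forall z, closest K U x z -> z = c i t) ->
  (distK K U x)^-1 *: (x - c i t) = g a ->
  forall d : R, 0 < d -> exists2 e : R, 0 < e & forall x', `|x' - x| < e -> U x' /\
    exists ta sa : R, [/\ `|ta - t| < d, `|sa - a| < d,
      good c i ta /\ closest K U x' (c i ta),
      x' = c i ta + distK K U x' *: g sa & maximizes K (nu (c i) ta) (g sa)].
Proof.
move=> Ux gt cx uy ka d d0.
have km := maximizes_closest Ux gt cx ka.
have c10 := good_regular hU gt; have n0 : nu (c i) t != 0 by rewrite perp_neq0.
have [r1 r10 loc1] := local_boundary_body hs hK a d0.
have [d2 d20 mc] := maximizer_continuous hK n0 km r10.
have /continuous_epsP nuc : {for t, continuous (nu (c i))}.
  exact: is_derive_continuous (is_derive_perp (good_derive2 hs hU gt)).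
have [d3 d30 nuP] := nuc d2 d20.
have [d4 d40 gP] := (nbhs_ballN _ _).1 (good_near gt).
have [d5 [d50 d5d d53]] := pos_min2 d0 d30.
have [d6 [d60 d65 d64]] := pos_min2 d50 d40.
have [r r0 loc] := good_local hs oU hU gt d60.
have [e e0 eP] := closest_near hK oU bU Ux cx uy r0.
have [e1 e10 e1U] := (interior_ballP _ _).1 (oU Ux).
have [e2 [e20 e2e e21]] := pos_min2 e0 e10.
exists e2 => // x' xx'.
have Ux' : U x' by apply: e1U; exact: lt_trans e21.
split=> //.
have b0 : bd U !=set0 by exists (c i t); have := good_bd hU gt.
have [y cy] := closest_exists hK oU bU x' b0.
have yr := eP x' y (lt_trans xx' e2e) cy.
have [cly niy] := cy.1.
have nUy : ~ U y by move=> Uy; apply: niy; rewrite /= (interior_id U).1.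
have [ta tad yE] := loc y cly nUy yr.
have ta5 := lt_trans tad d65.
have gta : good c i ta by apply: gP; exact: lt_trans d64.
rewrite yE in cy.
have mk' := closest_good_maximizes hs hK oU hU Ux' gta cy.
have c10' := good_regular hU gta; have n0' : nu (c i) ta != 0 by rewrite perp_neq0.
have kk := mc _ _ (nuP ta (lt_trans ta5 d53)) mk'.
have [sa sad kE] := loc1 _ (closure_interior_body hK mk'.1) (maximizes_notin_interior n0' mk') kk.
exists ta, sa; split=> //; first exact: lt_trans d5d.
- rewrite -kE scalerA divff ?scale1r; last by rewrite gt_eqF //; exact: (dist_gt0 hK oU Ux' cy).
  by rewrite addrC subrK.
- by rewrite -kE.
Qed.

Let minmax_sign (y z : R) : y * z < 0 -> Num.min y z <= 0 <= Num.max y z.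
Proof.
rewrite ge_min le_max; case: (lerP y 0) => hy; case: (lerP z 0) => hz /=; rewrite ?orbT ?andbT.
- by nra.
- by move=> _; rewrite (ltW hz) orbT.
- by move=> _; rewrite (ltW hy).
- by nra.
Qed.

Let div_mul_sqr (y z : R) : z != 0 -> y / z = y * z / z ^+ 2.
Proof. by move=> z0; field. Qed.

(** The velocity is [M b] times a fixed vector, with [M] continuous and never zero. A change of sign
    is excluded by the intermediate value theorem, and closing up by the mean value theorem, so the
    normals are positive multiples of each other. *)
Lemma segment_arc i : is_segment (c i) -> ~ one_periodic (c i) /\
  forall b b' : R, 0 <= b <= 1 -> 0 <= b' <= 1 ->
    (exists2 l, 0 < l & nu (c i) b = l *: nu (c i) b') /\ dot (nu (c i) b) (c i b - c i b') = 0.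
Proof.
move=> [p [q arcE]]; set w := q - p in arcE; set n := perp w.
have cE (b : R) : 0 <= b <= 1 -> exists r : R, c i b = p + r *: w.
  move=> b01; have : Defs.arc (c i) (c i b) by exists b; rewrite //= in_itv.
  by rewrite arcE => -[r _ <-]; exists r.
have pw (v : 'rV[R]_2) : dot (perp v) v = 0 by plane.
have nw : dot n w = 0 by exact: pw.
have nc (b : R) : 0 <= b <= 1 -> dot n (c i b) = dot n p.
  by move=> /cE[r ->]; rewrite dotDr dotZr nw mulr0 addr0.
have h01 : (0 : R) <= (0 : R) <= (1 : R) by rewrite lexx ler01.
have h11 : (0 : R) <= (1 : R) <= (1 : R) by rewrite lexx ler01.
have nc1 (b : R) : 0 <= b <= 1 -> dot n (derive1 (c i) b) = 0.
  move=> b01; apply/eqP; rewrite -normr_le0; apply/ler_addgt0Pl => e e0.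
  have /is_derive_epsP/(_ e e0)[d d0 dP] := is_derive_dot n (arc_derive hs hU i b01).
  have half0 : (0 : R) < 2^-1 by rewrite invr_gt0.
  have [h [h0 hd h1]] := pos_min2 d0 half0.
  (* The increment goes right or left so as to stay in [0, 1], the only times at which the arc is
     known to lie on the line. *)
  have [h' h'h bh'] : exists2 h' : R, `|h'| = h & 0 <= b + h' <= 1.
    have [bh|bh] := leP b (2^-1).
      exists h; first exact: gtr0_norm.
      by case/andP: b01 => b0 b1; apply/andP; split; lra.
    exists (- h); first by rewrite normrN gtr0_norm.
    by case/andP: b01 => b0 b1; apply/andP; split; lra.
  have := dP h'; rewrite h'h => /(_ hd); rewrite [h' *: 1]mulr1 !nc // subrr sub0r normrN.
  by rewrite /GRing.scale /= normrM h'h mulrC ler_pM2r // addr0.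
have w0 : w != 0.
  apply: contraTneq (pb_regular hU i h01) => w0.
  have e : c i 0 = c i (1/2).
    have [r ->] := cE _ h01; have [|r' ->] := cE (1/2).
      by apply/andP; split; lra.
    by rewrite w0 !scaler0.
  have [|||_ + _] := pb_simple hU _ _ _ e; lra.
have ww : 0 < dot w w by rewrite dot_gt0.
pose M (b : R) := dot w (derive1 (c i) b) / dot w w.
have c1E (b : R) : 0 <= b <= 1 -> derive1 (c i) b = M b *: w.
  move=> /nc1; rewrite /M /n; move: (derive1 (c i) b) => u e.
  have n0 : perp w != 0 by rewrite perp_neq0.
  have E := orth_perp n0 (etrans (dotC u (perp w)) e).
  have pp (v : 'rV[R]_2) : dot (perp v) (perp v) = dot v v by plane.
  by rewrite {1}E perpK pp dotNr mulNr scaleNr scalerN opprK dotC.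
have M0 (b : R) : 0 <= b <= 1 -> M b != 0.
  by move=> b01; have := pb_regular hU i b01; rewrite c1E // scaler_eq0 negb_or => /andP[].
split=> [pi|b b' b01 b'01].
  have [xi xi01] := arc_MVT hs hU i w (lexx 0) ler01 (lexx 1).
  rewrite -[X in c i X](add0r 1) pi subrr subr0 mulr1 (c1E _ xi01) dotZr => /eqP.
  by rewrite eq_sym mulf_eq0 (negbTE (M0 _ xi01)) gt_eqF.
have Mpos : 0 < M b / M b'.
  have H (a a' : R) : 0 <= a <= 1 -> 0 <= a' <= 1 -> a <= a' -> ~ (M a * M a' < 0).
    move=> a01 a'01 aa' neg.
    have [||x xaa' Mx] := @IVT R M a a' 0 aa'.
    - apply: continuous_in_subspaceT => z /set_mem /=; rewrite in_itv /= => /andP[az za'].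
      have z01 : 0 <= z <= 1.
        by rewrite (le_trans (proj1 (andP a01)) az) (le_trans za' (proj2 (andP a'01))).
      apply: cvgM; last exact: cvg_cst.
      by apply: cvg_dot; [exact: cvg_cst|exact: (arc_continuous1 hs hU (i := i))].
    - exact: minmax_sign neg.
    have : 0 <= x <= 1.
      move: xaa'; rewrite in_itv /= => /andP[ax xa'].
      by rewrite (le_trans (proj1 (andP a01)) ax) (le_trans xa' (proj2 (andP a'01))).
    by move=> /M0; rewrite Mx eqxx.
  have e : M b / M b' = M b * M b' / (M b' ^+ 2) by exact: (div_mul_sqr _ (M0 _ b'01)).
  rewrite e divr_gt0 ?exprn_even_gt0 ?M0 //.
  rewrite lt_neqAle eq_sym mulf_neq0 ?M0 //= leNgt; apply/negP => neg.
  by case/orP: (le_total b b') => bb; [apply: (H b b')|apply: (H b' b); rewrite 1?mulrC].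
have nuE (r : R) : 0 <= r <= 1 -> nu (c i) r = M r *: n by move=> r01; rewrite /nu (c1E _ r01) perpZ.
split; first exists (M b / M b'); first exact: Mpos.
  by rewrite (nuE _ b01) (nuE _ b'01) scalerA (divfK (M0 _ b'01)).
by rewrite (nuE _ b01) dotZl dotBr !nc // subrr mulr0.
Qed.

End LocalClosest.

Lemma enormZ (R : realType) (a : R) (u : 'rV[R]_2) : enorm (a *: u) = `|a| * enorm u.
Proof.
by rewrite /enorm dotZl dotZr mulrA -expr2 sqrtrM ?sqr_ge0 // sqrtr_sqr.
Qed.

Lemma open_normball (R : realType) (x : 'rV[R]_2) (e : R) : 0 < e ->
  open_nbhs x [set z | `|z - x| < e].
Proof.
move=> e0; split; last by rewrite /= subrr normr0.
rewrite openE => z /= ze; apply/interior_ballP; exists (e - `|z - x|).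
  by rewrite subr_gt0.
move=> w wz /=; rewrite -(subrK z w) -addrA; apply: le_lt_trans (ler_normD _ _) _.
by rewrite -ltrBrDr.
Qed.

Lemma ball_itv01 (R : realType) (t d b : R) : d < t -> d < 1 - t -> `|b - t| < d -> 0 <= b <= 1.
Proof. by move=> dt dt1; rewrite ltr_norml => /andP[h1 h2]; apply/andP; split; lra. Qed.

Lemma scale_unscale (R : realType) (m e : R) (u : 'rV[R]_2) : e != 0 ->
  m *: u = (m * e) *: (e^-1 *: u).
Proof. by move=> e0; rewrite scalerA mulfK. Qed.

Lemma affine_solve (F : fieldType) (y l b : F) : y != 0 -> l = y^-1 * (b + l * y) + - (b / y).
Proof. by move=> y0; field. Qed.

Section FlatDistance.
Variable R : realType.
Variables (s : regularity R) (K : set 'rV[R]_2) (g : R -> 'rV[R]_2).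
Hypothesis hs : admissible s.
Hypothesis hK : gauge_body s K g.
Variables (U : set 'rV[R]_2) (N : nat) (c : 'I_N -> R -> 'rV[R]_2) (succ : {perm 'I_N}).
Hypothesis oU : open U.
Hypothesis bU : bounded_set U.
Hypothesis hU : piecewise_boundary c succ s U.
Hypothesis hBA : boundary_assumption c succ g.

Let K0 : interior K 0 := gb_zero hK.

(** The common target of the flat and nonflat cases, written with the normal of the arc and the
    support point [k]. Crossing with [k] replaces the product with [zeta], up to sign and length. *)
Definition regular_with_formulas x i (t : R) k :=
  (exists2 A : set 'rV[R]_2, open_nbhs x A & of_class s A (distK K U)) /\
  forall v w, 'D_v (distK K U) x = dot (nu (c i) t) v / dot (nu (c i) t) k /\
    'D_v ('D_w (distK K U)) x = - (curvature (c i) t * enorm (nu (c i) t) ^+ 3) /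
      (dot (nu (c i) t) k ^+ 3 * (1 - Kcurvature K g (c i) t * distK K U x)) *
      cross v k * cross w k.

(** All nearby closest points lie on the same segment with the same normal direction, so they share
    the support point [g a]; projecting on [n] makes the distance affine. *)
Lemma distance_flat x i (t a : R) : U x -> 0 <= t <= 1 -> good c i t -> closest K U x (c i t) ->
  (forall z, closest K U x z -> z = c i t) ->
  (distK K U x)^-1 *: (x - c i t) = g a -> curvature g a = 0 -> regular_with_formulas x i t (g a).
Proof.
move=> Ux t01 gt cx uy ka cg.
have km := maximizes_closest hs hK oU hU Ux gt cx ka.
have c10 := good_regular hU gt; have n0 : nu (c i) t != 0 by rewrite perp_neq0.
have [l l0 nE] := maximizes_normal hs hK n0 km.
have g10 : nu g a != 0 by rewrite perp_neq0; exact: bp_regular (gb_boundary hK) a.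
(* Flat normals are outward for K, and the inward normal of the arc is a negative multiple of the
   inward normal of K at [g a]. *)
have fn : flat_normals g ((enorm (nu (c i) t))^-1 *: nu (c i) t).
  exists a; first exact: cg.
  rewrite nE enormZ normrN (gtr0_norm l0) scalerA mulrN scaleNr; congr (- (_ *: _)).
  by rewrite invfM mulrAC (mulVf (lt0r_neq0 l0)) mul1r.
have it : interior_time c i t by case: gt => [|[pi _]]; [left|right].
have sg : is_segment (c i).
  have [cp|//] := hBA (or_introl it) fn.
  by have := curvature_not_pos hs hK oU hU Ux gt cx ka cg.
have [np seg] := segment_arc hs hU sg.
have e0 : 0 < enorm (nu (c i) t) by rewrite enorm_gt0.
have fs : flat_segment g (c i).
  split=> //; eexists; first exact: fn.
  move=> b b01; have [[m m0 ->] _] := seg b t b01 t01.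
  exists (m * enorm (nu (c i) t)); first exact: mulr_gt0.
  exact: scale_unscale (lt0r_neq0 e0).
have Kc0 : Kcurvature K g (c i) t = 0 by rewrite /Kcurvature asboolT.
have [t0 t1] : 0 < t /\ t < 1 by case: gt => [/andP[]|[]].
have t1' : 0 < 1 - t by rewrite subr_gt0.
have [d [d0 dt dt1]] := pos_min2 t0 t1'.
have inn (b : R) : `|b - t| < d -> 0 <= b <= 1.
  exact: ball_itv01 dt dt1.
have [e e'0 eP] := closest_nearby hs hK oU bU hU Ux gt cx uy ka d0.
have G0 : 0 < dot (nu (c i) t) (g a) := maximizes_gt0 K0 n0 km.
set n := nu (c i) t in km n0 nE fn e0 G0 *; set G := dot n (g a) in G0 *.
have segt (b : R) : 0 <= b <= 1 -> (exists2 m, 0 < m & nu (c i) b = m *: n) /\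
    dot n (c i b) = dot n (c i t).
  move=> b01; have [[m m0 nb] dE] := seg b t b01 t01; split; first by exists m.
  move: dE; rewrite nb dotZl dotBr => /eqP; rewrite mulf_eq0 gt_eqF //= subr_eq0.
  by move/eqP.
have dE z : `|z - x| < e -> distK K U z = dot (G^-1 *: n) z + - (dot n (c i t) / G).
  move=> /eP[_ [ta [sa [tad _ _ zE mz]]]].
  have [[m m0 nta] cta] := segt ta (inn ta tad).
  have kE : g sa = g a.
    apply: (maximizes_uniq hK n0) km; rewrite nta in mz.
    have mi0 : 0 < m^-1 by rewrite invr_gt0.
    by have := maximizesZ mi0 mz; rewrite scalerA (mulVf (lt0r_neq0 m0)) scale1r.
  rewrite kE in zE; rewrite {2}zE dotZl dotDr dotZr cta -/G.
  exact: affine_solve (lt0r_neq0 G0).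
have [oA Ax] := open_normball x e'0.
set A := [set z | _] in oA Ax.
split; first by exists A => //; exact: (affine_class oA dE).
move=> v w; split.
  have [_ ->] := affine_derive oA dE [::] v Ax.
  by rewrite /= dotZl mulrC.
(* The segment has no curvature, because [dot n] of its velocity vanishes around [t]; this makes the
   Hessian formula agree with that of an affine function. *)
have c2n : curvature (c i) t * enorm n ^+ 3 = 0.
  rewrite (curvatureE (good_derive2 hs hU gt) c10).
  have H := is_derive_dot n (good_derive2 hs hU gt).
  have [oB Bt] : open_nbhs t (`]0, 1[%classic : set R).
    by split; [exact: interval_open|rewrite /= in_itv /= t0 t1].
  have H0 : is_derive t 1 (fun b => dot n (derive1 (c i) b)) 0.
    apply: (near_is_derive (conj oB Bt) _ (is_derive_cst (0 : R) t 1)) => b.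
    rewrite /= in_itv /= => /andP[b0 b1].
    have [|[m m0 nb] _] := segt b; first by rewrite !ltW.
    have : dot (nu (c i) b) (derive1 (c i) b) = 0.
      by rewrite /nu; move: (derive1 (c i) b) => u; plane.
    by rewrite nb dotZl => /eqP; rewrite mulf_eq0 gt_eqF //= => /eqP ->.
  by rewrite dotC; exact: is_derive_unique H H0.
rewrite c2n oppr0 !mul0r.
by have [_ ->] := affine_derive oA dE [:: w] v Ax.
Qed.

End FlatDistance.

(** * Directions in which the curvature of K is positive *)

Section LocalSolution.
Variable R : realType.
Implicit Types (c g : R -> 'rV[R]_2) (A : set 'rV[R]_2) (B : set R).

(** The radius [d] is fixed before the neighbourhood [A]: in the analytic case it is limited by the
    derivative bounds of both curves, and [A] has to be shrunk to fit. *)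
Lemma solution_class s B c g (t a : R) : admissible s -> open B -> B t ->
  of_class s B c -> of_class s setT g ->
  exists2 d : R, 0 < d & (forall b, `|b - t| <= d -> B b) /\
    forall A (tau sigma lam : 'rV[R]_2 -> R) (L C : R), open A -> 0 < L ->
    (forall z, A z -> [/\ `|tau z - t| <= d, `|sigma z - a| <= d, `|lam z| <= L,
      L^-1 <= `|mu_at c g tau sigma z| & L^-1 <= `|jac_at c g tau sigma lam z|]) ->
    (forall u w, A u -> A w -> [/\ `|tau u - tau w| <= C * `|u - w|,
      `|sigma u - sigma w| <= C * `|u - w| & `|lam u - lam w| <= C * `|u - w|]) ->
    (forall z, A z -> solves c (drv c 1) g (drv g 1) z (tau z) (sigma z) (lam z)) ->
    of_class s A lam.
Proof.
move=> hs oB Bt hc hg.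
have [d0 d00 d0B] : exists2 d : R, 0 < d & forall b, `|b - t| < d -> B b.
  by apply/nbhs_ballN; exact: open_nbhs_nbhs.
have lt_le_B (d : R) : d < d0 -> forall b, `|b - t| <= d -> B b.
  by move=> dd b bt; apply: d0B; exact: le_lt_trans dd.
case: s hs hc hg => [k al [k2 al01] [Ckc hc] [Ckg hg]|_ hc hg|_ [hc tc] [hg tg]].
- have [d [dp dd _]] := pos_min2 d00 d00; exists d => //; split; first exact: lt_le_B.
  move=> A tau sigma lam L C oA L0 hA hLip hsol.
  have sk : size (nseq k (1 : R)) = k by rewrite size_nseq.
  exact: (solution_Holder oB oA dp L0 (lt_le_B d dd) hA hLip hsol k2 al01 Ckc (hc _ sk) Ckg (hg _ sk)).
- have [d [dp dd _]] := pos_min2 d00 d00; exists d => //; split; first exact: lt_le_B.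
  move=> A tau sigma lam L C oA L0 hA hLip hsol.
  exact: (solution_smooth oB oA dp L0 (lt_le_B d dd) hA hLip hsol hc hg).
have [d1 [M1 [rho1 [d10 M10 rho10 b1]]]] := analytic_bounds oB hc Bt tc.
have [d2 [M2 [rho2 [d20 M20 rho20 b2]]]] := analytic_bounds openT hg (I : setT a) tg.
have [d3 [d30 d31 d32]] := pos_min2 d10 d20.
have [d [dp dd dd3]] := pos_min2 d00 d30.
exists d => //; split; first exact: lt_le_B.
move=> A tau sigma lam L C oA L0 hA hLip hsol.
have M0 : 0 <= M1 + M2 by rewrite addr_ge0.
have rho0 : 0 <= rho1 + rho2 by rewrite addr_ge0.
have grow (M M' r r' : R) (l : nat) : 0 <= M -> 0 <= M' -> 0 <= r -> 0 <= r' ->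
    M * r ^+ l * (l`!)%:R <= (M + M') * (r + r') ^+ l * (l`!)%:R.
  move=> h1 h2 h3 h4; apply: ler_wpM2r => //; apply: ler_pM => //; first exact: exprn_ge0.
    by rewrite lerDl.
  by apply: lerXn2r; rewrite ?nnegrE ?addr_ge0 // lerDl.
split; first exact: (solution_smooth oB oA dp L0 (lt_le_B d dd) hA hLip hsol hc hg).
apply: (solution_analytic oB oA dp L0 (lt_le_B d dd) hA hLip hsol M0 rho0 hc hg) => b bd l j.
  have bd1 : `|b - t| < d1 by apply: le_lt_trans bd _; exact: lt_trans d31.
  by apply: le_trans (b1 b bd1 l j) _; exact: grow.
have bd2 : `|b - a| < d2 by apply: le_lt_trans bd _; exact: lt_trans d32.
apply: le_trans (b2 b bd2 l j) _; rewrite [M1 + _]addrC [rho1 + _]addrC; exact: grow.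
Qed.

Lemma near_lower_bound (x : 'rV[R]_2) (f : 'rV[R]_2 -> R) : {for x, continuous f} -> f x != 0 ->
  \forall z \near x, `|f x| / 2 <= `|f z|.
Proof.
move=> /continuous_epsP cf f0; apply/nbhs_ballN.
have h : 0 < `|f x| / 2 by rewrite divr_gt0 // normr_gt0.
have [d d0 dP] := cf _ h; exists d => // z /dP hz.
have := ler_normB (f z) (f z - f x); rewrite opprB addrC subrK.
by move: hz; move: (`|f z - f x|) (`|f x|) (`|f z|) => p q r; lra.
Qed.

Lemma is_derive_curve c (f : 'rV[R]_2 -> R) x v df (dc : 'rV[R]_2) : is_derive x v f df ->
  is_derive (f x) 1 c dc -> is_derive x v (fun z => c (f z)) (df *: dc).
Proof.
move=> fd cd; apply: is_derive_row2; rewrite mxE mulrC;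
  exact: (is_derive_comp1 fd (is_derive_coord _ cd)).
Qed.

Lemma is_derive_dot2 (f h : 'rV[R]_2 -> 'rV[R]_2) x v df dh : is_derive x v f df ->
  is_derive x v h dh ->
  is_derive x v (fun z => dot (f z) (h z)) (dot df (h x) + dot (f x) dh).
Proof.
move=> fd hd.
have -> : (fun z => dot (f z) (h z)) =
    (fun z => f z 0 0) \* (fun z => h z 0 0) + (fun z => f z 0 1) \* (fun z => h z 0 1).
  by apply/funext => z; rewrite dotE.
have H j := is_deriveM (is_derive_coord j fd) (is_derive_coord j hd).
have [D1 D2] := is_deriveD (H 0) (H 1); apply: DeriveDef; first exact: D1.
by rewrite D2 !dotE /GRing.scale /=; ring.
Qed.

End LocalSolution.

Section ImplicitDistance.
Variable R : realType.
Variables (s : regularity R) (B : set R) (c g : R -> 'rV[R]_2) (x : 'rV[R]_2) (t a : R).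
Variable lam : 'rV[R]_2 -> R.
Hypothesis hs : admissible s.
Hypothesis oB : open B.
Hypothesis Bt : B t.
Hypothesis hc : of_class s B c.
Hypothesis hg : of_class s setT g.

Local Notation J := (jac0 (drv c 1) (drv c 2) g (drv g 1) (drv g 2) t a (lam x)).
Local Notation n := (perp (drv c 1 t)).
Local Notation sol := (solves c (drv c 1) g (drv g 1)).
Hypothesis J0 : J != 0.
Hypothesis G0 : dot n (g a) != 0.
Hypothesis hx : sol x t a (lam x).
Hypothesis clam : {for x, continuous lam}.
Hypothesis hnear : forall d : R, 0 < d -> exists2 e : R, 0 < e & forall z, `|z - x| < e ->
  exists ta sa : R, [/\ `|ta - t| < d, `|sa - a| < d & sol z ta sa (lam z)].

(** The parameters are selected by choice from the existing solutions. The Lipschitz estimate makes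
    the selection unique and continuous, after which the bounds on the determinant and the normal
    component hold on a smaller ball. *)
Lemma local_solution : exists A (tau sigma : 'rV[R]_2 -> R) (d L C : R),
  [/\ open_nbhs x A, 0 < L, forall b, `|b - t| <= d -> B b, tau x = t /\ sigma x = a & of_class s A lam] /\
  [/\ forall z, A z -> [/\ `|tau z - t| <= d, `|sigma z - a| <= d, `|lam z| <= L,
      L^-1 <= `|mu_at c g tau sigma z| & L^-1 <= `|jac_at c g tau sigma lam z|],
    forall u w, A u -> A w -> [/\ `|tau u - tau w| <= C * `|u - w|,
      `|sigma u - sigma w| <= C * `|u - w| & `|lam u - lam w| <= C * `|u - w|] &
    forall z, A z -> sol z (tau z) (sigma z) (lam z)].
Proof.
have C2c := of_class_C2 hs hc; have C2g := of_class_C2 hs hg.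
have [d0 d00 [d0B cls]] := solution_class a hs oB Bt hc hg.
have [d1 d10 [C lip]] := solution_lipschitz (Ck_near_derive oB C2c (l := 0) (isT : (0 < 2)%N) Bt)
  (Ck_near_derive oB C2c (l := 1) (isT : (1 < 2)%N) Bt) (Ck_drv C2c (isT : (2 <= 2)%N) Bt)
  (Ck_near_derive openT C2g (l := 0) (isT : (0 < 2)%N) (I : setT a))
  (Ck_near_derive openT C2g (l := 1) (isT : (1 < 2)%N) (I : setT a))
  (Ck_drv C2g (isT : (2 <= 2)%N) (I : setT a)) J0 G0 hx.2.
have [d [dp dd0 dd1]] := pos_min2 d00 d10.
have [e1 e10 e1P] := hnear dp.
have [e2 e20 e2P] := (continuous_epsP _ _).1 clam d1 d10.
have [e [ep ee1 ee2]] := pos_min2 e10 e20.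
have [f fP] : exists f : 'rV[R]_2 -> R * R, forall z, `|z - x| < e ->
    [/\ `|(f z).1 - t| < d, `|(f z).2 - a| < d & sol z (f z).1 (f z).2 (lam z)].
  have H z : exists p : R * R, `|z - x| < e ->
      [/\ `|p.1 - t| < d, `|p.2 - a| < d & sol z p.1 p.2 (lam z)].
    have [ze|nz] := pselect (`|z - x| < e); last by exists (t, a).
    by have [ta [sa h]] := e1P z (lt_trans ze ee1); exists (ta, sa).
  by have [f fP] := choice H; exists f.
pose tau z := (f z).1; pose sigma z := (f z).2.
have lipA u w : `|u - x| < e -> `|w - x| < e -> [/\ `|tau u - tau w| <= C * `|u - w|,
      `|sigma u - sigma w| <= C * `|u - w| & `|lam u - lam w| <= C * `|u - w|].
  move=> ue we; have [h1 h2 h3] := fP u ue; have [h4 h5 h6] := fP w we.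
  apply: (lip _ _ _ _ _ _ _ _ h3 h6).
  - exact: lt_trans h1 dd1.
  - exact: lt_trans h2 dd1.
  - exact: e2P (lt_trans ue ee2).
  - exact: lt_trans h4 dd1.
  - exact: lt_trans h5 dd1.
  - exact: e2P (lt_trans we ee2).
have [oA Ax] := open_normball x ep.
have [tx sx] : tau x = t /\ sigma x = a.
  have xe : `|x - x| < e by [].
  have [h1 h2 h3] := fP x xe.
  (* Uniqueness: the selected solution at [x] is compared with the given one, at distance 0. *)
  have [||||||h4 h5 _] := lip x x _ _ _ _ _ _ h3 hx.
  - exact: lt_trans h1 dd1.
  - exact: lt_trans h2 dd1.
  - by rewrite subrr normr0.
  - by rewrite subrr normr0.
  - by rewrite subrr normr0.
  - by rewrite subrr normr0.
  move: h4 h5; rewrite [x - x]subrr normr0 mulr0 !normr_le0 !subr_eq0.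
  by move=> /eqP h4 /eqP h5.
have al01 : (0 : R) <= (0 : R) <= (1 : R) by rewrite lexx ler01.
have ctau : {for x, continuous tau}.
  have H u w (Au : `|u - x| < e) (Aw : `|w - x| < e) : `|tau u - tau w| <= C * `|u - w| by have [] := lipA u w Au Aw.
  by have [+ _] := holder_lipschitz al01 oA H; apply.
have csig : {for x, continuous sigma}.
  have H u w (Au : `|u - x| < e) (Aw : `|w - x| < e) : `|sigma u - sigma w| <= C * `|u - w| by have [] := lipA u w Au Aw.
  by have [+ _] := holder_lipschitz al01 oA H; apply.
have FF : Filter (nbhs x) by exact: nbhs_filter.
have cc l : (l <= 2)%N -> drv c l (tau z) @[z --> x] --> drv c l (tau x).
  move=> l2; apply: (cvg_comp _ _ ctau).
  by apply: (Ck_drv C2c l2); rewrite tx.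
have cg l : (l <= 2)%N -> drv g l (sigma z) @[z --> x] --> drv g l (sigma x).
  by move=> l2; apply: (cvg_comp _ _ csig); exact: (Ck_drv C2g l2).
have cmu : {for x, continuous (mu_at c g tau sigma)}.
  exact: (cvg_dot (FF := FF) (cvg_perp (FF := FF) (cc 1%N isT)) (cg 0%N isT)).
have cjac : {for x, continuous (jac_at c g tau sigma lam)}.
  apply: cvgB; apply: cvgM.
  - exact: (cvg_dot (FF := FF) (cvg_perp (FF := FF) (cc 1%N isT)) (cg 2%N isT)).
  - exact: (cvg_cross (FF := FF) (cc 1%N isT) (cg 0%N isT)).
  - apply: cvgM; last exact: clam.
    exact: (cvg_dot (FF := FF) (cvg_perp (FF := FF) (cc 2%N isT)) (cg 1%N isT)).
  - exact: (cvg_cross (FF := FF) (cg 1%N isT) (cg 0%N isT)).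
have mu0 : mu_at c g tau sigma x != 0 by rewrite /mu_at tx sx.
have jac0' : jac_at c g tau sigma lam x != 0 by rewrite /jac_at tx sx.
have nm := near_lower_bound cmu mu0; have nj := near_lower_bound cjac jac0'.
have [e3 e30 e3P] := (nbhs_ballN _ _).1 (filterI nm nj).
have [e4 [e40 e4e e43]] := pos_min2 ep e30.
set mx := `|mu_at c g tau sigma x| in nm e3P; set jx := `|jac_at c g tau sigma lam x| in nj e3P.
have mx0 : 0 < mx by rewrite normr_gt0.
have jx0 : 0 < jx by rewrite normr_gt0.
(* Large enough to bound [lam] and the two inverses at once, as half of each value at [x] survives
   nearby. *)
pose L := 2 / mx + 2 / jx + `|lam x| + d1.
have p1 : 0 < 2 / mx by rewrite divr_gt0.
have p2 : 0 < 2 / jx by rewrite divr_gt0.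
have p3 := normr_ge0 (lam x).
have [L0 Lm Lj Ll] : [/\ 0 < L, 2 / mx <= L, 2 / jx <= L & `|lam x| + d1 <= L].
  by rewrite /L; move: p1 p2 p3 d10; clear; move: (2 / mx) (2 / jx) `|lam x| => p q r *; split; lra.
have [oA4 A4x] := open_normball x e40.
have bnd z : `|z - x| < e4 -> [/\ `|tau z - t| <= d0, `|sigma z - a| <= d0, `|lam z| <= L,
      L^-1 <= `|mu_at c g tau sigma z| & L^-1 <= `|jac_at c g tau sigma lam z|].
  move=> ze; have [h1 h2 _] := fP z (lt_trans ze e4e).
  have [h3 h4] := e3P z (lt_trans ze e43).
  have inv_half (m : R) : 0 < m -> 2 / m <= L -> L^-1 <= m / 2.
    by move=> m0 mL; rewrite -[m / 2]invrK invf_div lef_pV2 // posrE ?divr_gt0.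
  split.
  - exact: ltW (lt_trans h1 dd0).
  - exact: ltW (lt_trans h2 dd0).
  - apply: le_trans Ll; rewrite -(subrK (lam x) (lam z)) addrC; apply: le_trans (ler_normD _ _) _.
    by rewrite lerD2l; apply: ltW; exact: e2P (lt_trans (lt_trans ze e4e) ee2).
  - exact: le_trans (inv_half _ mx0 Lm) h3.
  - exact: le_trans (inv_half _ jx0 Lj) h4.
have lip4 u w : `|u - x| < e4 -> `|w - x| < e4 -> [/\ `|tau u - tau w| <= C * `|u - w|,
      `|sigma u - sigma w| <= C * `|u - w| & `|lam u - lam w| <= C * `|u - w|].
  by move=> ue we; exact: lipA (lt_trans ue e4e) (lt_trans we e4e).
have sol4 z : `|z - x| < e4 -> sol z (tau z) (sigma z) (lam z).
  by move=> ze; have [] := fP z (lt_trans ze e4e).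
exists [set z | `|z - x| < e4], tau, sigma, d0, L, C; split; split=> //.
exact: cls oA4 L0 bnd lip4 sol4.
Qed.

Let quotient_rule (p q r u h : R) : h != 0 ->
  q * (- h ^- 2 * (p * u)) + h^-1 * (p * r) = p * (r * h - q * u) / h ^+ 2.
Proof. by move=> h0; field. Qed.

(** The first derivative n·w / G is differentiated again along the solution. The variation of
    [sigma] drops out because g' is orthogonal to the normal, so only the derivative of [tau]
    remains. *)
Lemma local_solution_derivatives :
  (exists2 A : set 'rV[R]_2, open_nbhs x A & of_class s A lam) /\
  forall v w, 'D_v lam x = dot n v / dot n (g a) /\
    'D_v ('D_w lam) x = beta0 (drv c 1) (drv g 2) t a * cross v (g a) / J *
      (dot (perp (drv c 2 t)) w * dot n (g a) - dot n w * dot (perp (drv c 2 t)) (g a)) /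
      dot n (g a) ^+ 2.
Proof.
have C2c := of_class_C2 hs hc; have C2g := of_class_C2 hs hg.
have [A [tau [sigma [d [L [C [[[oA Ax] L0 dB [tx sx] cls] [bnd lip slv]]]]]]]] := local_solution.
have der z v (Az : A z) := solution_derivatives oB oA L0 dB bnd lip slv v C2c C2g Az.
split; first by exists A.
move=> v w; split.
  by have [_ _ [_ ->]] := der x v Ax; rewrite /mu_at tx sx.
have [td sd _] := der x v Ax; rewrite /jac_at tx sx in td sd.
set tv := _ / _ in td; set sv := _ / _ in sd.
have Dw z : A z -> dot (perp (drv c 1 (tau z))) w / mu_at c g tau sigma z = 'D_w lam z.
  by move=> Az; have [_ _ [_ ->]] := der z w Az.
have c1d : is_derive (tau x) 1 (drv c 1) (drv c 2 (tau x)).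
  by rewrite tx; exact: (Ck_is_derive C2c (l := 1)).
have g0d : is_derive (sigma x) 1 g (drv g 1 (sigma x)) by exact: (Ck_is_derive C2g (l := 0)).
have nd := is_derive_perp (is_derive_curve td c1d).
have gd := is_derive_curve sd g0d.
have wd := is_derive_dot w nd.
have mud := is_derive_dot2 nd gd.
have [wd1 wdE] := wd; have [mud1 mudE] := mud.
have mu0 : mu_at c g tau sigma x != 0 by rewrite /mu_at tx sx.
have H : is_derive x v (fun z => dot (perp (drv c 1 (tau z))) w / mu_at c g tau sigma z)
    (dot (perp (drv c 1 (tau x))) w *: (- (mu_at c g tau sigma x) ^- 2 *:
       (dot (perp (tv *: drv c 2 (tau x))) (g (sigma x)) +
        dot (perp (drv c 1 (tau x))) (sv *: drv g 1 (sigma x)))) +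
     (mu_at c g tau sigma x)^-1 *: dot w (perp (tv *: drv c 2 (tau x)))).
  apply: is_deriveM.
    have -> : (fun z => dot (perp (drv c 1 (tau z))) w) = (fun z => dot w (perp (drv c 1 (tau z)))).
      by apply/funext => z; rewrite dotC.
    exact: wd.
  apply: DeriveDef; first exact: derivableV.
  by rewrite deriveV // mudE.
have [_ ->] := near_is_derive (conj oA Ax) Dw H.
rewrite /mu_at tx sx !dotZr hx.2 mulr0 addr0 /GRing.scale /= [dot w _]dotC.
have E p q : dot (perp (tv *: p)) q = tv * dot (perp p) q by rewrite perpZ dotZl.
rewrite !E; exact: quotient_rule.
Qed.

End ImplicitDistance.

Lemma hessian_value (F : fieldType) (be kl G q cv cw : F) : be != 0 -> kl != 0 -> G != 0 ->
  be * cv / (be * kl * G) * (- q * cw) / G ^+ 2 = - q / (G ^+ 3 * kl) * cv * cw.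
Proof. by move=> b0 k0 G0; field; rewrite b0 k0 G0. Qed.

(** The plane case of the Binet-Cauchy identity; it reveals the rank-one form of the Hessian. *)
Lemma cross_swap (R : realType) (p n w k : 'rV[R]_2) :
  dot p w * dot n k - dot n w * dot p k = cross p n * cross w k.
Proof. by plane. Qed.

(** For [b = 0] the point [y] would be both inside and outside; for [b < 0] one side of [y] would be
    both. *)
Lemma points_into_pos (R : realType) (U : set 'rV[R]_2) y n (b : R) :
  points_into U y n -> points_into U y (b *: n) -> 0 < b.
Proof.
move=> [e e0 H1] [e' e'0 H2]; rewrite ltNge le_eqVlt; apply/negP => /orP[/eqP b0|bn].
  have h : 0 < e' / 2 < e' by rewrite divr_gt0 //= ltr_pdivrMr // ltr_pMr // ltr1n.
  have [h1 h2] := H2 _ h; apply: h2; apply: subset_closure.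
  by move: h1; rewrite b0 scale0r scaler0 subr0 addr0.
have nb0 : 0 < - b by rewrite oppr_gt0.
have [r [r0 re' re]] := pos_min2 e'0 (divr_gt0 e0 nb0).
have [h1 _] := H2 r (introT andP (conj r0 re')).
have [|_ h2] := H1 (r * - b); first by rewrite mulr_gt0 // -ltr_pdivlMr.
by apply: h2; apply: subset_closure; move: h1; rewrite scalerA mulrN scaleNr opprK.
Qed.

Section NonFlat.
Variable R : realType.
Variables (s : regularity R) (K : set 'rV[R]_2) (g : R -> 'rV[R]_2).
Hypothesis hs : admissible s.
Hypothesis hK : gauge_body s K g.
Variables (U : set 'rV[R]_2) (N : nat) (c : 'I_N -> R -> 'rV[R]_2) (succ : {perm 'I_N}).
Hypothesis oU : open U.
Hypothesis bU : bounded_set U.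
Hypothesis hU : piecewise_boundary c succ s U.

Let K0 : interior K 0 := gb_zero hK.

(** A flat segment has a flat normal of K, whose support point is unique, so [a] is a flat parameter
    up to a period. In the nonflat case this excludes the branch of [Kcurvature] with value 0. *)
Lemma flat_segment_curvature i (t a : R) : 0 <= t <= 1 -> nu (c i) t != 0 ->
  maximizes K (nu (c i) t) (g a) -> flat_segment g (c i) -> curvature g a = 0.
Proof.
move=> t01 n0 km [_ [mu [b /= cb muE]]] /(_ t t01)[l l0 nE].
have gp := bp_periodic (gb_boundary hK).
have nb0 : nu g b != 0 by rewrite perp_neq0; exact: bp_regular (gb_boundary hK) b.
have e0 : 0 < l * (enorm (nu g b))^-1 by apply: mulr_gt0 => //; rewrite invr_gt0 enorm_gt0.
have kb : maximizes K (nu (c i) t) (g b).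
  have := maximizesZ e0 (normal_maximizes hs hK b).
  by rewrite nE -muE scalerN scalerN scalerA.
have [m ->] := periodic_inj hK (maximizes_uniq hK n0 km kb).
have p1 := periodic_derive1 gp.
have p2 : one_periodic (nu g) by move=> u; rewrite /nu p1.
have p3 := periodic_derive1 p2.
by rewrite /curvature (periodic_int p3) (periodic_int p2).
Qed.

(** The determinant is a product of three nonzero factors: curvature of K at the contact point, the
    hypothesis on [Kcurvature], and positivity of the support function. *)
Lemma distance_nonflat x i (t a : R) : U x -> 0 <= t <= 1 -> good c i t -> closest K U x (c i t) ->
  (forall z, closest K U x z -> z = c i t) ->
  (distK K U x)^-1 *: (x - c i t) = g a -> curvature g a != 0 ->
  Kcurvature K g (c i) t * distK K U x != 1 -> regular_with_formulas s K g U c x i t (g a).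
Proof.
move=> Ux t01 gt cx uy ka cg hk.
have km := maximizes_closest hs hK oU hU Ux gt cx ka.
have c10 := good_regular hU gt; have n0 : nu (c i) t != 0 by rewrite perp_neq0.
have d0 := dist_gt0 hK oU Ux cx.
have [l l0 nE] := maximizes_normal hs hK n0 km.
have g10 := bp_regular (gb_boundary hK) a.
have ng0 : nu g a != 0 by rewrite perp_neq0.
have b0 : dot (nu (c i) t) (derive1 (derive1 g) a) != 0.
  rewrite nE dotZl [dot (nu g a) _]dotC -(curvatureE (body_derive2 hs hK a) g10).
  apply: mulf_neq0; first by rewrite oppr_eq0 (lt0r_neq0 l0).
  by apply: mulf_neq0 => //; apply: expf_neq0; apply: lt0r_neq0; rewrite enorm_gt0.
have nf : ~ flat_segment g (c i).
  by move=> /(flat_segment_curvature t01 n0 km) E; rewrite E eqxx in cg.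
have c2d := good_derive2 hs hU gt.
have KE := KcurvatureE hs hK nf c2d c10 km b0.
have nv : dot (nu (c i) t) (derive1 g a) = 0 := maximizes_curve (body_derive hs hK a) km (body_K hK).
have JE := jac_Kcurvature (g a) (distK K U x) (erefl (nu (c i) t)) c10 nv b0 KE.
have kl0 : 1 - Kcurvature K g (c i) t * distK K U x != 0 by rewrite subr_eq0 eq_sym.
have G0 := lt0r_neq0 (maximizes_gt0 K0 n0 km).
have [B [oB Bsub hc]] := pb_class hU i.
have Bt : B t by apply: Bsub; rewrite /= in_itv.
have hx : solves (c i) (drv (c i) 1) g (drv g 1) x t a (distK K U x).
  split; last by rewrite !drv1.
  by rewrite -ka scalerA (divff (lt0r_neq0 d0)) scale1r addrC subrK.
have J0 : jac0 (drv (c i) 1) (drv (c i) 2) g (drv g 1) (drv g 2) t a (distK K U x) != 0.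
  by rewrite /jac0 /alpha0 /beta0 !drv1 !drv2 JE; apply: mulf_neq0 => //; exact: mulf_neq0.
have G0' : dot (perp (drv (c i) 1 t)) (g a) != 0 by rewrite drv1.
have clam : {for x, continuous (distK K U)}.
  have bU0 : bd U !=set0 by exists (c i t); exact: cx.1.
  have [C C0 CP] := dist_lipschitz hK oU bU bU0.
  apply/continuous_epsP => e e0; exists (e / C); first exact: divr_gt0.
  by move=> z; rewrite ltr_pdivlMr // mulrC => zC; apply: le_lt_trans (CP z x) zC.
have hnear (d : R) : 0 < d -> exists2 e : R, 0 < e & forall z, `|z - x| < e ->
    exists ta sa : R, [/\ `|ta - t| < d, `|sa - a| < d &
      solves (c i) (drv (c i) 1) g (drv g 1) z ta sa (distK K U z)].
  move=> dp; have [e e0 eP] := closest_nearby hs hK oU bU hU Ux gt cx uy ka dp.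
  exists e; first exact: e0.
  move=> z /eP[_ [ta [sa [h1 h2 _ zE mz]]]]; exists ta, sa; split; [exact: h1|exact: h2|].
  split; first exact: zE.
  rewrite !drv1; exact: (maximizes_curve (body_derive hs hK sa) mz (body_K hK)).
have [A D] := local_solution_derivatives hs oB Bt hc (bp_class (gb_boundary hK)) J0 G0' hx clam hnear.
split; first exact: A.
move=> v w; have [D1 D2] := D v w.
rewrite drv1 in D1.
split.
  exact: D1.
rewrite D2 /jac0 /alpha0 /beta0 !drv1 !drv2 JE (curvatureE c2d c10) cross_swap.
have -> : cross (perp (derive1 (derive1 (c i)) t)) (perp (derive1 (c i) t)) =
    - dot (derive1 (derive1 (c i)) t) (nu (c i) t).
  by rewrite /nu; move: (derive1 (derive1 (c i)) t) (derive1 (c i) t) => p q; plane.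
rewrite -?/(nu (c i) t).
exact: (hessian_value _ _ _ b0 kl0 G0).
Qed.

End NonFlat.

(** [k] is a multiple of [perp zeta], so crossing with [k] is taking the product with [zeta] up to a
    factor whose square is [dot k k], the factor in the Laplacian. *)
Lemma rank_one_derivatives (R : realType) (f : 'rV[R]_2 -> R) (x n k : 'rV[R]_2) (G h : R) :
  (forall v w, 'D_v f x = dot n v / G /\
    'D_v ('D_w f) x = h * cross v k * cross w k) ->
  [/\ grad f x = G^-1 *: n, laplacian f x = h * dot k k &
    forall zeta v w : 'rV[R]_2, enorm zeta = 1 -> dot zeta k = 0 ->
      'D_v ('D_w f) x = laplacian f x * dot v zeta * dot w zeta].
Proof.
move=> H.
have Hv v : 'D_v f x = dot n v / G by have [] := H v 0.
have Hw v w : 'D_v ('D_w f) x = h * cross v k * cross w k by have [] := H v w.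
have lapE : laplacian f x = h * dot k k.
  rewrite /laplacian /mxtrace !big_ord_recl big_ord0 !mxE !Hw /cross dotE !mxE /=; ring.
split=> //.
  by apply: row2P; rewrite !mxE Hv dotE !mxE /= ?mulr1 ?mulr0 ?addr0 ?add0r mulrC.
move=> zeta v w z1 zk; rewrite Hw lapE.
have zz : dot zeta zeta = 1 by rewrite -enorm_sqr z1 expr1n.
have z0 : zeta != 0 by rewrite -dot_gt0 zz.
have [m ->] : exists m, k = m *: perp zeta.
  by eexists; exact: orth_perp z0 (etrans (dotC k zeta) zk).
have cz u : cross u (m *: perp zeta) = m * dot u zeta by plane.
have pp : dot (perp zeta) (perp zeta) = 1 by rewrite -zz; plane.
by rewrite !cz dotZl dotZr pp; ring.
Qed.

Lemma laplacian_scale (F : fieldType) (q b e G kl k2 : F) : b != 0 -> G != 0 -> kl != 0 ->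
  - (q * e ^+ 3) / (G ^+ 3 * kl) * k2 = - q * (b * e) ^+ 3 * k2 / ((b * G) ^+ 3 * kl).
Proof. by move=> b0 g0 k0; field; rewrite b0 g0 k0. Qed.

Theorem theorem1 (R : realType) (s : regularity R)
    (K : set 'rV[R]_2) (g : R -> 'rV[R]_2)
    (U : set 'rV[R]_2) (N : nat) (c : 'I_N -> R -> 'rV[R]_2)
    (succ : {perm 'I_N}) (x y : 'rV[R]_2) (i : 'I_N) (t : R)
    (hs : admissible s)
    (hK : gauge_body s K g)
    (hUo : open U) (hUb : bounded_set U)
    (hU : piecewise_boundary c succ s U)
    (hBA : boundary_assumption c succ g)
    (hcorner : forall j, corner c j -> nonreentrant c succ j)
    (hx : (U `\` ridge K U) x)
    (hy : closest K U x y)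
    (ht : 0 <= t <= 1) (hyt : y = c i t)
    (hk : Kcurvature K g (c i) t * distK K U x != 1) :
  (exists2 A : set 'rV[R]_2, open_nbhs x A & of_class s A (distK K U)) /\
  forall nv : 'rV[R]_2, inward_normal U (c i) t nv ->
    [/\ grad (distK K U) x = (gauge (polar K) nv)^-1 *: nv,
        laplacian (distK K U) x =
          - curvature (c i) t * enorm nv ^+ 3
            * enorm (grad (gauge (polar K)) nv) ^+ 2
          / (gauge (polar K) nv ^+ 3
             * (1 - Kcurvature K g (c i) t * distK K U x))
      & forall zeta v w : 'rV[R]_2,
          enorm zeta = 1 -> dot zeta (y - x) = 0 ->
          'D_v ('D_w (distK K U)) x =
            laplacian (distK K U) x * dot v zeta * dot w zeta].
Proof.
subst y.
have [Ux nr] : U x /\ ~ ridge K U x := hx.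
have uy z : closest K U x z -> z = c i t.
  by move=> cz; apply: contrapT => zt; apply: nr; split=> //; exists z, (c i t).
have gt := closest_is_good hs hK hUo hU hcorner Ux ht hy.
have d0 := dist_gt0 hK hUo Ux hy.
have kB := closest_bd hK hUo Ux hy.
have [a ka] : exists a, (distK K U x)^-1 *: (x - c i t) = g a.
  by move: kB; rewrite -(bp_range (gb_boundary hK)) => -[a _ e]; exists a.
have [cls H] : regular_with_formulas s K g U c x i t (g a).
  have [cg|cg] := eqVneq (curvature g a) 0.
    exact: (distance_flat hs hK hUo hUb hU hBA Ux ht gt hy uy ka cg).
  exact: (distance_nonflat hs hK hUo hUb hU Ux ht gt hy uy ka cg hk).
split; first exact: cls.
move=> nv [nv1 nvU].
have km := maximizes_closest hs hK hUo hU Ux gt hy ka.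
have c10 := good_regular hU gt; have n0 : nu (c i) t != 0 by rewrite perp_neq0.
have G0 := maximizes_gt0 (gb_zero hK) n0 km.
(* Every inward normal is a positive multiple of [nu], and the formulas are invariant under such
   scaling: the gauge and the Euclidean norm are both homogeneous of degree 1. *)
have [b nvE] : exists b, nv = b *: nu (c i) t by eexists; exact: orth_perp c10 nv1.
have b0 : 0 < b by apply: (points_into_pos (good_into hU gt)); rewrite -nvE.
have nv0 : nv != 0 by rewrite nvE scaler_eq0 negb_or (lt0r_neq0 b0).
have kmv : maximizes K nv (g a) by rewrite nvE; exact: maximizesZ.
have gE : gauge (polar K) nv = b * dot (nu (c i) t) (g a).
  by rewrite (gauge_polar (gb_zero hK) nv0 kmv) nvE dotZl.
have grE := grad_polar hK nv0 kmv.
have kl0 : 1 - Kcurvature K g (c i) t * distK K U x != 0 by rewrite subr_eq0 eq_sym.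
(* The segment from [x] to its closest point has the direction of the support point, so
   orthogonality to one is orthogonality to the other. *)
have yx : c i t - x = - distK K U x *: g a.
  by rewrite -ka scalerA mulNr (divff (lt0r_neq0 d0)) scaleN1r opprB.
have [gr lap sec] := rank_one_derivatives H.
split.
- rewrite gr gE nvE scalerA; congr (_ *: _).
  by rewrite invfM mulrAC (mulVf (lt0r_neq0 b0)) mul1r.
- rewrite lap grE gE nvE enormZ (gtr0_norm b0) enorm_sqr.
  exact: (laplacian_scale _ _ _ (lt0r_neq0 b0) (lt0r_neq0 G0) kl0).
move=> zeta v w z1 zx; apply: sec z1 _; apply/eqP.
by move/eqP: zx; rewrite yx dotZr mulf_eq0 oppr_eq0 (gt_eqF d0).
Qed.
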